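(* Let $(X,\mathsf d)$ and $\mathsf E:X\to\mathbb R\cup\{+\infty\}$ satisfy the standing assumptions (A1)–(A3) and Assumption (S), and let $x,y\in X$ be such that for some (hence for every) $\varepsilon>0$ the $\varepsilon$-Schrödinger problem between $x$ and $y$ is solvable. Then the map $\varepsilon\mapsto\mathscr C_\varepsilon(x,y)$ belongs to $AC_{loc}([0,\infty))$, is left and right differentiable everywhere in $(0,\infty)$ and, for every $\varepsilon>0$, its left and right derivatives are given by $$\frac{d^-}{d\varepsilon}\mathscr C_\varepsilon(x,y)=2\varepsilon\max_{\Lambda_\varepsilon(x,y)}\mathcal I,\qquad\frac{d^+}{d\varepsilon}\mathscr C_\varepsilon(x,y)=2\varepsilon\min_{\Lambda_\varepsilon(x,y)}\mathcal I,$$ respectively (in particular, the maximum and the minimum are attained). Moreover the left derivative is left continuous and the right derivative is right continuous.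
   Context: Curves: for a metric space $(X,\mathsf d)$, $C([0,1],X)$ denotes the continuous curves $\gamma=(\gamma_t)_{t\in[0,1]}$, $|\dot\gamma_t|$ the metric speed of an absolutely continuous curve, and $AC^2([0,1],X)$ the absolutely continuous curves with $|\dot\gamma|\in L^2(0,1)$. Slope: $D(\mathsf E)=\{x\in X:\mathsf E(x)<\infty\}$. The slope $|\partial\mathsf E|(x)$ is $+\infty$ if $x\notin D(\mathsf E)$, $0$ if $x$ is isolated, and $|\partial\mathsf E|(x)=\limsup_{z\to x}\frac{[\mathsf E(x)-\mathsf E(z)]^+}{\mathsf d(x,z)}$ otherwise. $\mathrm{EVI}_\lambda$-gradient flow of $\mathsf E$ ($\lambda\in\mathbb R$) starting from $x$: a curve $(\gamma_t)_{t>0}$ in $AC_{loc}((0,\infty),X)$ with $\gamma_t\to x$ as $t\downarrow0$ and $\frac12\frac{d}{dt}\mathsf d^2(\gamma_t,z)+\frac\lambda2\mathsf d^2(\gamma_t,z)+\mathsf E(\gamma_t)\le\mathsf E(z)$ for all $z\in X$ and a.e. $t>0$. Standing assumptions: (A1) $(X,\mathsf d)$ is a complete separable metric space. (A2) $\mathsf E$ is lower semicontinuous, $\overline{D(\mathsf E)}=X$, and for every $\mathsf d$-bounded $B\subset X$ there is $c_B\in\mathbb R$ with $\mathsf E\ge c_B$ on $B$. (A3) There is $\lambda\in\mathbb R$ such that for every $x\in X$ there exists an $\mathrm{EVI}_\lambda$-gradient flow of $\mathsf E$ starting from $x$. Assumption (S): there is a Hausdorff topology $\sigma$ on $X$ such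 that every $\mathsf d$-bounded sequence has a $\sigma$-converging subsequence, and $\mathsf d$ (jointly in its two variables) and $|\partial\mathsf E|$ are sequentially $\sigma$-lower semicontinuous. Functionals on $C([0,1],X)$: $\mathcal A(\gamma)=\frac12\int_0^1|\dot\gamma_t|^2dt$ (equal to $+\infty$ if $\gamma$ is not absolutely continuous), $\mathcal I(\gamma)=\frac12\int_0^1|\partial\mathsf E|^2(\gamma_t)dt$, $\mathcal A_\varepsilon=\mathcal A+\varepsilon^2\mathcal I$ for $\varepsilon>0$ and $\mathcal A_0=\mathcal A$. Cost and minimizers, for $\varepsilon\ge0$: $\mathscr C_\varepsilon(x,y)=\inf\{\mathcal A_\varepsilon(\gamma):\gamma\in C([0,1],X),\ \gamma_0=x,\ \gamma_1=y\}$ and $\Lambda_\varepsilon(x,y)=\{\omega\in AC^2([0,1],X):\omega_0=x,\ \omega_1=y,\ \mathcal A_\varepsilon(\omega)=\mathscr C_\varepsilon(x,y)\}$. The $\varepsilon$-Schrödinger problem between $x$ and $y$ ($\varepsilon>0$) is solvable if this infimum is finite and attained. *)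

(* Defs.v *)
From HB Require Import structures.
From mathcomp Require Import all_boot all_order all_algebra.
From mathcomp Require Import all_classical all_reals all_analysis.

Set Implicit Arguments.
Unset Strict Implicit.
Unset Printing Implicit Defensive.

Import Order.TTheory GRing.Theory Num.Theory.
Import numFieldNormedType.Exports.

Local Open Scope classical_set_scope.
Local Open Scope ring_scope.

(* Curves on an interval J are represented by functions R -> X, constrained on J
   only; their values outside J are irrelevant. *)
Section Curves.
Context {R : realType} {X : metricType R}.
Local Notation mu := (@lebesgue_measure R).
Implicit Types (gamma : R -> X) (J : set R).

Definition abs_cont (a b : R) gamma :=
  exists2 f : R -> R, mu.-integrable `[a, b] (EFin \o f) &
    forall s t, a <= s -> s <= t -> t <= b ->
      mdist (gamma s) (gamma t) <= \int[mu]_(r in `[s, t]) f r.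

Definition abs_cont_loc J gamma :=
  forall a b, a <= b -> `[a, b] `<=` J -> abs_cont a b gamma.

(* |gamma'_t|; for an absolutely continuous curve the limit exists for a.e. t,
   elsewhere the value is arbitrary. *)
Definition metric_speed gamma (t : R) : R :=
  lim (mdist (gamma t) (gamma s) / `|s - t| @[s --> t^']).

Definition AC2 gamma := abs_cont 0 1 gamma /\
  mu.-integrable `[0, 1] (fun t => (metric_speed gamma t ^+ 2)%:E).

Definition curves_between (x y : X) : set (R -> X) :=
  [set gamma : R -> X | [/\ {within `[0, 1], continuous gamma}, gamma 0 = x &
                   gamma 1 = y]].

Definition action gamma : \bar R :=
  if `[< abs_cont 0 1 gamma >] then
    (2^-1%:E * \int[mu]_(t in `[0%R, 1%R]) (metric_speed gamma t ^+ 2)%:E)%E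
  else +oo%E.

End Curves.

Section MetricSpace.
Context {R : realType} (X : metricType R).

Definition metric_complete :=
  forall u : nat -> X, cauchy (u @ \oo) -> exists l : X, u @ \oo --> l.

Definition metric_separable := exists2 D : set X, countable D & dense D.

Definition metric_bounded (B : set X) :=
  exists M : R, forall x y, B x -> B y -> mdist x y <= M.

End MetricSpace.

Section Energy.
Context {R : realType} {X : metricType R}.
Local Notation mu := (@lebesgue_measure R).
Implicit Types (E : X -> \bar R) (x y z : X) (eps lambda : R) (gamma : R -> X).

Definition energy_dom E : set X := [set x | (E x < +oo)%E].

Definition slope E x : \bar R :=
  if `[< energy_dom E x >] then
    if `[< isolated [set: X] x >] then 0%E
    else limf_esup
      (fun z => (Order.max (E x - E z) 0 * ((mdist x z)^-1)%:E)%E) x^'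
  else +oo%E.

Definition EVI_flow E lambda x gamma :=
  [/\ abs_cont_loc `]0, +oo[ gamma,
      gamma t @[t --> 0^'+] --> x &
      forall z, let d2 := fun t => mdist (gamma t) z ^+ 2 in
        {ae mu, forall t : R, 0 < t -> derivable d2 t 1 /\
          ((2^-1 * derive1 d2 t + lambda / 2 * d2 t)%:E + E (gamma t) <= E z)%E}].

Definition assumption_A2 E :=
  [/\ lower_semicontinuous E, closure (energy_dom E) = [set: X] &
      forall B : set X, metric_bounded B ->
        exists c : R, forall x, B x -> (c%:E <= E x)%E].

Definition assumption_A3 E :=
  exists lambda, forall x, exists gamma, EVI_flow E lambda x gamma.

(* sigma is a second topology on the carrier of X, unrelated to the canonical
   one; Xs is X endowed with sigma. *)
Definition assumption_S E :=
  exists sigma : Topological X,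
    let Xs : topologicalType := Topological.Pack sigma in
    [/\ hausdorff_space Xs,
        forall u : nat -> X, metric_bounded (range u) ->
          exists2 phi : nat -> nat, {homo phi : m n / (m < n)%N} &
            exists l : Xs, (u (phi n) : Xs) @[n --> \oo] --> l,
        forall (u v : nat -> Xs) (x y : Xs),
          u @ \oo --> x -> v @ \oo --> y ->
          ((mdist (x : X) (y : X))%:E <=
             limn_einf (fun n => (mdist (u n : X) (v n : X))%:E))%E &
        forall (u : nat -> Xs) (x : Xs), u @ \oo --> x ->
          (slope E x <= limn_einf (fun n => slope E (u n)))%E].

Definition fisher E gamma : \bar R :=
  (2^-1%:E * \int[mu]_(t in `[0%R, 1%R]) (slope E (gamma t) ^+ 2))%E.

(* For eps = 0 this is [action gamma], since 0 * +oo = 0 in \bar R. *)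
Definition action_eps E eps gamma : \bar R :=
  (action gamma + (eps ^+ 2)%:E * fisher E gamma)%E.

Definition cost E eps x y : \bar R :=
  ereal_inf [set action_eps E eps gamma | gamma in curves_between x y].

Definition minimizers E eps x y : set (R -> X) :=
  [set omega : R -> X | [/\ AC2 omega, omega 0 = x, omega 1 = y &
                   action_eps E eps omega = cost E eps x y]].

Definition schrodinger_solvable E eps x y :=
  cost E eps x y \is a fin_num /\
  exists2 gamma, curves_between x y gamma &
    action_eps E eps gamma = cost E eps x y.

End Energy.

Section OneSided.
Context {R : realType}.
Implicit Types (f : R -> R) (a : R).

Definition diff_quot f a (h : R) : R := h^-1 * (f (a + h) - f a).

Definition left_derive f a : R := lim (diff_quot f a h @[h --> 0^'-]).
Definition right_derive f a : R := lim (diff_quot f a h @[h --> 0^'+]).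

Definition is_left_derive f a (l : R) := diff_quot f a h @[h --> 0^'-] --> l.
Definition is_right_derive f a (l : R) := diff_quot f a h @[h --> 0^'+] --> l.

(* m is the maximum (minimum) of F over A, attained and finite. *)
Definition is_max_over {T} (F : T -> \bar R) (A : set T) (m : R) :=
  (F @` A) m%:E /\ ubound (F @` A) m%:E.
Definition is_min_over {T} (F : T -> \bar R) (A : set T) (m : R) :=
  (F @` A) m%:E /\ lbound (F @` A) m%:E.

End OneSided.

(* Main.v *)
Require Import Defs.
From HB Require Import structures.
From mathcomp Require Import all_boot all_order all_algebra.
From mathcomp Require Import all_classical all_reals all_analysis.
From mathcomp Require Import measurable_realfun metric_structure.
From mathcomp Require Import ring lra.
Set Implicit Arguments.
Unset Strict Implicit.
Unset Printing Implicit Defensive.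
Import Order.TTheory GRing.Theory Num.Theory.
Import numFieldNormedType.Exports.
Local Open Scope classical_set_scope.
Local Open Scope ring_scope.

(** Fix x and y, and call a pair (a, b) of reals attainable when some curve from
x to y has action at most a and Fisher integral I at most b. For eps > 0 the
cost is the minimum of a + eps^2 b over attainable pairs, so as a function of
tau = eps^2 it is a lower envelope of affine functions. If tau < tau' and b, b'
are the rates (the second coordinates) of optimal pairs at tau, tau', testing
each pair at the other parameter gives
  (tau' - tau) b' <= C(tau') - C(tau) <= (tau' - tau) b.
Hence the optimal rates decrease with tau, and once limits of optimal pairs are
known to be optimal, the right (left) derivative in tau is the least (greatest)
optimal rate, with the stated one-sided continuity. The chain rule for
tau = eps^2 produces the factor 2 eps. Local absolute continuity holds on
(0, +oo) because C is locally Lipschitz there; it extends to 0 by monotone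
convergence, because C is nondecreasing and continuous at 0.

Two facts about the metric space feed this argument.

The set of attainable pairs is closed ([attainable_closed]). A curve has action
at most a exactly when there is V with d(g s, g t)^2 <= (t - s) (V t - V s) and
V 1 - V 0 <= 2 a ([action_energy_mod], [energy_mod_action]). This inequality
between points survives sigma-limits taken point by point, so a diagonal
extraction along a dense set of times replaces compactness in a space of curves;
Fatou's lemma and the lower semicontinuity of the slope handle I. The
characterization of the action rests on the existence of the metric derivative,
obtained from dyadic difference quotients, which form a martingale bounded in a
weighted L^2 space ([energy_controlled_ac], [metric_derivative]).

Every curve of finite action can be approximated, with arbitrarily close action,
by curves with finite I ([recovery]), so that the envelope at tau = 0 is the cost
for eps = 0. The gradient flow S_s is exp(|lambda| s)-Lipschitz
([contraction]) and, for fixed s > 0, bounds the slope on bounded sets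
([semigroup_slope_bounded]); the image of a curve under S_s therefore has
finite I and almost the same action. Its end points are wrong. They are repaired
by the curve eta with finite action and finite I that exists by solvability: run
eta from x to a nearby point of finite slope, then the flow of that point for
time s, which is Lipschitz with bounded slope ([semigroup_lipschitz],
[semigroup_slope]), then S_s applied to (eta backwards to x, the given curve,
eta backwards from y), and symmetrically at the other end. *)

(** * Dyadic martingales *)

Lemma ex_div_lt (R : realType) (x d : R) : 0 <= x -> 0 < d ->
  exists N : nat, (0 < N)%N /\ x / N%:R < d.
Proof.
move=> x0 d0; exists (Num.Def.archi_bound (x / d)).+1; split => //.
rewrite ltr_pdivrMr// mulrC -ltr_pdivrMr//.
apply: lt_le_trans (archi_boundP _) _; first by rewrite divr_ge0// ltW.
by rewrite ler_nat.
Qed.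

(** The increments sum to an integrable function, which dominates the whole
sequence; hence [f n] converges almost everywhere and dominated convergence
applies over every measurable subset. *)
Lemma L1_fast_cauchy d (T : measurableType d) (R : realType)
    (mu : {measure set T -> \bar R}) (D : set T) (f : nat -> T -> R) (C : R) :
  measurable D ->
  (forall n, mu.-integrable D (EFin \o f n)) ->
  (forall n, (\int[mu]_(x in D) (`|f n.+1 x - f n x|)%:E <= (C / 2 ^+ n)%:E)%E) ->
  exists2 h : T -> R, mu.-integrable D (EFin \o h) &
    forall A, measurable A -> A `<=` D ->
      \int[mu]_(x in A) f n x @[n --> \oo] --> \int[mu]_(x in A) h x.
Proof.
move=> mD fi fd.
have mf n : measurable_fun D (f n) by apply/measurable_EFinP/(measurable_int mu).
pose df k x : \bar R := (`|f k.+1 x - f k x|)%:E.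
have df0 k x : (0 <= df k x)%E by rewrite lee_fin.
have mdf k : measurable_fun D (df k).
  by apply/measurable_EFinP/measurableT_comp => //; exact: measurable_funB.
have dfs n x : (\sum_(0 <= k < n) df k x)%E = (\sum_(0 <= k < n) `|f k.+1 x - f k x|)%:E.
  by rewrite sumEFin.
pose g x : \bar R := (`|f 0 x|%:E + \sum_(k <oo) df k x)%E.
have mg0 : measurable_fun D (fun x => `|f 0 x|%:E).
  by apply/measurable_EFinP/measurableT_comp.
have msum : measurable_fun D (fun x => \sum_(k <oo) df k x)%E.
  by apply: (ge0_emeasurable_sum (P := xpredT)) => // k _.
have s0 x : (0 <= \sum_(k <oo) df k x)%E by apply: nneseries_ge0.
have gi : mu.-integrable D g.
  apply/integrableP; split; first exact: emeasurable_funD.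
  under eq_integral do rewrite gee0_abs ?adde_ge0 ?lee_fin//.
  rewrite ge0_integralD//.
  rewrite integral_nneseries//.
  apply: lte_add_pinfty; first by have /integrableP[] := fi 0%N.
  apply: (@le_lt_trans _ _ (C * 2)%:E); last exact: ltry.
  have C0 : 0 <= C.
    have := fd 0%N; rewrite expr0 divr1 -(lee_fin 0); apply: le_trans.
    by apply: integral_ge0 => x _; rewrite lee_fin.
  apply: lime_le.
    by apply: is_cvg_nneseries => n _ _; apply: integral_ge0.
  apply: nearW => n.
  apply: (@le_trans _ _ (\sum_(0 <= k < n) (C / 2 ^+ k)%:E)%E).
    by apply: lee_sum => k _; exact: fd.
  rewrite sumEFin lee_fin.
  suff -> : \sum_(0 <= i < n) C / 2 ^+ i = C * 2 - C * 2 / 2 ^+ n.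
    by rewrite gerBl// divr_ge0 ?exprn_ge0 ?mulr_ge0.
  elim: n => [|n ih]; first by rewrite big_geq// expr0 divr1 subrr.
  rewrite big_nat_recr//= ih exprS; field.
  by rewrite expf_neq0.
have fgs n x : `|f n x| <= `|f 0 x| + \sum_(0 <= k < n) `|f k.+1 x - f k x|.
  rewrite -[in leLHS](subrK (f 0 x) (f n x)) addrC (le_trans (ler_normD _ _))//.
  by rewrite lerD2l -(telescope_sumr (fun k => f k x))// ler_norm_sum.
have fg n x : (`|(f n x)%:E| <= g x)%E.
  apply: (@le_trans _ _ (`|f 0 x|%:E + \sum_(0 <= k < n) df k x)%E).
    by rewrite dfs -EFinD lee_fin.
  by rewrite leeD2l//; apply: nneseries_lim_ge => k _ _.
have cv x : (g x < +oo)%E -> cvgn (f ^~ x).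
  move=> gx.
  have -> : f ^~ x = (fun n => f 0 x + series (fun k => f k.+1 x - f k x) n).
    apply/funext => n; rewrite /series/= (telescope_sumr (fun k => f k x))//.
    by rewrite addrC subrK.
  apply: is_cvgD; first exact: is_cvg_cst.
  apply: normed_cvg; apply: nondecreasing_is_cvgn.
    apply/nondecreasing_seqP => n.
    change (\sum_(0 <= k < n) `|f k.+1 x - f k x| <=
      \sum_(0 <= k < n.+1) `|f k.+1 x - f k x|).
    by rewrite big_nat_recr//= lerDl.
  have gfin : g x \is a fin_num by rewrite ge0_fin_numE// adde_ge0// lee_fin.
  exists (fine (g x)) => _ [n _ <-]; rewrite -lee_fin fineK// /series/=.
  rewrite -dfs (le_trans (nneseries_lim_ge n _))//.
  by rewrite leeDr// lee_fin.
pose h x := fine (limn_esup (fun n => (f n x)%:E)).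
have mh : measurable_fun D h.
  apply: measurableT_comp => //.
  by apply: measurable_fun_limn_esup => n; apply/measurable_EFinP.
have fcv : {ae mu, forall x, D x -> (fun n => (f n x)%:E) @ \oo --> (h x)%:E}.
  have := integrable_ae mD gi; apply: filterS => x /[swap] Dx /(_ Dx) gx.
  have gx' : (g x < +oo)%E by rewrite ltey_eq gx.
  have /cvg_ex[l fl] := cv x gx'.
  have fl' : (fun n => (f n x)%:E) @ \oo --> l%:E.
    by apply: cvg_EFin => //; exact: nearW.
  by rewrite /h (cvg_limn_einf_sup fl').2.
have [] := @dominated_convergence _ _ _ mu D mD (fun n => EFin \o f n)
  (EFin \o h) g _ _ fcv gi.
- by move=> n; apply/measurable_EFinP.
- exact/measurable_EFinP.
- by apply: nearW => x n Dx; exact: fg.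
move=> hi _ _; exists h => // A mA AD.
have iS k : mu.-integrable D k -> mu.-integrable A k by exact: integrableS.
have [] := @dominated_convergence _ _ _ mu A mA (fun n => EFin \o f n)
  (EFin \o h) g.
- by move=> n; apply/(measurable_int mu)/iS.
- exact/(measurable_int mu)/iS.
- by apply: filterS fcv => x + /AD.
- exact: iS.
- by apply: nearW => x n /AD ?; exact: fg.
move=> hiA _ cA; rewrite /Rintegral.
apply: fine_cvg; rewrite fineK//.
by apply: integrable_fin_num => //.
Qed.
Section Dyadic.
Context {R : realType}.
Local Notation mu := (@lebesgue_measure R).

Lemma Rintegral_itvcoD (f : R -> R) (a c b : R) : a <= c -> c <= b ->
  mu.-integrable setT (EFin \o f) ->
  \int[mu]_(x in `[a, b[) f x =
  \int[mu]_(x in `[a, c[) f x + \int[mu]_(x in `[c, b[) f x.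
Proof.
move=> ac cb fi.
rewrite (@itv_bndbnd_setU _ _ (BLeft a) (BLeft c) (BLeft b)) ?bnd_simp//.
rewrite Rintegral_setU//=; last 2 first.
  by apply: integrableS fi => //; exact: measurableU.
  apply/disj_set2P; rewrite -subset0 => z/=; rewrite !in_itv/= => -[/andP[_ zc]].
by rewrite leNgt zc.
Qed.

(** The value of [phi] on the n-th generation dyadic interval of [a, b[ that
contains t. For phi s t = (u t - u s) / W s t, the mean slope of u for the measure
w dt, these step functions form a martingale for w dt. *)
Fixpoint dyadic_step (phi : R -> R -> R) (n : nat) (a b t : R) : R :=
  if n is m.+1 then
    let c := (a + b) / 2 in
    if t < c then dyadic_step phi m a c t else dyadic_step phi m c b t
  else phi a b.

Fixpoint dyadic_sum (psi : R -> R -> R) (n : nat) (a b : R) : R :=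
  if n is m.+1 then
    let c := (a + b) / 2 in dyadic_sum psi m a c + dyadic_sum psi m c b
  else psi a b.

Definition bounded_mfun (h : R -> R) :=
  measurable_fun setT h /\ exists B : R, forall t, `|h t| <= B.

Lemma bounded_mfun_cst c : bounded_mfun (cst c).
Proof. by split => //; exists `|c|. Qed.

Lemma bounded_mfunD h1 h2 : bounded_mfun h1 -> bounded_mfun h2 ->
  bounded_mfun (fun t => h1 t + h2 t).
Proof.
move=> [m1 [B1 b1]] [m2 [B2 b2]]; split; first exact: measurable_funD.
by exists (B1 + B2) => t; rewrite (le_trans (ler_normD _ _))// lerD.
Qed.

Lemma bounded_mfunM h1 h2 : bounded_mfun h1 -> bounded_mfun h2 ->
  bounded_mfun (fun t => h1 t * h2 t).
Proof.
move=> [m1 [B1 b1]] [m2 [B2 b2]]; split; first exact: measurable_funM.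
by exists (B1 * B2) => t; rewrite normrM ler_pM.
Qed.

Lemma bounded_mfunN h : bounded_mfun h -> bounded_mfun (fun t => - h t).
Proof.
move=> [m1 [B1 b1]]; split; first exact: measurable_funN.
by exists B1 => t; rewrite normrN.
Qed.

Lemma bounded_mfunB h1 h2 : bounded_mfun h1 -> bounded_mfun h2 ->
  bounded_mfun (fun t => h1 t - h2 t).
Proof. by move=> ? ?; apply: bounded_mfunD => //; exact: bounded_mfunN. Qed.

Lemma bounded_mfun_integrable (h w : R -> R) (D : set R) : measurable D -> bounded_mfun h ->
  mu.-integrable D (EFin \o w) -> mu.-integrable D (EFin \o (fun t => h t * w t)).
Proof.
move=> mD [mh [B hB]] wi.
have := @integrableMr _ _ _ mu D mD h (EFin \o w) _ _ wi.
apply; first exact: measurable_funS mh.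
exists B; split; first by rewrite num_real.
by move=> x Bx t _ /=; rewrite (le_trans (hB t))// ltW.
Qed.

Lemma bounded_mfun_step phi n a b : bounded_mfun (dyadic_step phi n a b).
Proof.
elim: n a b => [|n ih] a b /=; first exact: bounded_mfun_cst.
have [m1 [B1 b1]] := ih a ((a + b) / 2).
have [m2 [B2 b2]] := ih ((a + b) / 2) b.
split.
  by apply: measurable_fun_ifT => //; exact: measurable_fun_ltr.
exists (Num.max B1 B2) => t.
by case: ifP => _; rewrite le_max ?b1 ?b2 ?orbT.
Qed.

Lemma Rintegral_stepS phi n a b (F : R -> R -> R) : a < b ->
  mu.-integrable setT (EFin \o (fun t => F (dyadic_step phi n.+1 a b t) t)) ->
  let c := (a + b) / 2 in
  \int[mu]_(t in `[a, b[) F (dyadic_step phi n.+1 a b t) t =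
  \int[mu]_(t in `[a, c[) F (dyadic_step phi n a c t) t +
  \int[mu]_(t in `[c, b[) F (dyadic_step phi n c b t) t.
Proof.
move=> ab Fi c.
rewrite (@Rintegral_itvcoD _ a c b) //; [|rewrite /c; lra..].
congr (_ + _); apply: eq_Rintegral => t; rewrite inE/= in_itv/= => /andP[t1 t2].
  by rewrite -/c t2.
by rewrite -/c ltNge t1.
Qed.

End Dyadic.

Section Martingale.
Context {R : realType}.
Local Notation mu := (@lebesgue_measure R).
Variables (u w : R -> R).
Hypothesis wi : mu.-integrable setT (EFin \o w).
Let W s t := \int[mu]_(x in `[s, t[) w x.
Let G := dyadic_step (fun s t => (u t - u s) / W s t).
Let Q := dyadic_sum (fun s t => (u t - u s) ^+ 2 / W s t).

Definition weight_ge1 a b := forall t, a <= t -> t < b -> 1 <= w t.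

Lemma weight_ge1_sub a b a' b' : a <= a' -> b' <= b ->
  weight_ge1 a b -> weight_ge1 a' b'.
Proof.
move=> aa bb w1 t ? ?; apply: w1; first exact: le_trans aa _.
exact: lt_le_trans bb.
Qed.

Lemma weight_ge a b : a <= b -> weight_ge1 a b -> b - a <= W a b.
Proof.
move=> ab w1.
have -> : b - a = \int[mu]_(x in `[a, b[) (cst 1) x.
  rewrite Rintegral_cst//= mul1r lebesgue_measure_itv/= lte_fin.
  by move: ab; rewrite le_eqVlt => /predU1P[->|->//]; rewrite ltxx subrr.
apply: le_Rintegral => //.
- apply/integrableP; split; first by apply/measurable_EFinP.
  under eq_integral do rewrite /= normr1.
  by rewrite integral_cst//= mul1e lebesgue_measure_itv/=; case: ifP => _; rewrite ?ltry// -EFinB ltry.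
- exact: integrableS wi.
- by move=> x/=; rewrite in_itv/= => /andP[]; exact: w1.
Qed.

Lemma weight_gt0 a b : a < b -> weight_ge1 a b -> 0 < W a b.
Proof.
move=> ab w1; apply: lt_le_trans (weight_ge (ltW ab) w1).
by rewrite subr_gt0.
Qed.

Lemma weightD a c b : a <= c -> c <= b -> W a b = W a c + W c b.
Proof. by move=> ac cb; rewrite /W -Rintegral_itvcoD. Qed.

Lemma mid_lt (a b : R) : a < b -> (a < (a + b) / 2) * ((a + b) / 2 < b).
Proof. by move=> ab; split; lra. Qed.

Lemma bounded_mfun_weight_integrable h : bounded_mfun h ->
  mu.-integrable setT (EFin \o (fun t => h t * w t)).
Proof. by move=> hb; exact: bounded_mfun_integrable. Qed.

Lemma martingale_mean n a b : a < b -> weight_ge1 a b ->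
  \int[mu]_(t in `[a, b[) (G n a b t * w t) = u b - u a.
Proof.
elim: n a b => [|n ih] a b ab w1.
  rewrite /G/= RintegralZl//; last exact: integrableS wi.
  by rewrite -/(W a b) divfK// gt_eqF// weight_gt0.
rewrite /G (Rintegral_stepS _ (F := fun x t => x * w t))//; last first.
  by apply: bounded_mfun_weight_integrable; exact: bounded_mfun_step.
have [ac cb] := mid_lt ab.
rewrite -/(G n a _) -/(G n _ b) !ih//; last 2 first.
  by apply: weight_ge1_sub w1 => //; exact: ltW.
  by apply: weight_ge1_sub w1 => //; exact: ltW.
ring.
Qed.

(** [Q n a b] is the squared L^2(w) norm of the martingale; the constant k is
subtracted because [martingale_orthogonal] starts from the constant of generation 0. *)
Lemma martingale_sqr n a b k : a < b -> weight_ge1 a b ->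
  \int[mu]_(t in `[a, b[) ((G n a b t - k) ^+ 2 * w t) =
  Q n a b - 2 * k * (u b - u a) + k ^+ 2 * W a b.
Proof.
elim: n a b => [|n ih] a b ab w1.
  have W0 := weight_gt0 ab w1.
  rewrite /G/Q/= RintegralZl//; last exact: integrableS wi.
  rewrite -/(W a b); field; by rewrite gt_eqF.
rewrite /G (Rintegral_stepS _ (F := fun x t => (x - k) ^+ 2 * w t))//; last first.
  apply: bounded_mfun_weight_integrable; have ? : bounded_mfun (fun t => dyadic_step (fun s t0 : R => (u t0 - u s) / W s t0) n.+1 a b t - k).
    by apply: bounded_mfunB; [exact: bounded_mfun_step|exact: bounded_mfun_cst].
  exact: bounded_mfunM.
have [ac cb] := mid_lt ab.
rewrite -/(G n a _) -/(G n _ b) !ih//; last 2 first.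
  by apply: weight_ge1_sub w1 => //; exact: ltW.
  by apply: weight_ge1_sub w1 => //; exact: ltW.
rewrite (@weightD a ((a + b) / 2) b); [|exact: ltW..].
rewrite /Q/=; ring.
Qed.

(** Increments of the martingale are orthogonal, hence Cauchy in L^2(w) as soon
as the energies [Q n a b] are bounded. *)
Lemma martingale_orthogonal m n a b : a < b -> weight_ge1 a b ->
  \int[mu]_(t in `[a, b[) ((G (m + n) a b t - G m a b t) ^+ 2 * w t) =
  Q (m + n) a b - Q m a b.
Proof.
elim: m a b => [|m ih] a b ab w1.
  have W0 := weight_gt0 ab w1.
  rewrite add0n [G 0]/= martingale_sqr// /Q/= -/Q; field; by rewrite gt_eqF.
have [ac cb] := mid_lt ab.
have wac : weight_ge1 a ((a + b) / 2).
  by apply: weight_ge1_sub w1 => //; exact: ltW.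
have wcb : weight_ge1 ((a + b) / 2) b.
  by apply: weight_ge1_sub w1 => //; exact: ltW.
rewrite (@Rintegral_itvcoD _ _ a ((a + b) / 2) b); [|exact: ltW..|]; last first.
  apply: bounded_mfun_weight_integrable.
  have ? : bounded_mfun (fun t => G (m.+1 + n) a b t - G m.+1 a b t).
    by apply: bounded_mfunB; exact: bounded_mfun_step.
  exact: bounded_mfunM.
transitivity (\int[mu]_(t in `[a, ((a + b) / 2)[)
     ((G (m + n) a ((a + b) / 2) t - G m a ((a + b) / 2) t) ^+ 2 * w t) +
  \int[mu]_(t in `[((a + b) / 2), b[)
     ((G (m + n) ((a + b) / 2) b t - G m ((a + b) / 2) b t) ^+ 2 * w t)).
  congr (_ + _); apply: eq_Rintegral => t; rewrite inE/= in_itv/= => /andP[t1 t2].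
    by rewrite /G addSn/= t2.
  by rewrite /G addSn/= ltNge t1.
rewrite !ih// /Q addSn/=; ring.
Qed.

(** The integral of [G n w] interpolates u at the dyadic points, so the error at
t comes from the single dyadic interval containing t: one oscillation of u and one
of its interpolation. *)
Lemma martingale_primitive n a b om : a < b -> weight_ge1 a b ->
  (forall s s', a <= s -> s <= s' -> s' <= b -> s' - s <= (b - a) / 2 ^+ n ->
    `|u s' - u s| <= om) ->
  forall t, a <= t -> t <= b ->
    `|\int[mu]_(x in `[a, t[) (G n a b x * w x) - (u t - u a)| <= 2 * om.
Proof.
elim: n a b => [|n ih] a b ab w1 uom t ta tb.
  have W0 := weight_gt0 ab w1.
  have wat : weight_ge1 a t by apply: weight_ge1_sub w1.
  have wtb : weight_ge1 t b by apply: weight_ge1_sub w1.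
  rewrite /G/= RintegralZl//; last exact: integrableS wi.
  rewrite -/(W a t) (le_trans (ler_normB _ _))// mulr_natl mulr2n lerD//; last first.
    by apply: uom => //; rewrite expr0 divr1; lra.
  rewrite mulrAC -mulrA normrM -[leRHS]mulr1 ler_pM//.
    by apply: uom => //; [exact: ltW|rewrite expr0 divr1].
  rewrite ger0_norm; last first.
    rewrite divr_ge0// ?(ltW W0)//.
    by rewrite (le_trans _ (weight_ge ta wat))// subr_ge0.
  rewrite ler_pdivrMr// mul1r (@weightD a t b)// lerDl.
  by rewrite (le_trans _ (weight_ge tb wtb))// subr_ge0.
have [ac cb] := mid_lt ab.
have wac : weight_ge1 a ((a + b) / 2).
  by apply: weight_ge1_sub w1 => //; exact: ltW.
have wcb : weight_ge1 ((a + b) / 2) b.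
  by apply: weight_ge1_sub w1 => //; exact: ltW.
have e2 : 0 < (2 : R) ^+ n by exact: exprn_gt0.
have [tc|ct] := ltP t ((a + b) / 2).
  rewrite [X in `|X - _|](_ : _ = \int[mu]_(x in `[a, t[) (G n a ((a + b) / 2) x * w x)).
    apply: ih => //; last exact: ltW.
    move=> s s' sa ss sc sd; apply: uom => //; first by rewrite (le_trans sc)// ltW.
    apply: le_trans sd _; rewrite exprS invfM mulrA ler_pM2r ?invr_gt0//; lra.
  apply: eq_Rintegral => x; rewrite inE/= in_itv/= => /andP[x1 x2].
  by rewrite /G/= (lt_trans x2).
rewrite (@Rintegral_itvcoD _ _ a ((a + b) / 2) t)//; [|exact: ltW|]; last first.
  by apply: bounded_mfun_weight_integrable; exact: bounded_mfun_step.
rewrite (_ : \int[mu]_(x in `[a, ((a + b) / 2)[) _ =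
   \int[mu]_(x in `[a, ((a + b) / 2)[) (G n a ((a + b) / 2) x * w x)); last first.
  apply: eq_Rintegral => x; rewrite inE/= in_itv/= => /andP[x1 x2].
  by rewrite /G/= x2.
rewrite martingale_mean//.
rewrite (_ : \int[mu]_(x in `[((a + b) / 2), t[) _ =
   \int[mu]_(x in `[((a + b) / 2), t[) (G n ((a + b) / 2) b x * w x)); last first.
  apply: eq_Rintegral => x; rewrite inE/= in_itv/= => /andP[x1 x2].
  by rewrite /G/= ltNge x1.
set I := \int[mu]_(x in _) _; set c := (a + b) / 2 in I ct *.
rewrite (_ : _ - _ = I - (u t - u c)); last by ring.
apply: ih => //.
move=> s s' sa ss sc sd; apply: uom => //; first by rewrite (le_trans _ sa)// ltW.
apply: le_trans sd _; rewrite exprS invfM mulrA ler_pM2r ?invr_gt0// /c; lra.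
Qed.

End Martingale.

(** * Increments controlled by an integral and an energy *)

Section AbsolutelyContinuous.
Context {R : realType}.
Local Notation mu := (@lebesgue_measure R).

Lemma dyadic_sum_le (psi : R -> R -> R) (F : R -> R) n a b : a < b ->
  (forall s t, a <= s -> s < t -> t <= b -> psi s t <= F t - F s) ->
  dyadic_sum psi n a b <= F b - F a.
Proof.
elim: n a b => [|n ih] a b ab h /=; first exact: h.
have [ac cb] := mid_lt ab.
have -> : F b - F a = (F ((a + b) / 2) - F a) + (F b - F ((a + b) / 2)) by ring.
apply: lerD; apply: ih => // s t sa st tb; apply: h => //.
  by rewrite (le_trans tb)// ltW.
by rewrite (le_trans _ sa)// ltW.
Qed.

(** Absolute continuity in quadratic form. With V a primitive of w it says
D s t <= int w, and with w = 1 it bounds the integral of the squared speed by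
V b - V a; one theory serves both kinds of curves. The bound w >= 1 makes the
weights of dyadic intervals positive and comparable to their lengths. *)
Definition energy_controlled (a b : R) (w V : R -> R) (D : R -> R -> R) :=
  [/\ mu.-integrable setT (EFin \o w), weight_ge1 w a b &
   forall s t, a <= s -> s <= t -> t <= b ->
     D s t ^+ 2 <= (\int[mu]_(x in `[s, t[) w x) * (V t - V s)].

Lemma energy_controlled_mono a b w V D : energy_controlled a b w V D ->
  forall s t, a <= s -> s <= t -> t <= b -> V s <= V t.
Proof.
move=> [wi w1 h] s t sa + tb; rewrite le_eqVlt => /predU1P[->//|st].
have W0 : 0 < \int[mu]_(x in `[s, t[) w x.
  by apply: weight_gt0 => //; exact: weight_ge1_sub w1.
rewrite -subr_ge0 -(pmulr_rge0 _ W0).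
by rewrite (le_trans _ (h _ _ sa (ltW st) tb))// sqr_ge0.
Qed.

(** Absolute continuity of the integral of w, V being bounded on [a, b]. *)
Lemma energy_controlled_unif a b w V D : a <= b -> energy_controlled a b w V D ->
  forall e : R, 0 < e -> exists2 d : R, 0 < d &
    forall s t, a <= s -> s <= t -> t <= b -> t - s < d -> `|D s t| <= e.
Proof.
move=> ab ec e e0; have [wi w1 h] := ec.
pose M := V b - V a + 1.
have M0 : 0 < M.
  by rewrite ltr_wpDl// subr_ge0 (energy_controlled_mono ec).
have [d [d0 hd]] := integral_normr_continuous wi (divr_gt0 (exprn_gt0 2 e0) M0).
exists d => // s t sa st tb tsd.
rewrite -(@ler_pXn2r _ 2%N)// ?nnegrE ?normr_ge0 ?(ltW e0)//.
rewrite real_normK ?num_real//.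
apply: le_trans (h _ _ sa st tb) _.
have wst : mu.-integrable `[s, t[ (EFin \o w) by exact: integrableS wi.
have mI : (mu `[s, t[%classic < d%:E)%E.
  rewrite lebesgue_measure_itv/= lte_fin; case: ifP => _.
    by rewrite -EFinB lte_fin.
  by rewrite lte_fin.
have I1 : \int[mu]_(x in `[s, t[) w x <= e ^+ 2 / M.
  apply: (le_trans _ (ltW (hd `[s, t[%classic _ _))) => //.
  by rewrite (le_trans _ (le_normr_Rintegral _ _))// ler_norm.
have V0 : 0 <= V t - V s by rewrite subr_ge0 (energy_controlled_mono ec).
apply: (@le_trans _ _ (e ^+ 2 / M * (V t - V s))); first exact: ler_wpM2r.
rewrite -mulrA ler_piMr ?sqr_ge0// mulrC ler_pdivrMr// mul1r.
have := energy_controlled_mono ec (lexx a) sa (le_trans st tb).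
have := energy_controlled_mono ec (le_trans sa st) tb (lexx b).
rewrite /M; lra.
Qed.

(** The martingale of dyadic mean slopes of u has energy at most V b - V a by
hypothesis on each interval, so its increments are small in L^2(w), hence w times
it is a fast Cauchy sequence in L^1 along a subsequence. The limit is the density
of u. *)
Lemma energy_controlled_ac (u w V : R -> R) (a b : R) : a < b ->
  energy_controlled a b w V (fun s t => u t - u s) ->
  exists2 h : R -> R, mu.-integrable setT (EFin \o h) &
    forall s t, a <= s -> s <= t -> t <= b ->
      u t - u s = \int[mu]_(x in `[s, t[) h x.
Proof.
move=> ab ec; have [wi w1 hu] := ec.
pose W s t := \int[mu]_(x in `[s, t[) w x.
pose G := dyadic_step (fun s t => (u t - u s) / W s t).
pose Q := dyadic_sum (fun s t => (u t - u s) ^+ 2 / W s t).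
have W0 s t : a <= s -> s < t -> t <= b -> 0 < W s t.
  by move=> ? ? ?; apply: weight_gt0 => //; exact: weight_ge1_sub w1.
have QV n : Q n a b <= V b - V a.
  apply: dyadic_sum_le => // s t sa st tb.
  by rewrite ler_pdivrMr ?W0// mulrC; apply: hu => //; exact: ltW.
have Gb n : bounded_mfun (G n a b) by exact: bounded_mfun_step.
have GBb n m : bounded_mfun (fun t => G n a b t - G m a b t).
  exact: bounded_mfunB.
have mDco c d : measurable (`[c, d[%classic : set R) by [].
have sq_int n m : mu.-integrable setT (EFin \o (fun t => (G n a b t - G m a b t) ^+ 2 * w t)).
  by apply: bounded_mfun_integrable => //; exact: bounded_mfunM.
have orth m n : (m <= n)%N ->
    \int[mu]_(t in `[a, b[) ((G n a b t - G m a b t) ^+ 2 * w t) = Q n a b - Q m a b.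
  by move=> mn; rewrite -(subnKC mn) martingale_orthogonal.
have Qnd : {homo (fun n => Q n a b) : n m / (n <= m)%N >-> n <= m}.
  move=> m n mn; rewrite -subr_ge0 -orth//; apply: Rintegral_ge0 => t/=.
  rewrite in_itv/= => /andP[ta tb].
  by rewrite mulr_ge0 ?sqr_ge0// (le_trans _ (w1 _ ta tb)).
have Qcvg : cvgn (fun n => Q n a b).
  apply: nondecreasing_is_cvgn => //.
  by exists (V b - V a) => _ [n _ <-].
have Qle := nondecreasing_cvgn_le Qnd Qcvg.
set L := limn _ in Qle.
(* Along k the martingale is within 2^-j of its limit in L^2(w). *)
have /choice[k hk] : forall j : nat, exists kj : nat, (j <= kj)%N /\
    forall n, (kj <= n)%N -> L - Q n a b <= (2 ^+ j)^-1 ^+ 2.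
  move=> j; have e0 : 0 < (2 ^+ j)^-1 ^+ 2 :> R by rewrite exprn_gt0 ?invr_gt0 ?exprn_gt0.
  move/cvgrPdist_le : Qcvg => /(_ _ e0)[N _ hN].
  exists (maxn j N); split; first exact: leq_maxl.
  move=> n; rewrite geq_max => /andP[_ Nn].
  by have := hN n Nn; rewrite -/L; apply: le_trans; exact: ler_norm.
pose f j t := G (k j) a b t * w t.
have fi j : mu.-integrable setT (EFin \o f j).
  exact: bounded_mfun_integrable.
have dsq j : \int[mu]_(t in `[a, b[) ((G (k j.+1) a b t - G (k j) a b t) ^+ 2 * w t)
    <= (2 ^+ j)^-1 ^+ 2.
  have [kk|kk] := leqP (k j) (k j.+1).
    rewrite orth//; have := (hk j).2 _ (leqnn (k j)); have := Qle (k j.+1); lra.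
  rewrite (_ : \int[mu]_(t in _) _ = \int[mu]_(t in `[a, b[) ((G (k j) a b t - G (k j.+1) a b t) ^+ 2 * w t)); last first.
    by apply: eq_Rintegral => t _; rewrite -sqrrN opprB.
  rewrite (orth _ _ (ltnW kk)).
  apply: (@le_trans _ _ ((2 ^+ j.+1)^-1 ^+ 2)).
    have := (hk j.+1).2 _ (leqnn (k j.+1)); have := Qle (k j); lra.
  rewrite lerXn2r ?nnegrE ?invr_ge0 ?exprn_ge0// lef_pV2 ?posrE ?exprn_gt0//.
  by rewrite exprS ler_peMl ?exprn_ge0// ler1n.
pose C := (W a b + 1) / 2.
have [||h0 h0i h0c] := @L1_fast_cauchy _ _ _ mu `[a, b[%classic f C (mDco a b).
- by move=> n; exact: integrableS (fi n).
- move=> j.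
  have dfi : mu.-integrable `[a, b[ (EFin \o (fun x => `|f j.+1 x - f j x|)).
    have := integrable_norm (integrableB measurableT (fi j.+1) (fi j)).
    exact: integrableS.
  rewrite -[leLHS]fineK; last exact: integrable_fin_num dfi.
  rewrite lee_fin.
  pose e : R := (2 ^+ j)^-1.
  have e0 : 0 < e by rewrite invr_gt0 exprn_gt0.
  (* |z| <= e / 2 + z^2 / (2 e) turns the L^2 bound into an L^1 bound. *)
  pose g x := (e / 2 * w x) + ((2 * e)^-1 * ((G (k j.+1) a b x - G (k j) a b x) ^+ 2 * w x)).
  apply: (@le_trans _ _ (\int[mu]_(x in `[a, b[) g x)).
    apply: le_Rintegral => //.
      apply: (@integrableS _ _ _ mu setT) => //.
      apply: (@integrableD _ _ _ mu setT measurableT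
        (fun x => (e / 2 * w x)%:E) (fun x => ((2 * e)^-1 * ((G (k j.+1) a b x - G (k j) a b x) ^+ 2 * w x))%:E)).
        exact: (integrableZl measurableT (e / 2) wi).
      exact: (integrableZl measurableT (2 * e)^-1 (sq_int (k j.+1) (k j))).
    move=> x/=; rewrite in_itv/= => /andP[xa xb].
    have wx0 : 0 <= w x by rewrite (le_trans _ (w1 _ xa xb)).
    rewrite /f /g -mulrBl normrM (ger0_norm wx0) mulrA -mulrDl ler_wpM2r//.
    set z := _ - _ : R.
    have z2 : z ^+ 2 = `|z| ^+ 2 by rewrite real_normK ?num_real.
    rewrite z2 -subr_ge0.
    have -> : e / 2 + (2 * e)^-1 * `|z| ^+ 2 - `|z| = (2 * e)^-1 * (e - `|z|) ^+ 2.
      by field; rewrite gt_eqF.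
    by rewrite mulr_ge0 ?sqr_ge0// invr_ge0 mulr_ge0// ltW.
  rewrite /g RintegralD//; last 2 first.
    apply: (@integrableS _ _ _ mu setT) => //.
    exact: (integrableZl measurableT (e / 2) wi).
    apply: (@integrableS _ _ _ mu setT) => //.
    exact: (integrableZl measurableT (2 * e)^-1 (sq_int (k j.+1) (k j))).
  rewrite !RintegralZl//; last 2 first.
    exact: integrableS (sq_int (k j.+1) (k j)).
    exact: integrableS wi.
  rewrite -/(W a b).
  apply: (@le_trans _ _ (e / 2 * W a b + (2 * e)^-1 * e ^+ 2)).
    rewrite lerD2l ler_wpM2l ?dsq// invr_ge0 mulr_ge0// ltW//.
  rewrite -/e le_eqVlt; apply/orP; left; apply/eqP; rewrite /C -/e.
  by field; rewrite gt_eqF.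
have hi : mu.-integrable setT (EFin \o (h0 \_ `[a, b[)).
  by rewrite -restrict_EFin; exact: ((integrable_mkcond (EFin \o h0) (mDco a b)).1 h0i).
exists (h0 \_ `[a, b[) => //.
have key t : a <= t -> t <= b -> u t - u a = \int[mu]_(x in `[a, t[) (h0 \_ `[a, b[) x.
  move=> ta tb.
  have sub : `[a, t[ `<=` `[a, b[ by apply: subset_itvl; rewrite bnd_simp.
  rewrite -Rintegral_mkcondr setIidl//.
  have c1 := h0c `[a, t[%classic (mDco a t) sub.
  suff c2 : \int[mu]_(x in `[a, t[) f n x @[n --> \oo] --> u t - u a.
    exact: cvg_unique c2 c1.
  apply/cvgrPdist_le => e e0.
  have e20 : 0 < e / 2 by rewrite divr_gt0.
  have [d d0 hd] := energy_controlled_unif (ltW ab) ec e20.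
  have [N hN] : exists N, forall n, (N <= n)%N -> (b - a) / 2 ^+ n < d.
    exists (Num.Def.archi_bound ((b - a) / d)) => n Nn.
    rewrite ltr_pdivrMr ?exprn_gt0// mulrC -ltr_pdivrMr//.
    exact: upper_nthrootP.
  exists N => // n /= Nn.
  rewrite distrC /f.
  have -> : e = 2 * (e / 2) by field.
  apply: martingale_primitive => // s s' sa ss sb sd; apply: hd => //.
  apply: le_lt_trans sd _; apply: hN; apply: leq_trans Nn _; exact: (hk n).1.
move=> s t sa st tb.
have := key t (le_trans sa st) tb; have := key s sa (le_trans st tb).
rewrite (@Rintegral_itvcoD _ _ a s t)//; lra.
Qed.

End AbsolutelyContinuous.

(** * Almost everywhere differentiation *)

Section Derivatives.
Context {R : realType}.
Local Notation mu := (@lebesgue_measure R).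

Lemma dense_sequence (a b : R) : a <= b -> exists q : nat -> R,
  (forall k, a <= q k <= b) /\
  (forall t e, a <= t <= b -> 0 < e -> exists k, `|q k - t| < e).
Proof.
move=> ab.
pose q k := if @unpickle rat k is Some r then Num.max a (Num.min b (ratr r)) else a.
exists q; split.
  move=> k; rewrite /q; case: unpickle => [r|]; last by rewrite lexx.
  by rewrite le_max lexx/= ge_max ab/= ge_min lexx.
move=> t e /andP[ta tb] e0.
have [r] := @rat_in_itvoo R (t - e) (t + e) ltac:(lra).
rewrite in_itv/= => /andP[r1 r2].
exists (pickle r); rewrite /q pickleK ltr_norml.
have [h1|h1] := leP b (ratr r); rewrite /Num.min /Num.max;
  case: ifPn; rewrite -?leNgt => h2; lra.
Qed.

Definition is_deriv (u : R -> R) (t l : R) := forall e, 0 < e ->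
  exists2 d, 0 < d & forall s, `|s - t| < d -> `|u s - u t - l * (s - t)| <= e * `|s - t|.

(** Difference quotients over intervals that contain t, rather than start at
t, still converge to the derivative; this is what dyadic intervals require. *)
Lemma is_deriv_straddle u t l : is_deriv u t l -> forall e, 0 < e ->
  exists2 d, 0 < d & forall s s', s <= t -> t <= s' -> s' - s < d ->
    `|u s' - u s - l * (s' - s)| <= e * (s' - s).
Proof.
move=> du e e0; have [d d0 hd] := du e e0; exists d => // s s' st ts' ss'.
have h1 : `|s - t| < d by rewrite ltr_norml; lra.
have h2 : `|s' - t| < d by rewrite ltr_norml; lra.
have := hd _ h1; have := hd _ h2.
rewrite (ler0_norm (_ : s - t <= 0)) ?(ger0_norm (_ : 0 <= s' - t)); try lra.
rewrite !ler_norml; lra.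
Qed.

Lemma derivable_is_deriv (u : R -> R) t : derivable u t 1 -> is_deriv u t (derive1 u t).
Proof.
move=> du e e0.
have : h^-1 *: (u (h + t) - u t) @[h --> 0^'] --> derive1 u t.
  move: du; rewrite /derivable /derive1.
  have -> : (fun h : R => h^-1 *: (u (h *: 1 + t) - u t)) =
            (fun h => h^-1 *: (u (h + t) - u t)).
    by apply/funext => h; rewrite [h *: 1]mulr1.
  by move=> dh; exact: dh.
move/cvgrPdist_le => /(_ _ e0)[d /= d0 hd].
exists d => // s sd; have [->|st] := eqVneq s t.
  by rewrite !subrr mulr0 subr0 normr0 mulr0.
have st0 : s - t != 0 by rewrite subr_eq0.
have := hd (s - t); rewrite /ball_/= sub0r normrN subrK => /(_ sd st0).
set l := derive1 u t => hl.
have -> : u s - u t - l * (s - t) =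
    - ((l - (s - t)^-1 * (u s - u t)) * (s - t)) by field.
by rewrite normrN normrM ler_wpM2r.
Qed.

Lemma ae_sub (P Q : R -> Prop) : {ae mu, forall t, P t} -> (forall t, P t -> Q t) ->
  {ae mu, forall t, Q t}.
Proof.
by move=> + PQ; apply: filterS => //; exact: (ae_filter_ringOfSetsType mu).
Qed.

Lemma ae_and (P Q : R -> Prop) : {ae mu, forall t, P t} -> {ae mu, forall t, Q t} ->
  {ae mu, forall t, P t /\ Q t}.
Proof.
by move=> HP HQ; apply: filterI => //; exact: (ae_filter_ringOfSetsType mu).
Qed.

Lemma ae_forall_nat (P : nat -> R -> Prop) : (forall k, {ae mu, forall t, P k t}) ->
  {ae mu, forall t, forall k, P k t}.
Proof. by move=> HP; exact/ae_foralln. Qed.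

Lemma ae_witness (P : R -> Prop) (a b : R) : a < b -> {ae mu, forall t, P t} ->
  exists2 t, a < t < b & P t.
Proof.
move=> ab [N [mN N0 PN]]; apply: contrapT => h.
have sub : `]a, b[ `<=` N.
  move=> t; rewrite /= in_itv/= => tab; apply: PN => /= Pt.
  by apply: h; exists t.
have : (mu `]a, b[%classic <= mu N)%E.
  by apply: le_measure => //; rewrite inE.
rewrite N0 lebesgue_measure_itv/= lte_fin ab -EFinB lee_fin; lra.
Qed.

Lemma ae_ne (c : R) : {ae mu, forall t, t <> c}.
Proof.
exists [set c]; split => //; first exact: lebesgue_measure_set1.
by move=> t /= /contrapT.
Qed.

Definition cumul (h : R -> R) (x : R) := \int[mu]_(t in `]-oo, x]) h t.

Lemma cumulB h s t : mu.-integrable setT (EFin \o h) -> s <= t ->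
  \int[mu]_(x in `[s, t[) h x = cumul h t - cumul h s.
Proof.
move=> hi st; rewrite /cumul Rintegral_itvB//; last 1 first.
  exact: integrableS hi.
rewrite Rintegral_itv_bndo_bndc ?Rintegral_itv_obnd_cbnd//.
  exact: integrableS hi.
exact: integrableS hi.
Qed.

Lemma ae_is_deriv_cumul h : mu.-integrable setT (EFin \o h) ->
  {ae mu, forall t, is_deriv (cumul h) t (h t)}.
Proof.
move=> hi.
have li : locally_integrable [set: R] h.
  by have := integrable_locally measurableT hi; rewrite patch_setT.
have hi' y : mu.-integrable `]-oo, y] (EFin \o h) by exact: integrableS hi.
apply: (ae_sub (FTC1Ny hi' li)) => t [dt <-].
exact: derivable_is_deriv.
Qed.

Lemma ae_is_deriv (h u : R -> R) (a b : R) : mu.-integrable setT (EFin \o h) ->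
  (forall s t, a <= s -> s <= t -> t <= b -> u t - u s = \int[mu]_(x in `[s, t[) h x) ->
  {ae mu, forall t, a < t -> t < b -> is_deriv u t (h t)}.
Proof.
move=> hi hu; apply: (ae_sub (ae_is_deriv_cumul hi)) => t dt ta tb e e0.
have [d d0 hd] := dt e e0.
exists (Num.min d (Num.min (t - a) (b - t))); first by rewrite !lt_min d0 !subr_gt0 ta.
move=> s; rewrite !lt_min !ltr_norml => /andP[sd /andP[s1 s2]].
have -> : u s - u t = cumul h s - cumul h t.
  have [st|/ltW ts] := leP s t.
    rewrite -[LHS]opprB hu//; [|lra|lra].
    by rewrite cumulB// opprB.
  by rewrite hu//; [rewrite cumulB//|lra|lra].
by apply: hd; rewrite ltr_norml.
Qed.

Lemma bounded_mfunX (h : R -> R) p : bounded_mfun h -> bounded_mfun (fun t => h t ^+ p).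
Proof.
move=> hb; elim: p => [|p ih].
  under eq_fun do rewrite expr0; exact: bounded_mfun_cst.
by under eq_fun do rewrite exprS; exact: bounded_mfunM.
Qed.

Lemma Rintegral_stepX phi n p (v : R -> R) a b : a < b ->
  mu.-integrable setT (EFin \o v) ->
  \int[mu]_(t in `[a, b[) (dyadic_step phi n a b t ^+ p * v t) =
  dyadic_sum (fun s t => phi s t ^+ p * \int[mu]_(x in `[s, t[) v x) n a b.
Proof.
move=> + vi; elim: n a b => [|n ih] a b ab.
  by rewrite /= RintegralZl//; exact: integrableS vi.
rewrite (Rintegral_stepS _ (F := fun x t => x ^+ p * v t))//; last first.
  apply: bounded_mfun_integrable => //; apply: bounded_mfunX; exact: bounded_mfun_step.
have [ac cb] := mid_lt ab.
by rewrite !ih.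
Qed.

Lemma dyadic_step_straddle (phi : R -> R -> R) n (a b t : R) : a < b -> a <= t -> t < b ->
  exists s s', [/\ a <= s, s <= t, t < s', s' <= b &
    s' - s = (b - a) / 2 ^+ n /\ dyadic_step phi n a b t = phi s s'].
Proof.
elim: n a b => [|n ih] a b ab ta tb.
  by exists a, b; rewrite expr0 divr1.
have [ac cb] := mid_lt ab.
have e2 : (2 : R) ^+ n != 0 by rewrite expf_neq0.
have [tc|ct] := ltP t ((a + b) / 2).
  have [s [s' [h1 h2 h3 h4 [h5 h6]]]] := ih _ _ ac ta tc.
  exists s, s'; split => //; first by rewrite (le_trans h4)// ltW.
  by rewrite h5 /= tc h6 exprS; split => //; field.
have [s [s' [h1 h2 h3 h4 [h5 h6]]]] := ih _ _ cb ct tb.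
exists s, s'; split => //; first by rewrite (le_trans _ h1)// ltW.
by rewrite h5 /= ltNge ct h6 exprS; split => //; field.
Qed.

End Derivatives.

(** * Lower limits and the metric derivative *)

Section LimInf.
Context {R : realType}.
Implicit Types (u : (\bar R)^nat) (c : \bar R).

Lemma limn_einfE u : limn_einf u = ereal_sup (range (einfs u)).
Proof.
rewrite limn_einf_lim; apply/cvg_lim => //.
apply: ereal_nondecreasing_cvgn; exact: nondecreasing_einfs.
Qed.

Lemma limn_einf_ge u c N : (forall n, (N <= n)%N -> (c <= u n)%E) -> (c <= limn_einf u)%E.
Proof.
move=> h; rewrite limn_einfE; apply: ereal_sup_ge; exists (einfs u N); first by exists N.
by apply: le_ereal_inf_tmp => _ [n /= Nn <-]; exact: h.
Qed.

Lemma limn_einf_le u c : (forall N, exists2 n, (N <= n)%N & (u n <= c)%E) ->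
  (limn_einf u <= c)%E.
Proof.
move=> h; rewrite limn_einfE; apply: ge_ereal_sup => _ [N _ <-].
by have [n Nn unc] := h N; apply: le_trans unc; apply: ereal_inf_lbound; exists n.
Qed.

Lemma limn_einf_lt_often u c : (limn_einf u < c)%E ->
  forall N, exists2 n, (N <= n)%N & (u n < c)%E.
Proof.
move=> uc N; apply: contrapT => h; move: uc; rewrite ltNge => /negP; apply.
apply: (@limn_einf_ge _ _ N) => n Nn; rewrite leNgt; apply/negP => un.
by apply: h; exists n.
Qed.

Lemma limn_einf_ge_eps (u : nat -> R) (c : R) :
  (forall e : R, 0 < e -> exists N, forall n, (N <= n)%N -> c - e <= u n) ->
  (c%:E <= limn_einf (fun n => (u n)%:E))%E.
Proof.
move=> h; apply/lee_addgt0Pr => e e0; have [N hN] := h e e0.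
rewrite -leeBlDr// -EFinB; apply: (@limn_einf_ge _ _ N) => n Nn.
by rewrite lee_fin hN.
Qed.

Lemma measurable_fun_limn_einf d (T : measurableType d) (D : set T)
    (f : nat -> T -> \bar R) : (forall n, measurable_fun D (f n)) ->
  measurable_fun D (fun x => limn_einf (f ^~ x)).
Proof.
move=> mf; rewrite /limn_einf; apply: measurableT_comp => //.
by apply: measurable_fun_limn_esup => n; exact: measurableT_comp.
Qed.

End LimInf.

Section MetricDerivative.
Context {R : realType} {X : metricType R}.
Local Notation mu := (@lebesgue_measure R).

Lemma ae_le_Rintegral (D : set R) (f g : R -> R) : measurable D ->
  mu.-integrable D (EFin \o f) -> mu.-integrable D (EFin \o g) ->
  (forall t, D t -> 0 <= f t) -> (forall t, D t -> 0 <= g t) ->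
  {ae mu, forall t, D t -> f t <= g t} ->
  \int[mu]_(x in D) f x <= \int[mu]_(x in D) g x.
Proof.
move=> mD fi gi f0 g0 fg; rewrite /Rintegral fine_le//; [exact: integrable_fin_num..|].
apply: ae_ge0_le_integral => //.
- exact: (measurable_int mu fi).
- exact: (measurable_int mu gi).
Qed.

Lemma integrable_cst_itv (c a b : R) : mu.-integrable `[a, b[ (EFin \o cst c).
Proof.
apply: measurable_bounded_integrable => //.
  rewrite /= lebesgue_measure_itv/=; case: ifP => _; last exact: ltry.
  by rewrite -EFinB ltry.
by exists `|c|; split; [rewrite num_real|move=> k ck x _ /=; exact: ltW].
Qed.

Lemma Rintegral_indic_itvco (a b s t : R) : a <= s -> s <= t -> t <= b ->
  \int[mu]_(x in `[s, t[) (\1_(`[a, b[%classic : set R) x : R) = t - s.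
Proof.
move=> sa st tb; transitivity (\int[mu]_(x in `[s, t[) (cst 1) x).
  apply: eq_Rintegral => x; rewrite inE/= in_itv/= => /andP[x1 x2].
  by rewrite indicE mem_set//= in_itv/= (le_trans sa)// (lt_le_trans x2).
rewrite Rintegral_cst//= mul1r lebesgue_measure_itv/= lte_fin.
by move: st; rewrite le_eqVlt => /predU1P[->|->//]; rewrite ltxx subrr.
Qed.

Lemma mdist_dist (x y z : X) : `|mdist x z - mdist y z| <= mdist x y.
Proof.
have := metric_triangle x y z; have := metric_triangle y x z.
by rewrite (metric_sym y x) ler_norml; lra.
Qed.

Lemma norm_lt_lbound (s t c : R) : `|s - t| < t - c -> c <= s.
Proof. by rewrite ltr_norml; lra. Qed.

Lemma norm_lt_ubound (s t c : R) : `|s - t| < c - t -> s <= c.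
Proof. by rewrite ltr_norml; lra. Qed.

Lemma norm_pinch (x p1 p2 p3 c1 c2 c3 c4 : R) :
  c1 <= p3 + p3 -> c2 <= p3 -> c3 <= c1 + p2 -> p1 <= c2 + c4 ->
  p2 - p3 <= p1 -> c4 <= x -> x <= c3 -> `|x - p2| <= p3 + p3.
Proof. by rewrite ler_norml; lra. Qed.

Definition is_mderiv (gamma : R -> X) (t l : R) := forall e, 0 < e ->
  exists2 d, 0 < d & forall s, `|s - t| < d ->
    `|mdist (gamma t) (gamma s) - l * `|s - t| | <= e * `|s - t|.

Variables (gamma : R -> X) (a b : R) (w V : R -> R).
Hypothesis ab : a < b.
Hypothesis ec : energy_controlled a b w V (fun s t => mdist (gamma s) (gamma t)).

Let q n t := dyadic_step (fun s t => mdist (gamma s) (gamma t) / (t - s)) n a b t.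

Let measurable_q n D : measurable_fun D (q n).
Proof.
have [m _] : bounded_mfun (q n) by exact: bounded_mfun_step.
exact: measurable_funS m.
Qed.

Let q_ge0 n t : a < t -> t < b -> 0 <= q n t.
Proof.
move=> ta tb; rewrite /q.
have [s [s' [_ h2 h3 _ [_ ->]]]] := dyadic_step_straddle
  (fun s t => mdist (gamma s) (gamma t) / (t - s)) n ab (ltW ta) tb.
by rewrite divr_ge0 ?mdist_ge0// subr_ge0 (le_trans h2)// ltW.
Qed.

Let unif (e : R) : 0 < e -> exists2 d : R, 0 < d & forall s t : R,
  a <= s <= b -> a <= t <= b -> `|t - s| < d -> mdist (gamma s) (gamma t) <= e.
Proof.
move=> e0; have [d d0 hd] := energy_controlled_unif (ltW ab) ec e0.
exists d => // s t /andP[sa sb] /andP[ta tb]; have [st|/ltW ts] := leP s t.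
  rewrite ger0_norm ?subr_ge0// => std.
  exact: le_trans (ler_norm _) (hd s t sa st tb std).
rewrite distrC ger0_norm ?subr_ge0// metric_sym => std.
exact: le_trans (ler_norm _) (hd t s ta ts sb std).
Qed.

Let vI := \1_(`[a, b[%classic : set R) : R -> R.

Let vI_int : mu.-integrable setT (EFin \o vI).
Proof. exact: integrable_indic_itv. Qed.

Let vIE s t : a <= s -> s <= t -> t <= b -> \int[mu]_(x in `[s, t[) vI x = t - s.
Proof. exact: Rintegral_indic_itvco. Qed.

Let q_integral n p : (\int[mu]_(t in `]a, b[) ((q n t) ^+ p)%:E <=
  (dyadic_sum (fun s t => (mdist (gamma s) (gamma t) / (t - s)) ^+ p * \int[mu]_(x in `[s, t[) vI x) n a b)%:E)%E.
Proof.
rewrite -Rintegral_stepX// /Rintegral fineK; last first.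
  apply: integrable_fin_num => //; apply: (@integrableS _ _ _ mu setT) => //.
  apply: bounded_mfun_integrable => //; apply: bounded_mfunX; exact: bounded_mfun_step.
rewrite (@integral_itv_bndoo _ a b _ true true)//; last first.
  apply/measurable_EFinP; apply: measurable_funM.
    by apply: measurable_funX; exact: measurable_q.
  by apply: measurable_indic.
apply: ge0_le_integral => //.
- by move=> t /=; rewrite in_itv/= => /andP[ta tb]; rewrite lee_fin exprn_ge0// q_ge0.
- by apply/measurable_EFinP/measurable_funX; exact: measurable_q.
- apply/measurable_EFinP; apply: measurable_funM.
    by apply: measurable_funX; exact: measurable_q.
  by apply: measurable_indic.
- move=> t /=; rewrite in_itv/= => /andP[ta tb].
  by rewrite lee_fin /vI indicE mem_set ?mulr1//= in_itv/= tb (ltW ta).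
Qed.

(** Let u k be the distance to z k, for z k dense in [a, b]. Each u k is
absolutely continuous and m is the supremum of their absolute derivatives. It
dominates d(g s, g t), since choosing z k close to s makes u k t - u k s close to
that distance; it is below the lower limit of the dyadic quotients, whose integrals
are bounded, so it is integrable by Fatou's lemma. At a point where the primitive
of m and all u k are differentiable, both bounds together give the derivative. *)
Lemma metric_derivative : exists m : R -> R,
  [/\ forall t, 0 <= m t, mu.-integrable setT (EFin \o m),
    forall s t, a <= s -> s <= t -> t <= b ->
      mdist (gamma s) (gamma t) <= \int[mu]_(x in `[s, t[) m x,
    {ae mu, forall t, a < t -> t < b -> is_mderiv gamma t (m t)} &
    {ae mu, forall t, a < t -> t < b -> ((m t)%:E <= limn_einf (fun n => (q n t)%:E))%E}].
Proof.
have [wi w1 hd] := ec.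
have [z [zab zdense]] := dense_sequence (ltW ab).
pose u k t := mdist (gamma t) (gamma (z k)).
have uk_le k s t : `|u k t - u k s| <= mdist (gamma s) (gamma t).
  by rewrite metric_sym; exact: mdist_dist.
have /choice[h hP] : forall k, exists h : R -> R, mu.-integrable setT (EFin \o h) /\
    forall s t, a <= s -> s <= t -> t <= b ->
      u k t - u k s = \int[mu]_(x in `[s, t[) h x.
  move=> k; have [|h h1 h2] := @energy_controlled_ac _ (u k) w V a b ab; last by exists h.
  split => // s t sa st tb; apply: le_trans (hd _ _ sa st tb).
  rewrite -[leLHS]real_normK ?num_real// lerXn2r ?nnegrE ?mdist_ge0//.
have hi k : mu.-integrable setT (EFin \o h k) by have [] := hP k.
have hu k := (hP k).2.
have mh k D : measurable_fun D (h k).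
  have /measurable_EFinP := measurable_int mu (hi k).
  by move=> H; exact: measurable_funS H.
pose me t := esups (fun k => (`|h k t|)%:E) 0.
have meE k t : ((`|h k t|)%:E <= me t)%E.
  by apply: ereal_sup_ubound; exists k.
have me_ge0 t : (0 <= me t)%E by apply: le_trans (meE 0%N t); rewrite lee_fin.
have mme D : measurable_fun D me.
  apply: measurable_fun_esups => n; apply/measurable_EFinP.
  by apply: measurableT_comp => //; exact: mh.
have aeD : {ae mu, forall t, forall k, a < t -> t < b -> is_deriv (u k) t (h k t)}.
  by apply: ae_forall_nat => k; apply: ae_is_deriv => //; exact: hu.
have q_low t k : a < t -> t < b -> is_deriv (u k) t (h k t) ->
    forall e : R, 0 < e -> exists N, forall n, (N <= n)%N -> `|h k t| - e <= q n t.
  move=> ta tb dk e e0; have [d d0 hd'] := is_deriv_straddle dk e0.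
  exists (Num.Def.archi_bound ((b - a) / d)) => n Nn; rewrite /q.
  have [s [s' [h1 h2 h3 h4 [h5 ->]]]] := dyadic_step_straddle
    (fun s t => mdist (gamma s) (gamma t) / (t - s)) n ab (ltW ta) tb.
  have ss' : 0 < s' - s by rewrite subr_gt0 (le_lt_trans h2).
  have sd : s' - s < d.
    rewrite h5 ltr_pdivrMr ?exprn_gt0// mulrC -ltr_pdivrMr//.
    exact: upper_nthrootP.
  rewrite ler_pdivlMr//; apply: le_trans (uk_le k s s').
  have := hd' s s' h2 (ltW h3) sd.
  have := ler_normD (h k t * (s' - s) - (u k s' - u k s)) (u k s' - u k s).
  rewrite mulrBl subrK normrM (ger0_norm (ltW ss')) distrC; lra.
have me_le : {ae mu, forall t, a < t -> t < b -> (me t <= limn_einf (fun n => (q n t)%:E))%E}.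
  apply: (ae_sub aeD) => t dt ta tb; apply: ge_ereal_sup => _ [k _ <-].
  by apply: limn_einf_ge_eps; apply: q_low => //; exact: dt.
have ibound : (\int[mu]_(t in `]a, b[) me t < +oo)%E.
  apply: (@le_lt_trans _ _ (\int[mu]_(t in `]a, b[) limn_einf (fun n => (q n t)%:E))%E).
    apply: ae_ge0_le_integral => //.
    - exact: mme.
    - move=> t /=; rewrite in_itv/= => /andP[ta tb].
      by apply: (@limn_einf_ge _ _ _ 0%N) => n _; rewrite lee_fin q_ge0.
    - apply: (measurable_fun_limn_einf (f := fun n t => (q n t)%:E)) => n.
      by apply/measurable_EFinP; exact: measurable_q.
    - by apply: (ae_sub me_le) => t ht /=; rewrite in_itv/= => /andP[]; exact: ht.
  apply: le_lt_trans.
    apply: fatou => //.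
    - by move=> n; apply/measurable_EFinP; exact: measurable_q.
    - by move=> n t /=; rewrite in_itv/= => /andP[ta tb]; rewrite lee_fin q_ge0.
  (* d(gamma s, gamma t) is at most the increment of F, by the inequality between
     geometric and arithmetic means. *)
  pose F t := 2^-1 * (\int[mu]_(x in `[a, t[) w x + V t).
  apply: (@le_lt_trans _ _ (F b - F a)%:E); last exact: ltry.
  apply: limn_einf_le => N; exists N => //.
  apply: le_trans (q_integral N 1) _; rewrite lee_fin.
  apply: dyadic_sum_le => // s t sa st tb.
  rewrite expr1 vIE// ?(ltW st)// divfK ?gt_eqF ?subr_gt0//.
  rewrite /F -mulrBr (@Rintegral_itvcoD _ w a s t)//; [|exact: ltW].
  have := hd s t sa (ltW st) tb.
  have W0 : 0 <= \int[mu]_(x in `[s, t[) w x.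
    apply: (le_trans _ (weight_ge wi (ltW st) (weight_ge1_sub sa tb w1))).
    by rewrite subr_ge0 ltW.
  have V0 := energy_controlled_mono ec sa (ltW st) tb.
  set W := \int[mu]_(x in `[s, t[) w x in W0 * => H1.
  have D0 := mdist_ge0 (gamma s) (gamma t).
  rewrite -(@ler_pXn2r _ 2%N)// ?nnegrE; last by lra.
  apply: (le_trans H1); rewrite -subr_ge0.
  set I := \int[mu]_(x in _) _.
  rewrite (_ : _ - _ = ((W - (V t - V s)) / 2) ^+ 2) ?sqr_ge0//.
  by field.
pose m := (fine \o me) \_ `]a, b[.
have min_rate_ge0 t : 0 <= m t by rewrite /m patchE; case: ifP => // _; exact: fine_ge0.
have mei : mu.-integrable `]a, b[ me.
  apply/integrableP; split; first exact: mme.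
  by under eq_integral do rewrite gee0_abs//.
have mi0 : mu.-integrable `]a, b[ (EFin \o (fine \o me)).
  apply: le_integrable mei => //.
    by apply/measurable_EFinP; apply: measurableT_comp => //; exact: mme.
  move=> t _ /=; rewrite ger0_norm ?fine_ge0// gee0_abs//.
  by case: (me t) (me_ge0 t) => //= *; rewrite leey.
have mi : mu.-integrable setT (EFin \o m).
  by rewrite -restrict_EFin; apply: ((integrable_mkcond _ _).1 mi0).
have h_le_m : {ae mu, forall t, a < t -> t < b -> (m t)%:E = me t}.
  have H : {ae mu, forall x, `]a, b[%classic x -> me x \is a fin_num}.
    by apply: integrable_ae mei.
  apply: (ae_sub H) => t ht ta tb.
  rewrite /m patchE mem_set/= ?in_itv/= ?ta//.
  by rewrite fineK// ht//= in_itv/= ta.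
have d_le s t : a <= s -> s <= t -> t <= b ->
    mdist (gamma s) (gamma t) <= \int[mu]_(x in `[s, t[) m x.
  move=> sa st tb.
  have uk k : `|u k t - u k s| <= \int[mu]_(x in `[s, t[) m x.
    rewrite hu//; apply: le_trans (le_normr_Rintegral _ _) _ => //.
      exact: integrableS (hi k).
    apply: ae_le_Rintegral => //.
    - have := integrable_norm (hi k); exact: integrableS.
    - exact: integrableS mi.
    - apply: (ae_sub (ae_and h_le_m (ae_ne a))) => x [+ xa] /=.
      rewrite in_itv/= => + /andP[sx xt].
      have ax : a < x by rewrite lt_neqAle (le_trans sa)// andbT eq_sym; exact/eqP.
      move=> /(_ ax (lt_le_trans xt tb)) mx.
      by rewrite -lee_fin mx.
  apply/ler_addgt0Pr => e e0.
  have e20 : 0 < e / 2 by rewrite divr_gt0.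
  have [d d0 hd'] := unif e20.
  have sab : a <= s <= b by rewrite sa (le_trans st).
  have [k kd] := zdense s d sab d0.
  have zs : mdist (gamma s) (gamma (z k)) <= e / 2 by exact: hd'.
  have := uk k; have := ler_norm (u k t - u k s); rewrite {1 2}/u.
  have := metric_triangle (gamma s) (gamma (z k)) (gamma t).
  rewrite (metric_sym (gamma (z k))); lra.
exists m; split => //.
- have aeM := ae_is_deriv_cumul mi.
  apply: (ae_sub (ae_and aeM (ae_and aeD h_le_m))) => t [dM [dk mt]] ta tb e e0.
  have e20 : 0 < e / 2 by rewrite divr_gt0.
  have [d1 d10 hd1] := dM e e0.
  have [k hk] : exists k, m t - e / 2 <= `|h k t|.
    apply: contrapT => hN.
    have : (me t <= (m t - e / 2)%:E)%E.
      apply: ge_ereal_sup => _ [k _ <-]; rewrite lee_fin leNgt; apply/negP => hk.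
      by apply: hN; exists k; exact: ltW.
    by rewrite -mt// lee_fin leNgt ltrBlDr ltrDl e20.
  have [d2 d20 hd2] := dk k ta tb (e / 2) e20.
  exists (Num.min (Num.min d1 d2) (Num.min (t - a) (b - t))).
    by rewrite !lt_min d10 d20 !subr_gt0 ta.
  move=> s; rewrite !lt_min => /andP[/andP[s1 s2] /andP[s3 s4]].
  have sa : a <= s := norm_lt_lbound s3.
  have sb : s <= b := norm_lt_ubound s4.
  have up : mdist (gamma t) (gamma s) <= `|cumul m s - cumul m t|.
    have [st|/ltW st] := leP s t.
      rewrite metric_sym distrC (le_trans (d_le s t sa st (ltW tb)))//.
      by rewrite cumulB// ler_norm.
    by rewrite (le_trans (d_le t s (ltW ta) st sb))// cumulB// ler_norm.
  have mm : `|m t * (s - t)| = m t * `|s - t| by rewrite normrM (ger0_norm (min_rate_ge0 t)).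
  have A1 := hd1 s s1; have A2 := hd2 s s2.
  have B1 := ler_normD (cumul m s - cumul m t - m t * (s - t)) (m t * (s - t)).
  rewrite subrK mm in B1.
  have B2 := ler_normD (h k t * (s - t) - (u k s - u k t)) (u k s - u k t).
  rewrite subrK distrC normrM in B2.
  have B3 : (m t - e / 2) * `|s - t| <= `|h k t| * `|s - t| by rewrite ler_wpM2r.
  have B4 := uk_le k t s.
  rewrite mulrBl in B3.
  have E : e * `|s - t| = e / 2 * `|s - t| + e / 2 * `|s - t| by field.
  rewrite E in A1 *; exact: norm_pinch A1 A2 B1 B2 B3 B4 up.
- apply: (ae_sub (ae_and me_le h_le_m)) => t [h1 h2] ta tb.
  by rewrite h2//; exact: h1.
Qed.

(** For w = 1 the same comparison with dyadic quotients, squared, and Fatou's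
lemma. *)
Lemma metric_derivative_sqr (m : R -> R) :
  (forall s t, a <= s -> s <= t -> t <= b ->
     mdist (gamma s) (gamma t) ^+ 2 <= (t - s) * (V t - V s)) ->
  (forall t, 0 <= m t) -> measurable_fun setT m ->
  {ae mu, forall t, a < t -> t < b -> ((m t)%:E <= limn_einf (fun n => (q n t)%:E))%E} ->
  (\int[mu]_(t in `]a, b[) (m t ^+ 2)%:E <= (V b - V a)%:E)%E.
Proof.
move=> hV m0 mm hm.
have mmD D : measurable_fun D m by exact: measurable_funS mm.
apply: (@le_trans _ _ (\int[mu]_(t in `]a, b[) limn_einf (fun n => (q n t ^+ 2)%:E))%E).
  apply: ae_ge0_le_integral => //.
  - by move=> t _; rewrite lee_fin sqr_ge0.
  - by apply/measurable_EFinP; apply: measurable_funX; exact: mmD.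
  - by move=> t _; apply: (@limn_einf_ge _ _ _ 0%N) => n _; rewrite lee_fin sqr_ge0.
  - apply: (measurable_fun_limn_einf (f := fun n t => (q n t ^+ 2)%:E)) => n.
    by apply/measurable_EFinP/measurable_funX; exact: measurable_q.
  - apply: (ae_sub hm) => t + /=; rewrite in_itv/= => + /andP[ta tb] => /(_ ta tb) mq.
    apply: limn_einf_ge_eps => e e0.
    pose d := e / (2 * m t + 1).
    have d0 : 0 < d by rewrite divr_gt0// ltr_wpDl// mulr_ge0.
    have [N hN] : exists N, forall n, (N <= n)%N -> m t - d <= q n t.
      apply: contrapT => hN.
      suff : (limn_einf (fun n => (q n t)%:E) <= (m t - d)%:E)%E.
        by move=> /(le_trans mq); rewrite lee_fin; lra.
      apply: limn_einf_le => N; apply: contrapT => hN'; apply: hN; exists N => n Nn.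
      rewrite leNgt; apply/negP => qn; apply: hN'; exists n => //.
      by rewrite lee_fin ltW.
    exists N => n Nn; have qn := hN n Nn; have q0 := q_ge0 n ta tb.
    have [md|md] := leP 0 (m t - d).
      apply: (@le_trans _ _ ((m t - d) ^+ 2)); last by rewrite lerXn2r.
      have : d * (2 * m t + 1) = e by rewrite /d divfK// gt_eqF// ltr_wpDl// mulr_ge0.
      rewrite sqrrB; have := sqr_ge0 d; rewrite !expr2; lra.
    apply: (@le_trans _ _ 0); last exact: sqr_ge0.
    have : d * (2 * m t + 1) = e by rewrite /d divfK// gt_eqF// ltr_wpDl// mulr_ge0.
    have := m0 t; nra.
apply: le_trans.
  apply: fatou => //.
  - by move=> n; apply/measurable_EFinP/measurable_funX; exact: measurable_q.
  - by move=> n t _; rewrite lee_fin sqr_ge0.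
apply: limn_einf_le => N; exists N => //.
apply: le_trans (q_integral N 2) _; rewrite lee_fin.
apply: dyadic_sum_le => // s t sa st tb.
rewrite vIE// ?(ltW st)//.
have ts : 0 < t - s by rewrite subr_gt0.
rewrite (_ : _ * _ = mdist (gamma s) (gamma t) ^+ 2 / (t - s)); last first.
  by field; rewrite gt_eqF.
by rewrite ler_pdivrMr// mulrC hV// ltW.
Qed.

End MetricDerivative.

(** * Measurability of the metric speed *)

Section SpeedMeasurable.
Context {R : realType} {X : metricType R}.
Local Notation mu := (@lebesgue_measure R).
Variable c : R -> X.
Hypothesis cu : forall e : R, 0 < e -> exists2 d : R, 0 < d &
  forall s t, `|s - t| < d -> mdist (c s) (c t) <= e.

Let quot r t := mdist (c t) (c (t + r)) / `|r|.

Let measurable_quot r : measurable_fun setT (quot r).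
Proof.
apply: measurable_funM => //; apply: continuous_measurable_fun => t.
apply/cvgrPdist_le => e e0.
have [d d0 hd] := cu (divr_gt0 e0 (ltr0Sn R 1)).
exists d => //= s ts; have sd : `|s - t| < d by rewrite distrC.
have h1 := hd _ _ sd.
have h2 : mdist (c (s + r)) (c (t + r)) <= e / 2 by apply: hd; rewrite opprD addrACA subrr addr0.
have := metric_triangle (c t) (c s) (c (t + r)).
have := metric_triangle (c s) (c (s + r)) (c (t + r)).
have := metric_triangle (c s) (c t) (c (s + r)).
have := metric_triangle (c t) (c (t + r)) (c (s + r)).
rewrite (metric_sym (c (t + r)) (c (s + r))) (metric_sym (c t) (c s)).
rewrite ler_norml; lra.
Qed.

Let quot_cont (t r0 e : R) : r0 != 0 -> 0 < e -> exists2 d, 0 < d &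
  forall r, `|r0 - r| < d -> `|quot r0 t - quot r t| < e.
Proof.
move=> r00 e1; suff : {for r0, continuous (quot ^~ t)}.
  by move=> /cvgrPdist_lt => /(_ _ e1)[d /= d0 hd]; exists d.
apply: cvgM; last first.
  by apply: cvgV; [rewrite normr_eq0|apply: cvg_norm; exact: cvg_id].
apply/cvgrPdist_le => e' e0.
have [d d0 hd] := cu e0.
exists d => //= r rr; have rd : `|r - r0| < d by rewrite distrC.
have h2 : mdist (c (t + r)) (c (t + r0)) <= e' by apply: hd; rewrite opprD addrACA subrr add0r.
rewrite (metric_sym (c t)) (metric_sym (c t)) distrC.
exact: le_trans (mdist_dist _ _ _) h2.
Qed.

Let rat_seq k : R := if @unpickle rat k is Some q then ratr q else 1.

Let rat_seq_dense (x y : R) : x < y -> exists k, x < rat_seq k < y.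
Proof.
move=> xy; have [q] := rat_in_itvoo xy; rewrite in_itv/= => qxy.
by exists (pickle q); rewrite /rat_seq pickleK.
Qed.

Let small n k := (0 < `|rat_seq k|) && (`|rat_seq k| < n.+1%:R^-1).

Let osc j n k k' := [set t | small n k && small n k' ->
  `|quot (rat_seq k) t - quot (rat_seq k') t| <= j.+1%:R^-1].

Let C := \bigcap_(j in setT) \bigcup_(n in setT) \bigcap_(k in setT)
  \bigcap_(k' in setT) osc j n k k'.

Let measurable_C : measurable (C : set R).
Proof.
apply: bigcap_measurable; first by exists 0%N.
move=> j _; apply: bigcup_measurable => n _.
apply: bigcap_measurable; first by exists 0%N.
move=> k _; apply: bigcap_measurable; first by exists 0%N.
move=> k' _; have [h|h] := boolP (small n k && small n k'); last first.
  rewrite (_ : osc _ _ _ _ = setT)//; apply/seteqP; split => // t _.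
  by rewrite /osc/= (negbTE h).
have mf : measurable_fun setT (fun t => `|quot (rat_seq k) t - quot (rat_seq k') t|).
  by apply: measurableT_comp => //; apply: measurable_funB.
rewrite (_ : osc _ _ _ _ = setT `&` (fun t => `|quot (rat_seq k) t - quot (rat_seq k') t|) @^-1` `]-oo, j.+1%:R^-1]).
  exact: mf.
rewrite setTI; apply/seteqP; split => t /=; rewrite in_itv/=; first by move=> /(_ h).
by move=> + _.
Qed.

Let F t := (fun s => mdist (c t) (c s) / `|s - t|) @ t^'.

Let FE t s : mdist (c t) (c s) / `|s - t| = quot (s - t) t.
Proof. by rewrite /quot (addrC t) subrK. Qed.

Let C_cvg t : C t -> cvg (F t).
Proof.
move=> Ct; apply: (cauchy_cvg (T := R)); apply: cauchy_exP => e e0.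
have e20 : 0 < e / 2 by rewrite divr_gt0.
have [j je] : exists j : nat, j.+1%:R^-1 < e / 2.
  have [j _ hj] := near_infty_natSinv_lt (PosNum e20).
  by exists j; apply: hj => /=.
have [n _ hn] := Ct j I.
have n0 : 0 < n.+1%:R^-1 :> R by rewrite invr_gt0.
have [k0 /andP[k01 k02]] := rat_seq_dense n0.
have k0s : small n k0 by rewrite /small gtr0_norm// k01.
exists (quot (rat_seq k0) t); exists n.+1%:R^-1 => //= s ts st; have sd : `|s - t| < n.+1%:R^-1 by rewrite distrC.
rewrite /ball/= FE.
have r0 : s - t != 0 by rewrite subr_eq0.
have [d d0 hd] := @quot_cont t _ _ r0 e20.
pose d' := Num.min d (Num.min `|s - t| (n.+1%:R^-1 - `|s - t|)).
have d'0 : 0 < d' by rewrite !lt_min d0 normr_gt0 r0 subr_gt0.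
have [k1 /andP[k11 k12]] := @rat_seq_dense (s - t - d') (s - t + d') ltac:(lra).
have k1d : `|s - t - rat_seq k1| < d' by rewrite ltr_norml; lra.
have := k1d; rewrite !lt_min => /andP[kd /andP[kd1 kd2]].
have k1s : small n k1.
  rewrite /small; have := ler_normB (s - t) (s - t - rat_seq k1).
  have := ler_normD (s - t - rat_seq k1) (rat_seq k1).
  rewrite subrK subKr => A B; apply/andP; split; last first.
    by rewrite (le_lt_trans B)// addrC -ltrBrDr.
  by rewrite -(ltrD2l `|s - t - rat_seq k1|) addr0 (lt_le_trans kd1).
have h1 := hd (rat_seq k1) kd.
have h2 := hn k0 I k1 I; rewrite /osc/= k0s k1s in h2.
have h3 := h2 isT.
have := ler_distD (quot (rat_seq k1) t) (quot (rat_seq k0) t) (quot (s - t) t).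
move=> H; rewrite (le_lt_trans H)// [ltRHS]splitr ltrD//; last by rewrite distrC.
exact: le_lt_trans h3 je.
Qed.

Let cvg_C t : cvg (F t) -> C t.
Proof.
move=> /cvg_ex[/= l /cvgrPdist_le Fl] j _.
have e0 : 0 < j.+1%:R^-1 / 2 :> R by rewrite divr_gt0// invr_gt0.
have [d /= d0 hd] := Fl _ e0.
have [n nd] : exists n : nat, n.+1%:R^-1 < d.
  have [n _ hn] := near_infty_natSinv_lt (PosNum d0).
  by exists n; apply: hn => /=.
exists n => // k _ k' _; rewrite /osc/= => /andP[/andP[k1 k2] /andP[k3 k4]].
have key i : 0 < `|rat_seq i| -> `|rat_seq i| < n.+1%:R^-1 ->
    `|l - quot (rat_seq i) t| <= j.+1%:R^-1 / 2.
  move=> i1 i2; have := hd (t + rat_seq i).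
  rewrite FE [t + _ - t]addrAC subrr add0r; apply.
    by rewrite /ball_/= opprD addrA subrr add0r normrN; exact: lt_trans nd.
  by rewrite -subr_eq0 [t + _ - t]addrAC subrr add0r -normr_gt0.
have h1 := key k k1 k2; have h2 := key k' k3 k4.
have := ler_distD l (quot (rat_seq k) t) (quot (rat_seq k') t).
move=> H; rewrite (le_trans H)// [leRHS]splitr lerD//.
by rewrite distrC.
Qed.

(** By continuity, the Cauchy criterion for the difference quotients may be
tested on rational increments, so the set [C] where the limit exists is measurable;
outside it [lim] takes a constant default value. *)
Lemma measurable_metric_speed : measurable_fun setT (metric_speed c).
Proof.
pose g t := fine (limn_esup (fun n => (quot n.+1%:R^-1 t)%:E)).
have mg : measurable_fun setT g.
  apply: measurableT_comp => //; apply: measurable_fun_limn_esup => n.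
  by apply/measurable_EFinP; exact: measurable_quot.
rewrite (_ : metric_speed c = g \_ C).
  apply/(measurable_restrictT _ _).1 => //; exact: measurable_funS mg.
apply/funext => t; rewrite patchE; case: ifPn => [/set_mem Ct|/negP nCt].
  have /cvg_ex[/= l Fl] := C_cvg Ct.
  have -> : metric_speed c t = l by apply: cvg_lim.
  suff H : (fun n => (quot n.+1%:R^-1 t)%:E) @ \oo --> l%:E.
    by rewrite /g (cvg_limn_einf_sup H).2.
  apply: cvg_EFin; first exact: nearW.
  apply/cvgrPdist_le => e e0.
  move/cvgrPdist_le : Fl => /(_ _ e0)[d /= d0 hd].
  have [N _ hN] := near_infty_natSinv_lt (PosNum d0).
  exists N => // n /= Nn; have := hd (t + n.+1%:R^-1).
  rewrite FE [t + _ - t]addrAC subrr add0r; apply.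
    by rewrite /ball_/= opprD addrA subrr add0r normrN gtr0_norm ?invr_gt0//; exact: hN.
  by rewrite -subr_eq0 [t + _ - t]addrAC subrr add0r invr_neq0.
(* Outside C no value is a limit, so lim is the default point on both sides. *)
apply: xgetPN => l Fl.
by apply: nCt; apply/mem_set/cvg_C/cvg_ex; exists l.
Qed.

End SpeedMeasurable.

(** * Curves of finite action *)

Section Action.
Context {R : realType} {X : metricType R}.
Local Notation mu := (@lebesgue_measure R).
Implicit Types (gamma : R -> X) (V : R -> R).

(** A curve whose squared speed has primitive V satisfies this by the
Cauchy-Schwarz inequality. Unlike the speed itself, the inequality is stable under
pointwise limits, gluing, time change and Lipschitz maps. *)
Definition path_mod (a b : R) gamma V := forall s t : R, a <= s -> s <= t -> t <= b ->
  mdist (gamma s) (gamma t) ^+ 2 <= (t - s) * (V t - V s).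

Definition energy_mod gamma V := path_mod 0 1 gamma V.

Definition ucont01 gamma := forall e : R, 0 < e -> exists2 d : R, 0 < d &
  forall s t, 0 <= s -> s <= t -> t <= 1 -> t - s < d -> mdist (gamma s) (gamma t) <= e.

Lemma path_mod_mono a b gamma V s t : path_mod a b gamma V ->
  a <= s -> s <= t -> t <= b -> V s <= V t.
Proof.
move=> h sa; rewrite le_eqVlt => /predU1P[->//|st] tb.
have := le_trans (sqr_ge0 _) (h s t sa (ltW st) tb).
by rewrite pmulr_rge0 ?subr_gt0// subr_ge0.
Qed.

Lemma energy_mod_controlled gamma V : energy_mod gamma V ->
  energy_controlled 0 1 (\1_(`[0, 1[%classic : set R)) V
    (fun s t => mdist (gamma s) (gamma t)).
Proof.
move=> h; split; first exact: integrable_indic_itv.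
  by move=> t t0 t1; rewrite indicE mem_set//= in_itv/= t0.
by move=> s t s0 st t1; rewrite Rintegral_indic_itvco// h.
Qed.

Lemma energy_controlled_ucont gamma w V :
  energy_controlled 0 1 w V (fun s t => mdist (gamma s) (gamma t)) -> ucont01 gamma.
Proof.
move=> ec e e0; have [d d0 hd] := energy_controlled_unif ler01 ec e0.
exists d => // s t s0 st t1 sd; exact: le_trans (ler_norm _) (hd _ _ s0 st t1 sd).
Qed.

(** Extends a curve on [0, 1] to a uniformly continuous one on the line. *)
Definition clamp01 (t : R) : R := Num.max 0 (Num.min 1 t).

Lemma clamp01_id t : 0 <= t -> t <= 1 -> clamp01 t = t.
Proof. by move=> t0 t1; rewrite /clamp01 min_r// max_r. Qed.

Lemma clamp01_in t : 0 <= clamp01 t <= 1.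
Proof. by rewrite /clamp01 le_max lexx/= ge_max ler01 ge_min lexx. Qed.

Lemma clamp01_lip s t : s <= t -> clamp01 s <= clamp01 t <= clamp01 s + (t - s).
Proof.
move=> st; rewrite /clamp01 /Num.max /Num.min.
by do ! case: ifPn; rewrite -?leNgt; lra.
Qed.

Lemma ucont01_clamp gamma : ucont01 gamma -> forall e : R, 0 < e ->
  exists2 d : R, 0 < d &
  forall s t, `|s - t| < d -> mdist (gamma (clamp01 s)) (gamma (clamp01 t)) <= e.
Proof.
move=> uc e e0; have [d d0 hd] := uc e e0; exists d => //.
have key s t : s <= t -> `|s - t| < d -> mdist (gamma (clamp01 s)) (gamma (clamp01 t)) <= e.
  move=> st; rewrite distrC ger0_norm ?subr_ge0// => std.
  have /andP[c1 c2] := clamp01_lip st.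
  have /andP[s0 _] := clamp01_in s; have /andP[_ t1] := clamp01_in t.
  apply: hd => //; lra.
move=> s t std; have [st|/ltW ts] := leP s t; first exact: key.
by rewrite metric_sym; apply: key => //; rewrite distrC.
Qed.

Lemma metric_speed_clamp gamma t : 0 < t -> t < 1 ->
  metric_speed gamma t = metric_speed (gamma \o clamp01) t.
Proof.
move=> t0 t1.
have H : {near t^', (fun s => mdist (gamma t) (gamma s) / `|s - t|) =1
    (fun s => mdist ((gamma \o clamp01) t) ((gamma \o clamp01) s) / `|s - t|)}.
  have d0 : 0 < Num.min t (1 - t) by rewrite lt_min t0 subr_gt0.
  exists (Num.min t (1 - t)) => //= s; rewrite /ball_/= lt_min => /andP[s1 s2] _.
  rewrite !(clamp01_id (ltW t0) (ltW t1)) clamp01_id//.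
    by move: s1; rewrite ltr_norml; lra.
  by move: s2; rewrite ltr_norml; lra.
rewrite /metric_speed; congr lim; apply/funext => A; apply/propext; split.
  exact: (near_eq_cvg H).
by apply: near_eq_cvg; apply: filterS H => s ->.
Qed.

Lemma measurable_metric_speed01 gamma : ucont01 gamma ->
  measurable_fun (`[0, 1]%classic : set R) (metric_speed gamma).
Proof.
move=> uc.
have m1 := measurable_metric_speed (ucont01_clamp uc).
apply: (@measurable_fun_itv_cc _ _ _ false true).
apply: (@eq_measurable_fun _ _ _ _ _ (metric_speed (gamma \o clamp01))).
  by move=> t; rewrite inE/= in_itv/= => /andP[t0 t1]; rewrite -metric_speed_clamp.
exact: measurable_funS m1.
Qed.

Lemma is_mderiv_speed gamma t l : is_mderiv gamma t l -> metric_speed gamma t = l.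
Proof.
move=> h; apply: cvg_lim => //; apply/cvgrPdist_le => e e0.
have [d d0 hd] := h e e0; exists d => //= s ts st.
have std : `|s - t| < d by rewrite distrC.
have n0 : 0 < `|s - t| by rewrite normr_gt0 subr_eq0.
rewrite (_ : l - _ = - ((mdist (gamma t) (gamma s) - l * `|s - t|) / `|s - t|)).
  by rewrite normrN normrM normfV normr_id ler_pdivrMr// hd.
by field; rewrite gt_eqF.
Qed.

Lemma ae_itv01 (P : R -> Prop) : {ae mu, forall t, 0 < t -> t < 1 -> P t} ->
  {ae mu, forall t, `[0, 1]%classic t -> P t}.
Proof.
move=> h; apply: (ae_sub (ae_and h (ae_and (ae_ne 0) (ae_ne 1)))) => t [ht [t0 t1]] /=.
rewrite in_itv/= => /andP[t0' t1']; apply: ht.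
  by rewrite lt_neqAle t0' andbT eq_sym; exact/eqP.
by rewrite lt_neqAle t1' andbT; exact/eqP.
Qed.

Lemma integral_speed_sqr gamma w V m :
  energy_controlled 0 1 w V (fun s t => mdist (gamma s) (gamma t)) ->
  measurable_fun setT m ->
  {ae mu, forall t, 0 < t -> t < 1 -> is_mderiv gamma t (m t)} ->
  (\int[mu]_(t in `[0%R, 1%R]) (metric_speed gamma t ^+ 2)%:E =
   \int[mu]_(t in `[0%R, 1%R]) (m t ^+ 2)%:E)%E.
Proof.
move=> ec mm hm.
have ms := measurable_metric_speed01 (energy_controlled_ucont ec).
apply: ge0_ae_eq_integral => //.
- by apply/measurable_EFinP; exact: measurable_funX.
- by apply/measurable_EFinP; apply: measurable_funX; exact: measurable_funS mm.
- by move=> t _; rewrite lee_fin sqr_ge0.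
- by move=> t _; rewrite lee_fin sqr_ge0.
- apply: (ae_itv01 (P := fun t => (metric_speed gamma t ^+ 2)%:E = (m t ^+ 2)%:E)).
  by apply: (ae_sub hm) => t ht t0 t1; rewrite (is_mderiv_speed (ht t0 t1)).
Qed.

(** Take w = 1 + |f| and V its primitive. *)
Lemma abs_cont_controlled (a b : R) gamma : abs_cont a b gamma -> exists w V,
  energy_controlled a b w V (fun s t => mdist (gamma s) (gamma t)).
Proof.
move=> [f fi hf].
pose w := (fun t => 1 + `|f t|) \_ `[a, b].
have w0i : mu.-integrable `[a, b] (EFin \o (fun t => 1 + `|f t|)).
  apply: (@integrableD _ _ _ mu `[a, b]%classic _ (cst 1%E) (fun t => `|f t|%:E)) => //.
    apply/integrableP; split => //.
    under eq_integral do rewrite abse1.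
    rewrite integral_cst//= mul1e lebesgue_measure_itv/=.
    by case: ifP; rewrite -?EFinB ltry.
  exact: integrable_norm.
have wi : mu.-integrable setT (EFin \o w).
  by rewrite -restrict_EFin; apply: ((integrable_mkcond _ _).1 w0i).
exists w, (cumul w); split => //.
  move=> t t0 t1; rewrite /w patchE mem_set/= ?in_itv/= ?t0 ?(ltW t1)//.
  by rewrite lerDl.
move=> s t s0 st t1; rewrite -cumulB// -expr2.
have h1 : mdist (gamma s) (gamma t) <= \int[mu]_(x in `[s, t[) w x.
  apply: le_trans (hf s t s0 st t1) _.
  have sub : `[s, t] `<=` `[a, b] by apply: subset_itv; rewrite bnd_simp.
  rewrite Rintegral_itv_bndo_bndc; last exact: integrableS wi.
  apply: le_Rintegral => //; [exact: integrableS fi|exact: integrableS wi|].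
  move=> x xst; rewrite /w patchE mem_set; last exact: sub.
  by have := ler_norm (f x); lra.
by rewrite lerXn2r ?nnegrE ?mdist_ge0// (le_trans _ h1)// mdist_ge0.
Qed.

(** Expand the square of m minus its mean value. *)
Lemma cauchy_schwarz_itv (m : R -> R) s t : s <= t ->
  mu.-integrable `[s, t[ (EFin \o m) ->
  mu.-integrable `[s, t[ (EFin \o (fun x => m x ^+ 2)) ->
  (\int[mu]_(x in `[s, t[) m x) ^+ 2 <= (t - s) * \int[mu]_(x in `[s, t[) (m x ^+ 2).
Proof.
rewrite le_eqVlt => /predU1P[->|st] mi m2i.
  by rewrite set_itvco0 ?Rintegral_set0 ?expr0n/= ?subrr ?mul0r.
have ts : 0 < t - s by rewrite subr_gt0.
set I := \int[mu]_(x in _) m x; set J := \int[mu]_(x in _) (_ ^+ 2).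
pose c := I / (t - s).
have c1i := integrable_cst_itv (c ^+ 2) s t.
have : 0 <= \int[mu]_(x in `[s, t[) ((m x ^+ 2 - 2 * c * m x) + c ^+ 2).
  by apply: Rintegral_ge0 => x _; rewrite (_ : _ + _ = (m x - c) ^+ 2) ?sqr_ge0//; ring.
have m1i : mu.-integrable `[s, t[ (EFin \o (fun x => 2 * c * m x)).
  exact: (integrableZl _ (2 * c) mi).
rewrite RintegralD//; last exact: (integrableB _ m2i m1i).
rewrite RintegralB// RintegralZl// Rintegral_cst//= lebesgue_measure_itv/= lte_fin st.
rewrite -/I -/J -EFinB/= -(ler_pM2r ts) mul0r /c => H.
rewrite -subr_ge0; apply: le_trans H _; rewrite le_eqVlt; apply/orP; left; apply/eqP.
by field; rewrite gt_eqF.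
Qed.

(** V is the primitive of the squared metric derivative. *)
Theorem action_energy_mod gamma : (action gamma < +oo)%E -> exists V,
  [/\ energy_mod gamma V, action gamma = (2^-1 * (V 1 - V 0))%:E &
   forall e : R, 0 < e -> exists2 d : R, 0 < d &
     forall s t, 0 <= s -> s <= t -> t <= 1 -> t - s < d -> V t - V s <= e].
Proof.
rewrite /action; case: ifPn => // /asboolP ac afin.
have [w [V0 ec]] := abs_cont_controlled ac.
have [m [m0 mi dm aem _]] := metric_derivative ltr01 ec.
have /measurable_EFinP mm := measurable_int mu mi.
have mmT : measurable_fun setT m by exact: mm.
have E := integral_speed_sqr ec mmT aem.
rewrite E in afin *.
have m2i0 : mu.-integrable `[0, 1] (EFin \o (fun t => m t ^+ 2)).
  apply/integrableP; split.
    by apply/measurable_EFinP; apply: measurable_funX; exact: measurable_funS mmT.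
  under eq_integral do rewrite /= ger0_norm ?sqr_ge0//.
  rewrite ltey; apply: contraTneq afin => ->.
  by rewrite gt0_muley// lte_fin invr_gt0.
pose M := (fun t => m t ^+ 2) \_ `[0, 1].
have Mi : mu.-integrable setT (EFin \o M).
  by rewrite -restrict_EFin; apply: ((integrable_mkcond _ _).1 m2i0).
have ME s t : 0 <= s -> s <= t -> t <= 1 ->
    cumul M t - cumul M s = \int[mu]_(x in `[s, t[) (m x ^+ 2).
  move=> s0 st t1; rewrite -cumulB//; apply: eq_Rintegral => x.
  rewrite inE/= in_itv/= => /andP[x1 x2].
  by rewrite /M patchE mem_set//= in_itv/= (le_trans s0)// (le_trans (ltW x2)).
have sub s t : 0 <= s -> t <= 1 -> `[s, t[ `<=` `[0, 1].
  by move=> s0 t1; apply: subset_itv; rewrite bnd_simp.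
exists (cumul M); split.
- move=> s t s0 st t1; rewrite ME//.
  apply: le_trans (cauchy_schwarz_itv st _ _).
  + rewrite lerXn2r ?nnegrE ?mdist_ge0//; last exact: dm.
    by apply: Rintegral_ge0 => x _; exact: m0.
  + exact: integrableS mi.
  + by apply: integrableS m2i0 => //; exact: sub.
- rewrite ME// EFinM; congr (_ * _)%E.
  rewrite Rintegral_itv_bndo_bndc; last by apply: integrableS m2i0 => //; exact: sub.
  by rewrite fineK//; exact: integrable_fin_num m2i0.
- move=> e e0; have [d [d0 hd]] := integral_normr_continuous Mi e0.
  exists d => // s t s0 st t1 std; rewrite -cumulB//.
  have mI : (mu `[s, t[%classic < d%:E)%E.
    rewrite lebesgue_measure_itv/= lte_fin; case: ifP => _.
      by rewrite -EFinB lte_fin.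
    by rewrite lte_fin.
  apply: (le_trans _ (ltW (hd `[s, t[%classic _ mI))) => //.
  rewrite (le_trans _ (le_normr_Rintegral _ _)) ?ler_norm//.
  exact: integrableS Mi.
Qed.

(** The metric derivative exists for any such curve, and the integral of its
square is at most V 1 - V 0. *)
Theorem energy_mod_action gamma V : energy_mod gamma V ->
  AC2 gamma /\ (action gamma <= (2^-1 * (V 1 - V 0))%:E)%E.
Proof.
move=> em; have ec := energy_mod_controlled em.
have [m [m0 mi dm aem lim]] := metric_derivative ltr01 ec.
have /measurable_EFinP mm := measurable_int mu mi.
have mmT : measurable_fun setT m by exact: mm.
have E := integral_speed_sqr ec mmT aem.
have I1 := metric_derivative_sqr ltr01 em m0 mmT lim.
have ac : abs_cont 0 1 gamma.
  exists m; first exact: integrableS mi.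
  move=> s t s0 st t1; rewrite -Rintegral_itv_bndo_bndc; first exact: dm.
  exact: integrableS mi.
have I2 : (\int[mu]_(t in `[0%R, 1%R]) (metric_speed gamma t ^+ 2)%:E <= (V 1 - V 0)%:E)%E.
  rewrite E (@integral_itv_bndoo _ 0 1 _ true false)//.
  by apply/measurable_EFinP; apply: measurable_funX; exact: measurable_funS mmT.
split; last first.
  rewrite /action; case: ifPn => [_|/asboolP//].
  by rewrite EFinM lee_pmul2l.
split => //; apply/integrableP; split.
  apply/measurable_EFinP; apply: measurable_funX.
  exact: measurable_metric_speed01 (energy_controlled_ucont ec).
apply: le_lt_trans (ltry (V 1 - V 0)); apply: le_trans I2.
apply: ge0_le_integral => //.
- apply: measurableT_comp => //; apply/measurable_EFinP; apply: measurable_funX.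
  exact: measurable_metric_speed01 (energy_controlled_ucont ec).
- apply/measurable_EFinP; apply: measurable_funX.
  exact: measurable_metric_speed01 (energy_controlled_ucont ec).
- by move=> t _; rewrite gee0_abs// lee_fin sqr_ge0.
Qed.

End Action.

(** * Bounds from derivatives *)

Section DerivativeBound.
Context {R : realType}.
Local Notation mu := (@lebesgue_measure R).

Lemma is_deriv_unique (u : R -> R) t l l' : is_deriv u t l -> is_deriv u t l' -> l = l'.
Proof.
move=> h h'; apply/eqP; rewrite -subr_eq0 -normr_le0; apply/ler_addgt0Pr => e e0.
have e20 : 0 < e / 2 by rewrite divr_gt0.
have [d d0 hd] := h _ e20; have [d' d'0 hd'] := h' _ e20.
pose r := Num.min d d' / 2.
have r0 : 0 < r by rewrite divr_gt0// lt_min d0.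
have : r < Num.min d d' by rewrite /r ltr_pdivrMr// ltr_pMr ?lt_min ?d0// ltr1n.
rewrite lt_min => /andP[rd rd'].
have E : t + r - t = r by ring.
have := hd (t + r); have := hd' (t + r); rewrite E (gtr0_norm r0) => /(_ rd') A /(_ rd) B.
rewrite add0r -(ler_pM2r r0) -{1}(gtr0_norm r0) -normrM.
rewrite (_ : (l - l') * r = (u (t + r) - u t - l' * r) - (u (t + r) - u t - l * r)); last by ring.
apply: le_trans (ler_normB _ _) _; rewrite [e]splitr mulrDl; exact: lerD.
Qed.

(** The control by w and V excludes a singular part of phi, so its increment is
the integral of its derivative. *)
Lemma deriv_le_incr (phi w V : R -> R) (a b C : R) : a < b ->
  energy_controlled a b w V (fun s t => phi t - phi s) ->
  {ae mu, forall t, a < t -> t < b -> derivable phi t 1 /\ derive1 phi t <= C} ->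
  phi b - phi a <= C * (b - a).
Proof.
move=> ab ec hC.
have [h hi hphi] := energy_controlled_ac ab ec.
rewrite hphi//; [|exact: ltW].
have mh : measurable_fun (`[a, b[%classic : set R) h.
  have /measurable_EFinP := measurable_int mu hi.
  by move=> H; exact: measurable_funS H.
have hle : {ae mu, forall t, `[a, b[%classic t -> h t <= C}.
  apply: (ae_sub (ae_and (ae_ne a) (ae_and hC (ae_is_deriv hi hphi)))).
  move=> t [ta [h1 h2]] /=; rewrite in_itv/= => /andP[ta' tb].
  have at' : a < t by rewrite lt_neqAle ta' andbT eq_sym; exact/eqP.
  have [d1 d2] := h1 at' tb.
  by rewrite (is_deriv_unique (h2 at' tb) (derivable_is_deriv d1)).
pose h' t := Num.min (h t) C.
have mh' : measurable_fun (`[a, b[%classic : set R) h'.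
  exact: measurable_minr.
have -> : \int[mu]_(x in `[a, b[) h x = \int[mu]_(x in `[a, b[) h' x.
  rewrite /Rintegral; congr fine; apply: ae_eq_integral => //.
  - by apply/measurable_EFinP.
  - by apply/measurable_EFinP.
  - by apply: (ae_sub hle) => t ht tD; rewrite /h' min_l// ht.
have hi' : mu.-integrable `[a, b[ (EFin \o h') .
  apply: (@eq_integrable _ _ _ mu _ _ _ (EFin \o h')) => //.
  have ci := integrable_cst_itv C a b.
  have hi2 : mu.-integrable `[a, b[ (EFin \o h) by exact: integrableS hi.
  have : mu.-integrable `[a, b[ (EFin \o (fun t => `|h t| + `|C|)).
    exact: (integrableD _ (integrable_norm hi2) (integrable_norm ci)).
  apply: le_integrable => //; first exact/measurable_EFinP.
  move=> t _; rewrite lee_fin /h' /Num.min; case: ifP => _.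
    by rewrite [leRHS]ger0_norm ?addr_ge0// lerDl.
  by rewrite [leRHS]ger0_norm ?addr_ge0// lerDr.
apply: (@le_trans _ _ (\int[mu]_(x in `[a, b[) cst C x)).
  apply: le_Rintegral => //; first exact: integrable_cst_itv.
  by move=> x _; rewrite /h' ge_min lexx orbT.
by rewrite Rintegral_cst//= lebesgue_measure_itv/= lte_fin ab -EFinB/=.
Qed.

Context {X : metricType R}.

Lemma controlled_bounded (gamma : R -> X) (z : X) a b w V : a <= b ->
  energy_controlled a b w V (fun s t => mdist (gamma s) (gamma t)) ->
  exists B, forall t, a <= t -> t <= b -> mdist (gamma t) z <= B.
Proof.
move=> ab ec; have [wi w1 hd] := ec.
pose W := \int[mu]_(x in `[a, b[) w x.
exists (mdist (gamma a) z + (1 + W * (V b - V a))) => t ta tb.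
have W0 s r : a <= s -> s <= r -> r <= b -> 0 <= \int[mu]_(x in `[s, r[) w x.
  move=> sa sr rb.
  apply: (le_trans _ (weight_ge wi sr (weight_ge1_sub sa rb w1))).
  by rewrite subr_ge0.
have := metric_triangle (gamma t) (gamma a) z.
rewrite (metric_sym (gamma t) (gamma a)).
suff : mdist (gamma a) (gamma t) <= 1 + W * (V b - V a) by lra.
have := hd a t (lexx a) ta tb.
have h1 : \int[mu]_(x in `[a, t[) w x <= W.
  by rewrite /W (@Rintegral_itvcoD _ _ a t b)// lerDl W0.
have h2 := energy_controlled_mono ec ta tb (lexx b).
have h3 := energy_controlled_mono ec (lexx a) ta tb.
have h4 := W0 a t (lexx a) ta tb.
have h5 : \int[mu]_(x in `[a, t[) w x * (V t - V a) <= W * (V b - V a).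
  by rewrite ler_pM ?subr_ge0// lerD2r.
move=> h6; have := mdist_ge0 (gamma a) (gamma t).
move: h6 h5; set I := \int[mu]_(x in _) _ * _; set D := mdist _ _.
move=> h6 h5 D0; have := sqr_ge0 (D - 1); rewrite sqrrB; nra.
Qed.

Lemma controlled_sqr_dist (gamma : R -> X) (z : X) a b w V : a <= b ->
  energy_controlled a b w V (fun s t => mdist (gamma s) (gamma t)) ->
  exists V', energy_controlled a b w V'
    (fun s t => mdist (gamma t) z ^+ 2 - mdist (gamma s) z ^+ 2).
Proof.
move=> ab ec; have [wi w1 hd] := ec.
have [B hB] := controlled_bounded z ab ec.
exists (fun t => (2 * B) ^+ 2 * V t); split => // s t sa st tb.
have D := mdist_dist (gamma s) (gamma t) z.
rewrite -mulrBr mulrCA; apply: (@le_trans _ _ ((2 * B) ^+ 2 * mdist (gamma s) (gamma t) ^+ 2)).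
  have B1 := hB s sa (le_trans st tb); have B2 := hB t (le_trans sa st) tb.
  have d1 := mdist_ge0 (gamma s) z; have d2 := mdist_ge0 (gamma t) z.
  rewrite subr_sqr exprMn mulrC ler_pM ?sqr_ge0//.
    by rewrite lerXn2r ?nnegrE ?addr_ge0 ?mulr_ge0//; lra.
  rewrite -(real_normK (num_real (mdist (gamma t) z - _))) distrC.
  by rewrite lerXn2r ?nnegrE ?mdist_ge0.
by rewrite ler_wpM2l ?sqr_ge0// hd.
Qed.

End DerivativeBound.

(** * Gradient flows: energy decay and contraction *)

Lemma nbhs_mdist_ex (R : realType) (X : metricType R) (x : X) (V : set X) :
  nbhs x V <-> exists2 r : R, 0 < r & forall y, mdist x y < r -> V y.
Proof.
rewrite -nbhs_ballE; split => -[r r0 h]; exists r => // y.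
  by move=> xy; apply: h; rewrite ballEmdist.
by rewrite ballEmdist; exact: h.
Qed.

Section EVIFlow.
Context {R : realType} {X : metricType R}.
Local Notation mu := (@lebesgue_measure R).
Variables (E : X -> \bar R) (lambda : R).
Hypothesis E_proper : forall z, E z != -oo%E.
Hypothesis E_lsc : lower_semicontinuous E.
Hypothesis E_dom : exists z, (E z < +oo)%E.
Let L := `|lambda|.

Lemma dom_fin z : (E z < +oo)%E -> E z = (fine (E z))%:E.
Proof. by move=> h; rewrite fineK// fin_numE E_proper/= lt_eqF. Qed.

Section OneFlow.
Variables (x0 : X) (gamma : R -> X).
Hypothesis flow : EVI_flow E lambda x0 gamma.
Let e t := E (gamma t).

Lemma flow_controlled a b : 0 < a -> a <= b -> exists w V,
  energy_controlled a b w V (fun s t => mdist (gamma s) (gamma t)).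
Proof.
move=> a0 ab; apply: abs_cont_controlled.
have [ac _ _] := flow; apply: ac => // t /=.
by rewrite !in_itv/= andbT => /andP[ta _]; exact: lt_le_trans ta.
Qed.

Lemma flow_bounded a b z : 0 < a -> a <= b ->
  exists B, forall t, a <= t -> t <= b -> mdist (gamma t) z <= B.
Proof.
move=> a0 ab; have [w [V ec]] := flow_controlled a0 ab.
exact: controlled_bounded ec.
Qed.

Lemma flow_unif a b : 0 < a -> a <= b -> forall e : R, 0 < e ->
  exists2 d : R, 0 < d & forall s t, a <= s -> s <= t -> t <= b -> t - s < d ->
    mdist (gamma s) (gamma t) <= e.
Proof.
move=> a0 ab r r0; have [w [V ec]] := flow_controlled a0 ab.
have [d d0 hd] := energy_controlled_unif ab ec r0.
exists d => // s t s0 st t1 sd; exact: le_trans (ler_norm _) (hd _ _ s0 st t1 sd).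
Qed.

(** The squared distance to z is absolutely continuous, so the differential
inequality of the flow can be integrated. *)
Lemma flow_dist_incr a b z C : 0 < a -> a < b -> (E z < +oo)%E ->
  (forall t, a < t -> t < b -> (e t < +oo)%E ->
    fine (E z) - fine (e t) + L / 2 * mdist (gamma t) z ^+ 2 <= C) ->
  2^-1 * mdist (gamma b) z ^+ 2 - 2^-1 * mdist (gamma a) z ^+ 2 <= (b - a) * C.
Proof.
move=> a0 ab zE hC; have [w [V ec]] := flow_controlled a0 (ltW ab).
have [V' ec'] := controlled_sqr_dist z (ltW ab) ec.
rewrite -mulrBr -(ler_pM2l (ltr0Sn R 1)) mulrA divff// mul1r.
rewrite mulrA mulrC mulrA (mulrC C).
apply: (deriv_le_incr ab ec').
have [_ _ /(_ z)/= evi] := flow.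
apply: (ae_sub evi) => t + ta tb => /(_ (lt_trans a0 ta))[dt].
rewrite -/(e t) => h; split => //.
have et : (e t < +oo)%E.
  by apply: contraTT h; rewrite -leNgt leye_eq => /eqP ->; rewrite addey// -ltNge.
move: h; rewrite (dom_fin zE) -/(e t) [e t]dom_fin// -EFinD lee_fin -/(e t).
have := hC t ta tb et.
have : - lambda * mdist (gamma t) z ^+ 2 <= L * mdist (gamma t) z ^+ 2.
  by rewrite ler_wpM2r ?sqr_ge0// /L -normrN ler_norm.
lra.
Qed.

Lemma flow_dom_dense a b : 0 < a -> a < b -> exists2 t, a < t < b & (e t < +oo)%E.
Proof.
move=> a0 ab; have [z zE] := E_dom; have [_ _ /(_ z)/= evi] := flow.
have [t /andP[ta tb] ht] := ae_witness ab evi; exists t; first by rewrite ta.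
have [_ h] := ht (lt_trans a0 ta).
have := le_lt_trans h zE; rewrite -/(e t).
by case: (e t) => [r| |]//=; rewrite ?ltry ?ltNyr.
Qed.

(** Otherwise the energy stays above E (gamma a) on ]a, b]; the inequality
tested at z = gamma a then bounds the supremum of d(gamma r, gamma a)^2 by its half,
and gamma does not move. *)
Lemma flow_return a b : 0 < a -> a < b -> L * (b - a) <= 2^-1 -> (e a < +oo)%E ->
  exists2 r, a < r <= b & (e r <= e a)%E.
Proof.
move=> a0 ab Lab ea; apply: contrapT => hN.
have hgt r : a < r -> r <= b -> (e a < e r)%E.
  by move=> ar rb; rewrite ltNge; apply/negP => re; apply: hN; exists r; rewrite ?ar.
have [B hB] := flow_bounded (gamma a) a0 (ltW ab).
pose S := [set mdist (gamma r) (gamma a) ^+ 2 | r in `[a, b]].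
have S0 : S !=set0 by exists (mdist (gamma a) (gamma a) ^+ 2), a => //=; rewrite in_itv/= lexx ltW.
have hS : has_sup S.
  split => //; exists (B ^+ 2) => _ [r /= + <-]; rewrite in_itv/= => /andP[ar rb].
  by have := hB r ar rb; have := mdist_ge0 (gamma r) (gamma a); rewrite !expr2; nra.
have Sle r : a <= r -> r <= b -> mdist (gamma r) (gamma a) ^+ 2 <= sup S.
  by move=> ar rb; apply: sup_upper_bound => //; exists r => //=; rewrite in_itv/= ar.
have sup0 : 0 <= sup S.
  by have := Sle a (lexx a) (ltW ab); apply: le_trans; rewrite sqr_ge0.
have half r : a <= r -> r <= b -> mdist (gamma r) (gamma a) ^+ 2 <= sup S / 2.
  rewrite le_eqVlt => /predU1P[<- _|ar rb].
    by rewrite mdistxx expr0n/= divr_ge0.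
  have := @flow_dist_incr a r (gamma a) (L / 2 * sup S) a0 ar ea.
  rewrite mdistxx expr0n/= mulr0 subr0 => H.
  suff : 2^-1 * mdist (gamma r) (gamma a) ^+ 2 <= (r - a) * (L / 2 * sup S).
    have L0 : 0 <= L by exact: normr_ge0.
    have : L * (r - a) <= 2^-1.
      by apply: le_trans Lab; rewrite ler_wpM2l// lerD2r.
    by nra.
  apply: H => t ta tr et.
  have h1 : fine (E (gamma a)) <= fine (e t).
    rewrite -lee_fin -(dom_fin ea) -(dom_fin et) ltW//; apply: hgt => //.
    by rewrite (le_trans (ltW tr)).
  have h2 : L / 2 * mdist (gamma t) (gamma a) ^+ 2 <= L / 2 * sup S.
    by rewrite ler_wpM2l ?divr_ge0 ?normr_ge0// Sle ?(ltW ta)// (le_trans (ltW tr)).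
  lra.
have : sup S <= sup S / 2.
  apply: ge_sup => // _ [r /= + <-]; rewrite in_itv/= => /andP[ar rb]; exact: half.
move=> hs; have s0 : sup S <= 0 by lra.
have := Sle b (ltW ab) (lexx b) => /le_trans/(_ s0).
rewrite real_exprn_even_le0 ?num_real//= => /eqP/mdist_positivity gab.
by have := hgt b ab (lexx b); rewrite /e gab ltxx.
Qed.

(** The last time T at which the energy is at most E (gamma a) belongs to this
set by lower semicontinuity, and [flow_return] produces a later one unless T = b. *)
Lemma flow_noninc_fin a b : 0 < a -> a <= b -> (e a < +oo)%E -> (e b <= e a)%E.
Proof.
move=> a0 ab ea.
pose S := [set t | a <= t <= b /\ (e t <= e a)%E].
have Sa : S a by split; rewrite ?lexx ?ab.
have hS : has_sup S.
  by split; [exists a|exists b => t [/andP[_ tb] _]].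
pose T := sup S.
have aT : a <= T by exact: sup_upper_bound.
have Tb : T <= b by apply: ge_sup; [exists a|move=> t [/andP[_ tb] _]].
have eT : (e T <= e a)%E.
  rewrite leNgt; apply/negP => eaT.
  have [V nV hV] := E_lsc (a := fine (e a)) (x := gamma T) ltac:(by rewrite -(dom_fin ea)).
  have /nbhs_mdist_ex[r r0 rV] := nV.
  have r20 : 0 < r / 2 by rewrite divr_gt0.
  have [d d0 hd] := flow_unif a0 ab r20.
  have [t [/andP[ta tb] te] Tt] := sup_adherent d0 hS.
  have tT : t <= T by apply: sup_upper_bound => //; split; rewrite ?ta.
  have : V (gamma t).
    apply: rV => /=; rewrite metric_sym.
    apply: (@le_lt_trans _ _ (r / 2)); last lra.
    apply: hd => //; move: Tt; rewrite -/T; lra.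
  by move=> /hV; rewrite -(dom_fin ea) ltNge -/(e t) te.
have [Tb'|] := ltP T b; last by move=> bT; rewrite (_ : b = T)//; apply/eqP; rewrite eq_le bT.
pose b' := Num.min b (T + (2 * (L + 1))^-1).
have L10 : 0 < 2 * (L + 1) by rewrite mulr_gt0// ltr_wpDl ?normr_ge0.
have Tb1 : T < b' by rewrite lt_min Tb'/= ltrDl invr_gt0.
have [||//|r /andP[Tr rb] re] := @flow_return T b' _ Tb1.
- exact: lt_le_trans aT.
- apply: (@le_trans _ _ (L * (2 * (L + 1))^-1)).
    by rewrite ler_wpM2l ?normr_ge0// lerBlDl ge_min lexx orbT.
  rewrite ler_pdivrMr// mulrA mulVf// mul1r lerDl//.
- exact: le_lt_trans eT ea.
have rb' : r <= b by move: rb; rewrite le_min => /andP[].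
have : r <= T.
  apply: sup_upper_bound => //; split; last exact: le_trans eT.
  by rewrite rb' andbT (le_trans aT)// ltW.
by rewrite leNgt Tr.
Qed.

(** The inequality for one z of finite energy makes E (gamma t) finite for
almost every t, and monotonicity propagates this forward. *)
Lemma flow_fin t : 0 < t -> (e t < +oo)%E.
Proof.
move=> t0; have t20 : 0 < t / 2 by rewrite divr_gt0.
have [|s /andP[s1 s2] es] := @flow_dom_dense (t / 2) t t20; first lra.
apply: (le_lt_trans _ es); apply: flow_noninc_fin => //; last exact: ltW.
exact: lt_trans s1.
Qed.

(** The content of the gradient flow inequality in integrated form, without
derivatives; it is stable under time shift. *)
Definition evi_curve (c : R -> X) := [/\
  forall t : R, 0 < t -> (E (c t) < +oo)%E,
  forall s t : R, 0 < s -> s <= t -> fine (E (c t)) <= fine (E (c s)),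
  forall a b : R, 0 < a -> a <= b -> forall r : R, 0 < r ->
    exists2 d : R, 0 < d & forall s t, a <= s -> s <= t -> t <= b -> t - s < d ->
      mdist (c s) (c t) <= r,
  forall (a b : R) (z : X), 0 < a -> a <= b ->
    exists B, forall t, a <= t -> t <= b -> mdist (c t) z <= B &
  forall (z : X) (a b M : R), 0 < a -> a <= b -> (E z < +oo)%E ->
    (forall t, a <= t -> t <= b -> mdist (c t) z ^+ 2 <= M) ->
    2^-1 * mdist (c b) z ^+ 2 - 2^-1 * mdist (c a) z ^+ 2 <=
      (b - a) * (fine (E z) - fine (E (c b)) + L / 2 * M)].

Lemma flow_evi_curve : evi_curve gamma.
Proof.
have noninc s t : 0 < s -> s <= t -> fine (e t) <= fine (e s).
  move=> s0 st; have t0 := lt_le_trans s0 st.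
  by rewrite -lee_fin -!dom_fin; [exact/flow_noninc_fin/flow_fin|exact: flow_fin..].
split => //; [exact: flow_fin|exact: flow_unif|exact: (fun a b z => @flow_bounded a b z)|].
move=> z a b M a0; rewrite le_eqVlt => /predU1P[<-|ab] zE hM.
  by rewrite !subrr mul0r.
apply: flow_dist_incr => // t ta tb et.
have h1 : fine (E (gamma b)) <= fine (e t).
  by apply: noninc => //; [exact: lt_trans ta|exact: ltW].
have h2 : L / 2 * mdist (gamma t) z ^+ 2 <= L / 2 * M.
  by rewrite ler_wpM2l ?divr_ge0 ?normr_ge0// hM// ltW.
lra.
Qed.

End OneFlow.

Lemma evi_curve_shift c h : 0 <= h -> evi_curve c -> evi_curve (fun t => c (t + h)).
Proof.
move=> h0 [c1 c2 c3 c5 c4]; split.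
- by move=> t t0; apply: c1; rewrite ltr_wpDr.
- by move=> s t s0 st; apply: c2; [rewrite ltr_wpDr|rewrite lerD2r].
- move=> a b a0 ab r r0.
  have [|d d0 hd] := c3 (a + h) (b + h) (ltr_wpDr h0 a0) _ r r0; first by rewrite lerD2r.
  exists d => // s t sa st tb std; apply: hd; rewrite ?lerD2r//; lra.
- move=> a b z a0 ab; have [|B hB] := c5 (a + h) (b + h) z (ltr_wpDr h0 a0).
    by rewrite lerD2r.
  by exists B => t ta tb; apply: hB; rewrite lerD2r.
- move=> z a b M a0 ab zE hM.
  have := c4 z (a + h) (b + h) M; rewrite ltr_wpDr// lerD2r => /(_ isT ab zE).
  rewrite (_ : b + h - (a + h) = b - a); last by ring.
  apply=> t ta tb; have := hM (t - h); rewrite subrK; apply; lra.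
Qed.

Section Contraction.
Variables (c d : R -> X).
Hypotheses (hc : evi_curve c) (hd : evi_curve d).

(** The inequality for c tested at d a and the one for d tested at c b: the two
terms in E (c b) cancel and only the decay of E along d remains. *)
Lemma contraction_step a b M : 0 < a -> a <= b ->
  (forall r r', a <= r -> r <= b -> a <= r' -> r' <= b -> mdist (c r) (d r') ^+ 2 <= M) ->
  mdist (c b) (d b) ^+ 2 - mdist (c a) (d a) ^+ 2 <=
    2 * (b - a) * (fine (E (d a)) - fine (E (d b)) + L * M).
Proof.
move=> a0 ab hM; have b0 := lt_le_trans a0 ab.
have [c1 _ _ _ c4] := hc; have [d1 _ _ _ d4] := hd.
have h1 := c4 (d a) a b M a0 ab (d1 a a0) (fun t ta tb => hM t a ta tb (lexx a) ab).
have h2 := d4 (c b) a b M a0 ab (c1 b b0).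
have {h2} := h2 (fun t ta tb => eq_ind_r (fun x => x ^+ 2 <= M) (hM b t ab (lexx b) ta tb) (metric_sym _ _)).
rewrite (metric_sym (d b)) (metric_sym (d a)) => h2; nra.
Qed.

(** Summing [contraction_step] over a partition of mesh h, the energies enter
through 2 h (f s - f t), which vanishes with h, and the factors (1 + 2 L h)^N tend
to the exponential. *)
Lemma contraction s t : 0 < s -> s <= t ->
  mdist (c t) (d t) <= expR (L * (t - s)) * mdist (c s) (d s).
Proof.
move=> s0; rewrite le_eqVlt => /predU1P[<-|st].
  by rewrite subrr mulr0 expR0 mul1r.
have L0 : 0 <= L by exact: normr_ge0.
have [c1 c2 c3 c5 c4] := hc; have [d1 d2 d3 d5 d4] := hd.
pose Y r := mdist (c r) (d r) ^+ 2.
pose f r := fine (E (d r)).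
have Y0 r : 0 <= Y r by exact: sqr_ge0.
have fst_ : 0 <= f s - f t by rewrite subr_ge0 d2// ltW.
have [B hB] : exists B : R, forall r, s <= r -> r <= t -> mdist (c r) (d r) <= B.
  have [Bc hBc] := c5 s t (c s) s0 (ltW st).
  have [Bd hBd] := d5 s t (c s) s0 (ltW st).
  exists (Bc + Bd) => r sr rt.
  apply: le_trans (metric_triangle _ (c s) _) _.
  by rewrite lerD// ?hBc// metric_sym hBd.
have B0 : 0 <= B by apply: le_trans (mdist_ge0 (c s) (d s)) (hB s (lexx s) (ltW st)).
have key eps : 0 < eps -> Y t <= expR (2 * L * (t - s)) * (Y s + eps).
  move=> e0.
  have ts0 : 0 < t - s by rewrite subr_gt0.
  (* ep is the error allowed in the squared distances on one step, rho the
     displacement that ensures it, del the mesh that ensures rho. *)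
  pose ep := eps / (4 * (t - s) * L + 1).
  have den0 : 0 < 4 * (t - s) * L + 1.
    by rewrite ltr_wpDl// mulr_ge0// mulr_ge0// ltW.
  have ep0 : 0 < ep by rewrite divr_gt0.
  pose rho := Num.min 1 (ep / (4 * B + 4)).
  have B4 : 0 < 4 * B + 4 by rewrite ltr_wpDl// mulr_ge0.
  have rho0 : 0 < rho by rewrite lt_min ltr01/= divr_gt0.
  have rho1 : rho <= 1 by rewrite ge_min lexx.
  have rhoe : rho * (4 * B + 4) <= ep by rewrite -ler_pdivlMr// ge_min lexx orbT.
  have [dc dc0 hdc] := c3 s t s0 (ltW st) rho rho0.
  have [dd dd0 hdd] := d3 s t s0 (ltW st) rho rho0.
  pose del := Num.min (Num.min dc dd) (eps / (4 * (f s - f t) + 1)).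
  have fd0 : 0 < 4 * (f s - f t) + 1 by rewrite ltr_wpDl// mulr_ge0.
  have del0 : 0 < del by rewrite !lt_min dc0 dd0 divr_gt0.
  have [N [N0 hN]] : exists N : nat, (0 < N)%N /\ (t - s) / N%:R < del.
    exact: ex_div_lt (ltW ts0) del0.
  pose h := (t - s) / N%:R.
  have h0 : 0 < h by rewrite divr_gt0// ltr0n.
  have NhE : N%:R * h = t - s by rewrite /h mulrC divfK// pnatr_eq0 -lt0n.
  have := hN; rewrite -/h !lt_min => /andP[/andP[hdc' hdd'] hf].
  pose a i : R := s + i%:R * h.
  have aS i : a i.+1 = a i + h by rewrite /a -natr1 mulrDl mul1r addrA.
  have sa i : s <= a i by rewrite lerDl mulr_ge0// ltW.
  have at_ i : (i <= N)%N -> a i <= t.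
    move=> iN; rewrite -lerBrDl -NhE ler_wpM2r ?(ltW h0)// ler_nat//.
  have step i : (i < N)%N -> Y (a i.+1) <= (1 + 2 * L * h) * Y (a i) +
      2 * h * (f (a i) - f (a i.+1)) + 2 * h * L * ep.
    move=> iN; have aiS : a i <= a i.+1 by rewrite aS lerDl ltW.
    have aiSt := at_ _ iN.
    have := @contraction_step (a i) (a i.+1) (Y (a i) + ep) (lt_le_trans s0 (sa i)) aiS.
    rewrite -/(Y _) -/(Y _) -/(f _) -/(f _) aS (addrAC (a i)) subrr add0r -aS => H.
    suff /H : forall r r', a i <= r -> r <= a i.+1 -> a i <= r' -> r' <= a i.+1 ->
        mdist (c r) (d r') ^+ 2 <= Y (a i) + ep.
      rewrite lerBlDl => /le_trans; apply; rewrite le_eqVlt; apply/orP; left.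
      by apply/eqP; ring.
    have near_ai r del' : h < del' -> r <= a i.+1 -> r - a i < del'.
      by move=> hdel rai; apply: le_lt_trans hdel; rewrite lerBlDl -aS.
    move=> r r' r1 r2 r3 r4.
    have q1 : mdist (c (a i)) (c r) <= rho.
      by apply: hdc => //; [exact: le_trans aiSt|exact: near_ai].
    have q2 : mdist (d (a i)) (d r') <= rho.
      by apply: hdd => //; [exact: le_trans aiSt|exact: near_ai].
    have q3 : mdist (c (a i)) (d (a i)) <= B by apply: hB => //; exact: at_ (ltnW iN).
    have q4 : mdist (c r) (d r') <= mdist (c (a i)) (d (a i)) + 2 * rho.
      have := metric_triangle (c r) (c (a i)) (d r').
      have := metric_triangle (c (a i)) (d (a i)) (d r').
      rewrite (metric_sym (c r) (c (a i))); clear - q1 q2; lra.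
    have q5 := mdist_ge0 (c r) (d r'); have q6 := mdist_ge0 (c (a i)) (d (a i)).
    apply: (@le_trans _ _ ((mdist (c (a i)) (d (a i)) + 2 * rho) ^+ 2)).
      by rewrite lerXn2r// nnegrE ?addr_ge0// mulr_ge0// ltW.
    rewrite /Y; move: (mdist (c (a i)) (d (a i))) q3 q6 => D q3 q6.
    rewrite sqrrD -addrA lerD2l.
    by clear - rhoe rho0 rho1 q3 q6; nra.
  have ind i : (i <= N)%N -> Y (a i) <= (1 + 2 * L * h) ^+ i *
      (Y s + 2 * h * (f s - f (a i)) + 2 * i%:R * h * L * ep).
    elim: i => [_|i ih iN].
      by rewrite expr0 mul1r /a mul0r addr0 subrr !mulr0 !mul0r !addr0.
    apply: le_trans (step i iN) _.
    have q0 : 0 <= 2 * L * h by rewrite mulr_ge0 ?(ltW h0)// mulr_ge0.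
    set q := 1 + 2 * L * h.
    have q1 : 1 <= q by rewrite lerDl.
    have qi1 : 1 <= q ^+ i.+1 by rewrite exprn_ege1.
    have ff : 0 <= f (a i) - f (a i.+1).
      by rewrite subr_ge0 d2// ?(lt_le_trans s0)// aS lerDl ltW.
    have ih' : q * Y (a i) <= q ^+ i.+1 * (Y s + 2 * h * (f s - f (a i)) + 2 * i%:R * h * L * ep).
      by rewrite exprS -mulrA ler_wpM2l ?ih ?(ltnW iN)// (le_trans ler01).
    set T1 := 2 * h * (f (a i) - f (a i.+1)); set T2 := 2 * h * L * ep.
    have T10 : 0 <= T1 by rewrite mulr_ge0// mulr_ge0// ltW.
    have T20 : 0 <= T2 by rewrite mulr_ge0 ?(ltW ep0)// mulr_ge0// mulr_ge0// ltW.
    have e1 : T1 <= q ^+ i.+1 * T1 by rewrite ler_peMl.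
    have e2 : T2 <= q ^+ i.+1 * T2 by rewrite ler_peMl.
    have -> : q ^+ i.+1 * (Y s + 2 * h * (f s - f (a i.+1)) + 2 * i.+1%:R * h * L * ep) =
      q ^+ i.+1 * (Y s + 2 * h * (f s - f (a i)) + 2 * i%:R * h * L * ep) +
      q ^+ i.+1 * T1 + q ^+ i.+1 * T2.
      rewrite /T1 /T2 -natr1; ring.
    by rewrite !lerD.
  have := ind N (leqnn N).
  have -> : a N = t by rewrite /a NhE addrC subrK.
  move=> /le_trans; apply.
  have qe : (1 + 2 * L * h) ^+ N <= expR (2 * L * (t - s)).
    have -> : 2 * L * (t - s) = N%:R * (2 * L * h) by rewrite -NhE; ring.
    rewrite expRM_natl lerXn2r ?nnegrE ?expR_ge0 ?expR_ge1Dx//.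
    by rewrite addr_ge0// mulr_ge0 ?(ltW h0)// mulr_ge0.
  apply: ler_pM => //.
  - by rewrite exprn_ge0// addr_ge0// mulr_ge0 ?(ltW h0)// mulr_ge0.
  - rewrite !addr_ge0//; first by rewrite mulr_ge0// mulr_ge0// ltW.
    by rewrite mulr_ge0 ?(ltW ep0)// mulr_ge0// mulr_ge0 ?(ltW h0)// mulr_ge0.
  rewrite -addrA lerD2l -(mulrA 2 _ h) NhE.
  have E1 : 2 * h * (f s - f t) <= eps / 2.
    move: hf; rewrite ltr_pdivlMr// => hf; clear - hf h0 e0; nra.
  have E2 : 2 * (t - s) * L * ep <= eps / 2.
    have q : ep * (4 * (t - s) * L + 1) = eps by rewrite /ep divfK// gt_eqF.
    have -> : 2 * (t - s) * L * ep = (eps - ep) / 2 by rewrite -{1}q; field.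
    by rewrite ler_wpM2r ?invr_ge0// gerBl ltW.
  by rewrite [leRHS]splitr lerD.
have Yt : Y t <= expR (2 * L * (t - s)) * Y s.
  apply/ler_addgt0Pr => r r0.
  have := key (r / expR (2 * L * (t - s))) (divr_gt0 r0 (expR_gt0 _)).
  by rewrite mulrDr (mulrC (expR _) (r / _)) divfK// gt_eqF// expR_gt0.
rewrite -(@ler_pXn2r _ 2%N) ?nnegrE ?mdist_ge0 ?mulr_ge0 ?expR_ge0 ?mdist_ge0//.
rewrite exprMn; have -> : expR (L * (t - s)) ^+ 2 = expR (2 * L * (t - s)) => //.
by rewrite -expRM_natl mulrA.
Qed.

End Contraction.
End EVIFlow.

(** * Gradient flows: dissipation and slope *)

Section Semigroup.
Context {R : realType} {X : metricType R}.
Variables (E : X -> \bar R) (lambda : R).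
Hypothesis E_proper : forall z, E z != -oo%E.
Hypothesis E_lsc : lower_semicontinuous E.
Hypothesis E_dom : exists z, (E z < +oo)%E.
Let L := `|lambda|.
Let L0 : 0 <= L. Proof. exact: normr_ge0. Qed.

(** The supremum s of D satisfies s <= k + s / 2. *)
Lemma half_bootstrap (D : R -> R) (A : set R) (k B : R) :
  (forall r, A r -> 0 <= D r <= B) ->
  (forall M, (forall r, A r -> D r <= M) -> forall r, A r -> D r <= k + M / 2) ->
  forall r, A r -> D r <= 2 * k.
Proof.
move=> hB h r0 Ar0.
have hS : has_sup (D @` A).
  by split; [exists (D r0), r0|exists B => _ [r Ar <-]; have /andP[] := hB r Ar].
have hM r : A r -> D r <= sup (D @` A) by move=> Ar; apply: sup_upper_bound => //; exists r.
have : sup (D @` A) <= k + sup (D @` A) / 2.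
  apply: ge_sup; first by exists (D r0), r0.
  by move=> _ [r Ar <-]; exact: h.
have := hM r0 Ar0; lra.
Qed.

(** The squared distance D to the starting point is at most
2 h G + M / 2 when it is at most M, so [half_bootstrap] absorbs M. *)
Lemma bootstrap_dissipation (D e : R -> R) h e0 G B : 0 < h -> L * h <= 2^-1 -> 0 <= G ->
  (forall r, 0 < r -> r <= h -> 0 <= D r <= B) ->
  (forall r M, 0 < r -> r <= h -> (forall t, 0 < t -> t <= r -> D t <= M) ->
    2^-1 * D r <= r * (e0 - e r + L / 2 * M)) ->
  (forall r, 0 < r -> r <= h -> e0 - e r <= G) -> D h <= 4 * h * G.
Proof.
move=> h0 Lh G0 hB hD hG; rewrite (_ : 4 * h * G = 2 * (2 * h * G)); last by ring.
apply: (@half_bootstrap D [set r | 0 < r <= h] _ B); last by rewrite /= h0 lexx.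
  by move=> r /= /andP[r0 rh]; exact: hB.
move=> M hM r /= /andP[r0 rh].
have hM' t : 0 < t -> t <= r -> D t <= M.
  by move=> t0 tr; apply: hM => /=; rewrite t0 (le_trans tr).
have M0 : 0 <= M by apply: le_trans (hM' r r0 (lexx r)); have /andP[] := hB r r0 rh.
have := hD r M r0 rh hM'.
have : r * (e0 - e r) <= h * G.
  by apply: (@le_trans _ _ (r * G)); rewrite ?ler_wpM2r// ler_wpM2l ?(ltW r0)// hG.
have : r * (L / 2 * M) <= 2^-1 * M / 2.
  rewrite (_ : r * _ = (r * L) * M / 2); last by ring.
  by rewrite ler_wpM2r ?invr_ge0// ler_wpM2r// mulrC (le_trans _ Lh)// ler_wpM2l.
rewrite mulrDr; lra.
Qed.

Lemma dissipation c a h : evi_curve E lambda c -> 0 < a -> 0 < h -> L * h <= 2^-1 ->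
  mdist (c (a + h)) (c a) ^+ 2 <= 4 * h * (fine (E (c a)) - fine (E (c (a + h)))).
Proof.
move=> [c1 c2 c3 c5 c4] a0 h0 Lh.
have aar r : 0 < r -> a <= a + r by move=> r0; rewrite lerDl ltW.
have [B hB] := c5 a (a + h) (c a) a0 (aar h h0).
apply: (@bootstrap_dissipation (fun r => mdist (c (a + r)) (c a) ^+ 2)
  (fun r => fine (E (c (a + r)))) _ (fine (E (c a))) _ (B ^+ 2)) => //.
- by rewrite subr_ge0 c2// aar.
- move=> r r0 rh; have ar : a + r <= a + h by rewrite lerD2l.
  rewrite sqr_ge0/= lerXn2r ?nnegrE ?mdist_ge0 ?hB ?aar//.
  by apply: le_trans (hB _ (aar r r0) ar); exact: mdist_ge0.
- move=> r M r0 rh hM; have M0 : 0 <= M.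
    by apply: le_trans (hM r r0 (lexx r)); exact: sqr_ge0.
  have := c4 (c a) a (a + r) M a0 (aar r r0) (c1 a a0).
  rewrite mdistxx expr0n/= mulr0 subr0 (addrAC a) subrr add0r; apply=> t.
  rewrite le_eqVlt => /predU1P[<- _|at_ tr]; first by rewrite mdistxx expr0n.
  by have := hM (t - a); rewrite (addrC a) subrK; apply; rewrite ?subr_gt0// lerBlDl.
- move=> r r0 rh; rewrite lerD2l lerN2 c2//; first by rewrite (lt_le_trans a0)// aar.
  by rewrite lerD2l.
Qed.

(** Contraction for the flow and its shift by h shows that the increment after s
is at most, up to the exponential factor, each of the N increments between a and s.
These are bounded by the energies they dissipate, which telescope. *)
Lemma dissipation_sum c a s N : evi_curve E lambda c -> 0 < a -> a < s -> (0 < N)%N ->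
  let h := (s - a) / N%:R in L * h <= 2^-1 ->
  mdist (c (s + h)) (c s) ^+ 2 * (s - a) <=
    4 * expR (2 * L * (s - a)) * h ^+ 2 * (fine (E (c a)) - fine (E (c s))).
Proof.
move=> hc a0 as_ N0 h Lh.
have [c1 c2 c3 c5 c4] := hc.
have sa0 : 0 < s - a by rewrite subr_gt0.
have h0 : 0 < h by rewrite divr_gt0// ltr0n.
have NhE : N%:R * h = s - a by rewrite /h mulrC divfK// pnatr_eq0 -lt0n.
pose D := mdist (c (s + h)) (c s).
pose f t := fine (E (c t)).
have ind i : (i <= N)%N ->
    i%:R * D ^+ 2 <= expR (2 * L * (s - a)) * (4 * h * (f a - f (a + i%:R * h))).
  elim: i => [_|i ih iN]; first by rewrite !mul0r addr0 subrr !mulr0.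
  pose ai := a + i%:R * h.
  have aai : a <= ai by rewrite lerDl mulr_ge0// ltW.
  have ais : ai <= s.
    by rewrite /ai -lerBrDl -NhE ler_wpM2r ?(ltW h0)// ler_nat ltnW.
  have ai0 : 0 < ai := lt_le_trans a0 aai.
  have d1 := dissipation hc ai0 h0 Lh.
  have := contraction (evi_curve_shift (ltW h0) hc) hc ai0 ais.
  rewrite -/D -/L => d2.
  have d3 : D ^+ 2 <= expR (2 * L * (s - a)) * mdist (c (ai + h)) (c ai) ^+ 2.
    apply: (@le_trans _ _ ((expR (L * (s - ai)) * mdist (c (ai + h)) (c ai)) ^+ 2)).
      by rewrite lerXn2r ?nnegrE ?mulr_ge0 ?expR_ge0 ?mdist_ge0.
    rewrite exprMn ler_wpM2r ?sqr_ge0// -expRM_natl mulrA ler_expR.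
    by rewrite ler_wpM2l ?mulr_ge0// lerD2l lerN2.
  have E1 : a + i.+1%:R * h = ai + h by rewrite /ai -natr1 mulrDl mul1r addrA.
  rewrite E1 -natr1 mulrDl mul1r.
  apply: le_trans (lerD (ih (ltnW iN)) d3) _.
  rewrite -mulrDr ler_wpM2l ?expR_ge0//.
  apply: le_trans (lerD (lexx _) d1) _.
  by rewrite -mulrDr -/(f _) -/(f _) /ai addrA subrK.
have := ind N (leqnn N); rewrite NhE (addrC a) subrK -/D => H.
rewrite -NhE (mulrC (D ^+ 2)) mulrAC.
apply: le_trans (ler_wpM2r (ltW h0) H) _.
rewrite NhE -/(f a) -/(f s) le_eqVlt; apply/orP; left; apply/eqP.
by move: (expR _) (f a) (f s) => x y z; ring.
Qed.

(** The quadratic term is o(d(y, z)) as z tends to y. *)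
Lemma slope_le_near (y : X) (K : R) : (E y < +oo)%E -> 0 <= K ->
  (forall z, (E z < +oo)%E ->
    fine (E y) - fine (E z) <= K * mdist y z + L / 2 * mdist y z ^+ 2) ->
  (slope E y <= K%:E)%E.
Proof.
move=> yE K0 hz; rewrite /slope; case: asboolP => [_|]; last by move=> /(_ yE).
case: asboolP => [_|_]; first by rewrite lee_fin.
apply/lee_addgt0Pr => e e0.
pose r := e / (L + 1).
have L10 : 0 < L + 1 by rewrite ltr_wpDl.
have r0 : 0 < r by rewrite divr_gt0.
have hV : (y^' : set_system X) [set z | mdist y z < r /\ y <> z].
  have : nbhs y [set z | mdist y z < r] by apply/nbhs_mdist_ex; exists r.
  by apply: filterS => z /= zr zy; split => // yz; move: zy; rewrite yz eqxx.
apply: (@le_trans _ _ (ereal_sup ((fun z => (Order.max (E y - E z) 0 * ((mdist y z)^-1)%:E)%E) @` [set z | mdist y z < r /\ y <> z]))).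
  by apply: ereal_inf_lbound; eexists; [exact: hV|].
apply: ge_ereal_sup => _ [z /= [zr yz] <-].
have d0 : 0 < mdist y z by rewrite mdist_gt0; exact/eqP.
have [zE|] := boolP (E z < +oo)%E; last first.
  rewrite -leNgt leye_eq => /eqP ->; rewrite (dom_fin E_proper yE) /= addeNy.
  by rewrite max_r ?leNye// mul0e lee_fin addr_ge0// ltW.
rewrite (dom_fin E_proper yE) (dom_fin E_proper zE) -EFinB -EFin_max -EFinM lee_fin.
rewrite ler_pdivrMr// ge_max mulr_ge0 ?(ltW d0) ?addr_ge0 ?(ltW e0)//= andbT.
apply: le_trans (hz z zE) _; rewrite mulrDl lerD2l expr2 mulrA ler_wpM2r ?(ltW d0)//.
have rE : r * (L + 1) = e by rewrite /r divfK// gt_eqF.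
rewrite -rE; have := ltW zr; have := ltW r0; have := ltW d0; nra.
Qed.

(** Dividing the integrated inequality over [s, s + h] by h: moving by at most
K h changes half the squared distance to z by about K d h. All errors are multiples
of w. *)
Lemma slope_arith (K l d w h u v Ez es es0 : R) : 0 <= K -> 0 <= l -> 0 <= d ->
  0 < w -> w <= 1 -> 0 < h -> v <= K * h -> d <= v + u -> 0 <= u -> u <= d + w ->
  0 <= v -> 2^-1 * u ^+ 2 - 2^-1 * d ^+ 2 <= h * (Ez - es + l / 2 * (d + w) ^+ 2) ->
  es0 - w <= es ->
  es0 - Ez <= K * d + l / 2 * d ^+ 2 + w * (1 + K / 2 + l / 2 * (2 * d + 1)).
Proof.
move=> K0 l0 d0 w0 w1 h0 hKh t1 u0 u1 v0 H hes.
have H2 : - (2^-1 * (K * h) * (2 * d + w)) <= 2^-1 * u ^+ 2 - 2^-1 * d ^+ 2.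
  rewrite -mulrBr -subr_ge0.
  have q1 : d - u <= K * h by lra.
  have q2 : (d - u) * (d + u) <= K * h * (2 * d + w).
    have [du|ud] := leP 0 (d - u).
      by apply: ler_pM => //; lra.
    apply: (@le_trans _ _ 0); first by rewrite nmulr_rle0// addr_ge0.
    by apply: mulr_ge0; [exact: le_trans hKh|lra].
  rewrite (_ : u ^+ 2 - d ^+ 2 = - ((d - u) * (d + u))); last by ring.
  lra.
have := le_trans H2 H.
rewrite (_ : - (2^-1 * (K * h) * (2 * d + w)) = h * - (2^-1 * K * (2 * d + w))); last by ring.
rewrite ler_pM2l// => H3.
have q : l / 2 * (d + w) ^+ 2 <= l / 2 * d ^+ 2 + l / 2 * (2 * d + 1) * w.
  rewrite -(mulrA (l / 2)) -mulrDr ler_wpM2l ?divr_ge0//.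
  have : w ^+ 2 <= w by rewrite expr2 ler_piMl// ltW.
  by rewrite sqrrD mulrDl mul1r; lra.
rewrite (_ : w * (1 + _ + _) = w + w * (K / 2) + l / 2 * (2 * d + 1) * w); last by ring.
lra.
Qed.

(** The integrated inequality over a short time h bounds E (c (s + h)) - E z by
K d(c s, z) plus a quadratic term, and the energy at s + h is almost at least
the energy at s by lower semicontinuity. *)
Lemma slope_le_speed c s K : evi_curve E lambda c -> 0 < s -> 0 <= K ->
  (forall d : R, 0 < d -> exists2 h, 0 < h < d & mdist (c (s + h)) (c s) <= K * h) ->
  (slope E (c s) <= K%:E)%E.
Proof.
move=> hc s0 K0 hK; have [c1 c2 c3 c5 c4] := hc.
apply: slope_le_near => //; first exact: c1.
move=> z zE; set d := mdist (c s) z.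
have d0 : 0 <= d by exact: mdist_ge0.
apply/ler_addgt0Pr => eps eps0.
pose C := 1 + K / 2 + L / 2 * (2 * d + 1).
have C0 : 0 < C.
  by rewrite ltr_wpDr ?mulr_ge0 ?divr_ge0 ?addr_ge0 ?mulr_ge0// ltr_wpDr ?divr_ge0.
pose w := Num.min 1 (eps / C).
have w0 : 0 < w by rewrite lt_min ltr01 divr_gt0.
have w1 : w <= 1 by rewrite ge_min lexx.
have wC : w * C <= eps by rewrite -ler_pdivlMr// ge_min lexx orbT.
have [d1 d10 hd1] := c3 s (s + 1) s0 ltac:(lra) w w0.
have [V nV hV] := E_lsc (x := c s) (a := fine (E (c s)) - w)
  ltac:(by rewrite [ltRHS](dom_fin E_proper (c1 s s0)) lte_fin; lra).
have /nbhs_mdist_ex[r r0 rV] := nV.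
have [d2 d20 hd2] := c3 s (s + 1) s0 ltac:(lra) (r / 2) ltac:(lra).
have [h /andP[h0 hd] hKh] := hK (Num.min (Num.min d1 d2) 1) ltac:(by rewrite !lt_min d10 d20 ltr01).
move: hd; rewrite !lt_min => /andP[/andP[hd1' hd2'] h1].
have sh0 : 0 < s + h by exact: addr_gt0.
have ssh : s <= s + h by rewrite lerDl ltW.
have sh1 : s + h <= s + 1 by rewrite lerD2l ltW.
have es : fine (E (c s)) - w <= fine (E (c (s + h))).
  rewrite -lee_fin -(dom_fin E_proper (c1 _ sh0)) ltW//; apply/hV/rV.
  apply: (@le_lt_trans _ _ (r / 2)); last by rewrite ltr_pdivrMr// ltr_pMr// ltr1n.
  by apply: hd2 => //; rewrite addrAC subrr add0r.
have hM t : s <= t -> t <= s + h -> mdist (c t) z ^+ 2 <= (d + w) ^+ 2.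
  move=> st th; rewrite lerXn2r ?nnegrE ?mdist_ge0 ?addr_ge0 ?(ltW w0)//.
  apply: le_trans (metric_triangle _ (c s) _) _; rewrite addrC lerD2l metric_sym.
  apply: hd1 => //; first exact: le_trans sh1.
  by rewrite ltrBlDl (le_lt_trans th)// ltrD2l.
have := c4 z s (s + h) _ s0 ssh zE hM.
rewrite (addrAC s h) subrr add0r => H.
have t1 := metric_triangle (c s) (c (s + h)) z.
have t2 := hM (s + h) ssh (lexx _).
have u0 := mdist_ge0 (c (s + h)) z.
have u1 : mdist (c (s + h)) z <= d + w.
  by rewrite -(@ler_pXn2r _ 2%N)// nnegrE addr_ge0// ltW.
rewrite -/d (metric_sym (c s) (c (s + h))) in t1.
have v0 := mdist_ge0 (c (s + h)) (c s).
apply: le_trans (slope_arith K0 L0 d0 w0 w1 h0 hKh t1 u0 u1 v0 H es) _.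
by rewrite lerD2l.
Qed.

End Semigroup.

(** * The semigroup of gradient flows *)

Section SemigroupFromZero.
Context {R : realType} {X : metricType R}.
Variables (E : X -> \bar R) (lambda : R).
Hypothesis E_proper : forall z, E z != -oo%E.
Hypothesis E_lsc : lower_semicontinuous E.
Hypothesis E_dom : exists z, (E z < +oo)%E.
Let L := `|lambda|.
Let L0 : 0 <= L. Proof. exact: normr_ge0. Qed.
Variable S0 : X -> R -> X.
Hypothesis flows : forall p, EVI_flow E lambda p (S0 p).

(** The curve S0 p is a gradient flow for positive times only; its value at time
0 is unrelated to p. *)
Definition semigroup p t := if t <= 0 then p else S0 p t.
Local Notation S := semigroup.

Lemma semigroup0 p : S p 0 = p.
Proof. by rewrite /S lexx. Qed.

Lemma semigroup_gt0 p t : 0 < t -> S p t = S0 p t.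
Proof. by move=> t0; rewrite /S leNgt t0. Qed.

Let hcurve p : evi_curve E lambda (S0 p).
Proof. exact: flow_evi_curve (flows p). Qed.

Definition starts_at (c : R -> X) p := forall e : R, 0 < e ->
  exists2 d : R, 0 < d & forall t, 0 < t -> t < d -> mdist p (c t) <= e.

Lemma semigroup_start p : starts_at (S0 p) p.
Proof.
move=> e e0; have [_ /metricType_numDomainType.cvgrPdist_le H _] := flows p.
have [d /= d0 hd] := H _ e0.
exists d => // t t0 td; apply: hd => //=.
by rewrite sub0r normrN gtr0_norm.
Qed.

(** Let the initial time in [contraction] tend to 0. *)
Lemma contraction_start (c d : R -> X) p q t : evi_curve E lambda c -> evi_curve E lambda d ->
  starts_at c p -> starts_at d q -> 0 < t ->
  mdist (c t) (d t) <= expR (L * t) * mdist p q.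
Proof.
move=> hc hd cp dq t0; apply/ler_addgt0Pr => e e0.
pose w := e / (2 * expR (L * t)).
have ex0 := expR_gt0 (L * t).
have w0 : 0 < w by rewrite divr_gt0// mulr_gt0.
have wE : w * (2 * expR (L * t)) = e by rewrite /w divfK// gt_eqF// mulr_gt0.
have [d1 d10 hd1] := cp w w0; have [d2 d20 hd2] := dq w w0.
pose s := Num.min t (Num.min d1 d2) / 2.
have m0 : 0 < Num.min t (Num.min d1 d2) by rewrite !lt_min t0 d10.
have s0 : 0 < s by rewrite divr_gt0.
have : s < Num.min t (Num.min d1 d2) by rewrite /s ltr_pdivrMr// ltr_pMr// ltr1n.
rewrite !lt_min => /andP[st /andP[sd1 sd2]].
apply: le_trans (contraction hc hd s0 (ltW st)) _.
have h1 : expR (L * (t - s)) <= expR (L * t).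
  by rewrite ler_expR ler_wpM2l// gerBl ltW.
have h2 : mdist (c s) (d s) <= mdist p q + 2 * w.
  have := metric_triangle (c s) p (d s).
  have := metric_triangle p q (d s).
  have := hd1 s s0 sd1; have := hd2 s s0 sd2.
  rewrite (metric_sym (c s) p); lra.
apply: le_trans (ler_pM (expR_ge0 _) (mdist_ge0 _ _) h1 h2) _.
rewrite mulrDr lerD2l -wE le_eqVlt; apply/orP; left; apply/eqP; ring.
Qed.

Lemma semigroup_contraction p q t : 0 <= t ->
  mdist (S p t) (S q t) <= expR (L * t) * mdist p q.
Proof.
rewrite le_eqVlt => /predU1P[<-|t0].
  by rewrite !semigroup0 mulr0 expR0 mul1r.
by rewrite !semigroup_gt0//; apply: contraction_start => //; exact: semigroup_start.
Qed.

Lemma semigroup_shift p s h : 0 <= s -> 0 <= h ->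
  mdist (S p (s + h)) (S p s) <= expR (L * s) * mdist (S p h) p.
Proof.
rewrite le_eqVlt => /predU1P[<-|s0].
  by rewrite add0r semigroup0 mulr0 expR0 mul1r.
rewrite le_eqVlt => /predU1P[<-|h0].
  by rewrite addr0 mdistxx mulr_ge0 ?expR_ge0 ?mdist_ge0.
rewrite !semigroup_gt0//; last exact: addr_gt0.
apply: (contraction_start (evi_curve_shift (ltW h0) (hcurve p)) (hcurve p)) => //.
  move=> e e0; have [_ _ c3 _ _] := hcurve p.
  have hh1 : h <= h + 1 by rewrite lerDl.
  have [d d0 hd] := c3 h (h + 1) h0 hh1 e e0.
  exists (Num.min d 1); first by rewrite lt_min d0 ltr01.
  move=> t t0; rewrite lt_min => /andP[td t1]; apply: hd => //; rewrite ?addrK//.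
    by rewrite lerDr ltW.
  by rewrite addrC lerD2l ltW.
exact: semigroup_start.
Qed.

Lemma semigroup_evi p z b M : 0 < b -> (E z < +oo)%E ->
  (forall t, 0 < t -> t <= b -> mdist (S0 p t) z ^+ 2 <= M) ->
  2^-1 * mdist (S0 p b) z ^+ 2 - 2^-1 * mdist p z ^+ 2 <=
    b * (fine (E z) - fine (E (S0 p b)) + L / 2 * M).
Proof.
move=> b0 zE hM; set K := _ + _ * M.
apply/ler_addgt0Pr => e e0.
set D := mdist p z.
have D0 : 0 <= D by exact: mdist_ge0.
pose w := Num.min 1 (e / (2 * D + 1)).
have D1 : 0 < 2 * D + 1 by lra.
have w0 : 0 < w by rewrite lt_min ltr01 divr_gt0.
have w1 : w <= 1 by rewrite ge_min lexx.
have wE : w * (2 * D + 1) <= e by rewrite -ler_pdivlMr// ge_min lexx orbT.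
have [d1 d10 hd1] := semigroup_start p w0.
pose a := Num.min b (Num.min d1 (e / (2 * `|K| + 1))) / 2.
have K1 : 0 < 2 * `|K| + 1 by have := normr_ge0 K; lra.
have m0 : 0 < Num.min b (Num.min d1 (e / (2 * `|K| + 1))) by rewrite !lt_min b0 d10 divr_gt0.
have a0 : 0 < a by rewrite divr_gt0.
have : a < Num.min b (Num.min d1 (e / (2 * `|K| + 1))) by rewrite /a ltr_pdivrMr// ltr_pMr// ltr1n.
rewrite !lt_min => /andP[ab /andP[ad1 aK]].
rewrite ltr_pdivlMr// in aK.
have [_ _ _ _ c4] := hcurve p.
have := c4 z a b M a0 (ltW ab) zE.
have hM' t : a <= t -> t <= b -> mdist (S0 p t) z ^+ 2 <= M.
  by move=> at_ tb; apply: hM => //; exact: lt_le_trans at_.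
move=> /(_ hM'); rewrite -/L -/K => H.
have u1 : mdist (S0 p a) z <= D + w.
  have := metric_triangle (S0 p a) p z; have := hd1 a a0 ad1.
  rewrite (metric_sym (S0 p a) p) -/D; lra.
have u0 := mdist_ge0 (S0 p a) z.
have u2 : mdist (S0 p a) z ^+ 2 <= D ^+ 2 + w * (2 * D + 1).
  apply: (@le_trans _ _ ((D + w) ^+ 2)); first by rewrite lerXn2r ?nnegrE ?addr_ge0 ?(ltW w0).
  have : w ^+ 2 <= w by rewrite expr2 ler_piMl// ltW.
  rewrite sqrrD; lra.
have u3 : - (a * K) <= e / 2.
  have : - (a * K) <= a * `|K|.
    by rewrite -mulrN ler_wpM2l ?(ltW a0)// -normrN ler_norm.
  lra.
lra.
Qed.

Lemma semigroup_dissipation0 p h G : 0 < h -> L * h <= 2^-1 -> (E p < +oo)%E ->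
  0 <= G -> fine (E p) - fine (E (S0 p h)) <= G ->
  mdist (S0 p h) p ^+ 2 <= 4 * h * G.
Proof.
move=> h0 Lh pE G0 hG.
have [c1 c2 c3 c5 c4] := hcurve p.
have [d1 d10 hd1] := semigroup_start p ltr01.
have [B hB] : exists B, forall t, 0 < t -> t <= h -> mdist (S0 p t) p <= B.
  have [B hB] := c5 (Num.min d1 h) h p ltac:(by rewrite lt_min d10) ltac:(by rewrite ge_min lexx orbT).
  exists (Num.max 1 B) => t t0 th; rewrite le_max.
  have [td|td] := ltP t d1; first by rewrite metric_sym hd1.
  by rewrite hB ?orbT// ge_min td.
apply: (@bootstrap_dissipation _ lambda (fun r => mdist (S0 p r) p ^+ 2)
  (fun r => fine (E (S0 p r))) _ (fine (E p)) _ (B ^+ 2)) => //.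
- move=> r r0 rh; rewrite sqr_ge0/= lerXn2r ?nnegrE ?mdist_ge0 ?hB//.
  by apply: le_trans (hB r r0 rh); exact: mdist_ge0.
- move=> r M r0 rh hM; have := semigroup_evi r0 pE hM.
  by rewrite mdistxx expr0n/= mulr0 subr0.
- by move=> r r0 rh; apply: le_trans hG; rewrite lerD2l lerN2 c2.
Qed.

(** A limsup below G bounds all difference quotients near p; when p is isolated
only z = p remains. *)
Lemma slope_near p G : (slope E p < G%:E)%E -> (E p < +oo)%E /\
  exists2 d : R, 0 < d & forall z, mdist p z < d -> (E z < +oo)%E ->
    fine (E p) - fine (E z) <= G * mdist p z.
Proof.
rewrite /slope; case: asboolP => [pE|_]; last by rewrite ltNge leey.
move=> h; split => //; move: h; case: asboolP => [[_ [V nV Vp]] _|_ h].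
  have /nbhs_mdist_ex[r r0 rV] := nV; exists r => // z zr zE.
  have : (V `&` setT) z by split => //; exact: rV.
  by rewrite Vp => /= ->; rewrite subrr mdistxx mulr0.
have [_ [V nV <-] hV] := ereal_inf_lt h.
have nV' : nbhs p [set z | z != p -> V z] by exact: nV.
have /nbhs_mdist_ex[r r0 rV] := nV'.
exists r => // z zr zE; have [->|zp] := eqVneq z p.
  by rewrite subrr mdistxx mulr0.
have Vz : V z by exact: rV.
have d0 : 0 < mdist p z by rewrite mdist_gt0 eq_sym.
have := le_lt_trans (ereal_sup_ubound (ex_intro2 _ _ z Vz erefl)) hV.
rewrite (dom_fin E_proper pE) (dom_fin E_proper zE) -EFinB -EFin_max -EFinM lte_fin.
rewrite ltr_pdivrMr// => /ltW; apply: le_trans; by rewrite le_max lexx.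
Qed.

(** For small h, [semigroup_dissipation0] and the slope bound at p give
d^2 <= 4 h G d, hence d <= 4 G h. Contraction transports this bound to later times,
and small steps add up. *)
Lemma semigroup_lipschitz p G : 0 <= G -> (slope E p < G%:E)%E ->
  forall s h, 0 <= s -> 0 <= h ->
    mdist (S p (s + h)) (S p s) <= expR (L * (s + h)) * (4 * G) * h.
Proof.
move=> G0 /slope_near[pE [d d0 hd]].
have [d1 d10 hd1] := semigroup_start p (ltac:(by rewrite divr_gt0//) : 0 < d / 2).
have [c1 c2 c3 c5 c4] := hcurve p.
pose del := Num.min d1 (2 * (L + 1))^-1.
have L10 : 0 < 2 * (L + 1) by rewrite mulr_gt0// ltr_wpDl.
have del0 : 0 < del by rewrite lt_min d10 invr_gt0.
have small h : 0 < h -> h < del -> mdist (S p h) p <= 4 * G * h.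
  move=> h0; rewrite lt_min => /andP[hd1' hL].
  rewrite semigroup_gt0//.
  have Lh : L * h <= 2^-1.
    apply: (@le_trans _ _ (L * (2 * (L + 1))^-1)); first by rewrite ler_wpM2l// ltW.
    by rewrite ler_pdivrMr// mulrA mulVf// mul1r lerDl.
  have ph : mdist p (S0 p h) < d by apply: le_lt_trans (hd1 h h0 hd1') _; lra.
  have hG := hd _ ph (c1 h h0).
  have GM : 0 <= G * mdist p (S0 p h) by rewrite mulr_ge0// mdist_ge0.
  have := semigroup_dissipation0 h0 Lh pE GM hG.
  rewrite (metric_sym p).
  have := mdist_ge0 (S0 p h) p; rewrite le_eqVlt => /predU1P[<- _|D0].
    by rewrite mulr_ge0 ?mulr_ge0// ltW.
  rewrite expr2 mulrA ler_pM2r//; lra.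
move=> s h s0; rewrite le_eqVlt => /predU1P[<-|h0].
  by rewrite addr0 mdistxx mulr0.
have [N [N0 hN]] := ex_div_lt (ltW h0) del0.
pose k := h / N%:R.
have k0 : 0 < k by rewrite divr_gt0// ltr0n.
have NkE : N%:R * k = h by rewrite /k mulrC divfK// pnatr_eq0 -lt0n.
have ind i : (i <= N)%N ->
    mdist (S p (s + i%:R * k)) (S p s) <= expR (L * (s + h)) * (4 * G) * (i%:R * k).
  elim: i => [_|i ih iN]; first by rewrite mul0r addr0 mdistxx mulr0.
  have ik : i%:R * k <= h by rewrite -NkE ler_wpM2r ?(ltW k0)// ler_nat ltnW.
  have ik0 : 0 <= i%:R * k by rewrite mulr_ge0// ltW.
  rewrite -natr1 mulrDl mul1r addrA mulrDr.
  apply: le_trans (metric_triangle _ (S p (s + i%:R * k)) _) _.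
  rewrite [leRHS]addrC lerD ?ih ?(ltnW iN)//.
  apply: le_trans (semigroup_shift p (addr_ge0 s0 ik0) (ltW k0)) _.
  rewrite -mulrA ler_pM ?expR_ge0 ?mdist_ge0 ?small//.
  by rewrite ler_expR ler_wpM2l// lerD2l.
by have := ind N (leqnn N); rewrite NkE.
Qed.

Lemma semigroup_slope p G : 0 <= G -> (slope E p < G%:E)%E ->
  forall s, 0 < s -> (slope E (S p s) <= (expR (L * (s + 1)) * (4 * G))%:E)%E.
Proof.
move=> G0 hG s s0; rewrite semigroup_gt0//.
apply: (slope_le_speed E_proper E_lsc (hcurve p)) => //.
  by rewrite mulr_ge0 ?expR_ge0// mulr_ge0.
move=> d d0; pose h := Num.min 1 d / 2.
have m0 : 0 < Num.min 1 d by rewrite lt_min ltr01.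
have h0 : 0 < h by rewrite divr_gt0.
have : h < Num.min 1 d by rewrite /h ltr_pdivrMr// ltr_pMr// ltr1n.
rewrite lt_min => /andP[h1 hd].
exists h; first by rewrite h0.
have := semigroup_lipschitz G0 hG (ltW s0) (ltW h0).
rewrite !semigroup_gt0 ?addr_gt0// => /le_trans; apply.
rewrite ler_wpM2r ?(ltW h0)// ler_wpM2r ?mulr_ge0// ler_expR ler_wpM2l// lerD2l.
exact: ltW.
Qed.

Hypothesis E_bounded_below : forall B : set X, metric_bounded B ->
  exists c : R, forall x, B x -> (c%:E <= E x)%E.

Lemma semigroup_bounded w b : 0 < b -> exists B, forall t, 0 <= t -> t <= b -> mdist (S w t) w <= B.
Proof.
move=> b0; have [d1 d10 hd1] := semigroup_start w ltr01.
have [c1 c2 c3 c5 c4] := hcurve w.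
have [B hB] := c5 (Num.min d1 b) b w ltac:(by rewrite lt_min d10) ltac:(by rewrite ge_min lexx orbT).
exists (Num.max 1 B) => t; rewrite le_eqVlt => /predU1P[<- _|t0 tb].
  by rewrite semigroup0 mdistxx le_max ler01.
rewrite semigroup_gt0// le_max.
have [td|td] := ltP t d1; first by rewrite metric_sym hd1.
by rewrite hB ?orbT// ge_min td.
Qed.

(** The energy dissipated between s / 2 and s is bounded on bounded sets: above
by the integrated inequality tested at a point v of finite energy, below because E
is bounded below on bounded sets. [dissipation_sum] turns this into a speed at time
s and [slope_le_speed] into a slope. *)
Lemma semigroup_slope_bounded (w : X) (rho s : R) : 0 < s -> exists2 K : R, 0 <= K &
  forall p, mdist p w <= rho -> (slope E (S p s) <= K%:E)%E.
Proof.
move=> s0.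
have [v vE] := E_dom.
have [B hB] := semigroup_bounded v s0.
have s20 : 0 < s / 2 by rewrite divr_gt0.
pose r1 := rho + mdist w v.
pose r2 := expR (L * s) * r1 + B.
have near p t : mdist p w <= rho -> 0 <= t -> t <= s -> mdist (S p t) v <= r2.
  move=> pw t0 ts; apply: le_trans (metric_triangle _ (S v t) _) _.
  rewrite lerD ?hB//; apply: le_trans (semigroup_contraction p v t0) _.
  apply: ler_pM; rewrite ?expR_ge0 ?mdist_ge0//.
    by rewrite ler_expR ler_wpM2l.
  by apply: le_trans (metric_triangle _ w _) _; rewrite /r1 lerD2r.
have [c hc] : exists c : R, forall x, mdist x v <= r2 -> (c%:E <= E x)%E.
  apply: (E_bounded_below (B := [set x | mdist x v <= r2])).
  exists (2 * r2) => x y /= xv yv.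
  have := metric_triangle x v y; rewrite (metric_sym v y); lra.
pose e1 := fine (E v) + L / 2 * r2 ^+ 2 + r1 ^+ 2 / s.
pose Q := 4 * expR (2 * L * (s - s / 2)) * (e1 - c) / (s - s / 2).
exists (1 + `|Q|); first by rewrite addr_ge0.
move=> p pw; rewrite semigroup_gt0//.
have [c1 c2 c3 c5 c4] := hcurve p.
have ss2 : s / 2 < s by lra.
have upper : fine (E (S0 p (s / 2))) <= e1.
  have hM t : 0 < t -> t <= s / 2 -> mdist (S0 p t) v ^+ 2 <= r2 ^+ 2.
    move=> t0 ts; have := near p t pw (ltW t0) ltac:(lra); rewrite semigroup_gt0// => H.
    by rewrite lerXn2r ?nnegrE ?mdist_ge0// (le_trans _ H)// mdist_ge0.
  have := semigroup_evi s20 vE hM.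
  set x1 := mdist (S0 p (s / 2)) v; have x10 := sqr_ge0 x1.
  have : mdist p v ^+ 2 <= r1 ^+ 2.
    have H : mdist p v <= r1 by apply: le_trans (metric_triangle _ w _) _; rewrite /r1 lerD2r.
    by rewrite lerXn2r ?nnegrE ?mdist_ge0// (le_trans _ H)// mdist_ge0.
  rewrite /e1; set Ev := fine (E v); set Es := fine _; set T := L / 2 * _.
  move=> H1 H2.
  have H3 : - (r1 ^+ 2) <= s * (Ev - Es + T) by lra.
  have : - (r1 ^+ 2 / s) <= Ev - Es + T by rewrite -mulNr ler_pdivrMr// mulrC.
  lra.
have lower : c <= fine (E (S0 p s)).
  rewrite -lee_fin -(dom_fin E_proper (c1 s s0)); apply: hc.
  by have := near p s pw (ltW s0) (lexx s); rewrite semigroup_gt0.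
apply: (slope_le_speed E_proper E_lsc (hcurve p)) => //.
move=> d d0.
(* The step must divide s - s / 2 for the telescoping of energies. *)
pose del := Num.min d (2 * (L + 1))^-1.
have L10 : 0 < 2 * (L + 1) by rewrite mulr_gt0// ltr_wpDl.
have del0 : 0 < del by rewrite lt_min d0 invr_gt0.
have [N [N0 hN]] := ex_div_lt (ltac:(lra) : 0 <= s - s / 2) del0.
move: hN; set h := _ / N%:R; rewrite lt_min => /andP[hd hL].
have h0 : 0 < h by rewrite divr_gt0 ?subr_gt0// ltr0n.
exists h; first by rewrite h0.
have Lh : L * h <= 2^-1.
  apply: (@le_trans _ _ (L * (2 * (L + 1))^-1)); first by rewrite ler_wpM2l// ltW.
  by rewrite ler_pdivrMr// mulrA mulVf// mul1r lerDl.
have := dissipation_sum (hcurve p) s20 ss2 N0 Lh.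
rewrite -/h -/L => H.
have H2 : mdist (S0 p (s + h)) (S0 p s) ^+ 2 <= `|Q| * h ^+ 2.
  apply: (@le_trans _ _ (Q * h ^+ 2)); last by rewrite ler_wpM2r ?sqr_ge0 ?ler_norm.
  rewrite /Q mulrAC ler_pdivlMr ?subr_gt0//; apply: le_trans H _.
  rewrite [leRHS]mulrAC; apply: ler_wpM2l; last exact: lerB upper lower.
  by rewrite mulr_ge0 ?sqr_ge0// mulr_ge0 ?expR_ge0.
have Qh0 : 0 <= (1 + `|Q|) * h.
  by apply: mulr_ge0; [rewrite addr_ge0|exact: ltW].
rewrite -(@ler_pXn2r _ 2%N) ?nnegrE ?mdist_ge0//.
apply: le_trans H2 _; rewrite [leRHS]exprMn ler_wpM2r ?sqr_ge0// sqrrD expr1n mul1r mulr2n.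
by rewrite (addrC 1) -!addrA lerDl !addr_ge0// sqr_ge0.
Qed.

End SemigroupFromZero.

(** * Sequential compactness *)

Section SequentialCompactness.
Context {R : realType} {X : metricType R}.
Local Notation mu := (@lebesgue_measure R).
Variable E : X -> \bar R.

(** What the proof retains of convergence in sigma. The last property speaks of
an index map beyond a rank, because a diagonal sequence is a subsequence of each of
the given ones only from some rank on. *)
Record sigma_conv (conv : (nat -> X) -> X -> Prop) : Prop := {
  conv_compact : forall u, metric_bounded (range u) ->
    exists2 phi : nat -> nat, {homo phi : m n / (m < n)%N} &
      exists l, conv (u \o phi) l;
  conv_mdist : forall u v x y, conv u x -> conv v y ->
    ((mdist x y)%:E <= limn_einf (fun n => (mdist (u n) (v n))%:E))%E;
  conv_slope : forall u x, conv u x ->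
    (slope E x <= limn_einf (fun n => slope E (u n)))%E;
  conv_cst : forall x, conv (fun=> x) x;
  conv_sub : forall u v l (rho : nat -> nat) N, conv u l ->
    (forall n, (N <= n)%N -> (n <= rho n)%N /\ v n = u (rho n)) -> conv v l }.

Lemma assumption_S_conv : assumption_S E -> exists conv, sigma_conv conv.
Proof.
move=> [sigma [_ h1 h2 h3]].
exists (fun u l => (fun n => u n : Topological.Pack sigma) @ \oo --> (l : Topological.Pack sigma)).
split => //.
- by move=> x; exact: cvg_cst.
- move=> u v l rho N ul h A Al; have [M _ hM] := ul A Al.
  exists (maxn M N) => // n /=; rewrite geq_max => /andP[Mn Nn].
  have [nr vn] := h n Nn; rewrite vn; apply: hM => /=; exact: leq_trans nr.
Qed.

Lemma homo_ge (phi : nat -> nat) : {homo phi : m n / (m < n)%N} -> forall n, (n <= phi n)%N.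
Proof. by move=> h; elim => // n ih; apply: leq_ltn_trans ih (h _ _ _). Qed.

Variable conv : (nat -> X) -> X -> Prop.
Hypothesis hconv : sigma_conv conv.

Lemma conv_sub_homo u l phi : {homo phi : m n / (m < n)%N} -> conv u l -> conv (u \o phi) l.
Proof.
move=> hphi ul; apply: (conv_sub hconv (rho := phi) (N := 0) ul) => n _.
by split => //; exact: homo_ge.
Qed.

Lemma conv_mdist_le u v x y C : conv u x -> conv v y ->
  (forall N, exists2 n, (N <= n)%N & mdist (u n) (v n) <= C) -> mdist x y <= C.
Proof.
move=> ux vy h; rewrite -lee_fin; apply: le_trans (conv_mdist hconv ux vy) _.
by apply: limn_einf_le => N; have [n Nn hn] := h N; exists n.
Qed.

Lemma diagonal_extraction (a : nat -> nat -> X) :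
  (forall j, metric_bounded (range (a j))) ->
  exists2 phi : nat -> nat, {homo phi : m n / (m < n)%N} &
    forall j, exists l, conv (a j \o phi) l.
Proof.
move=> ha.
have /choice[F hF] : forall jt : nat * (nat -> nat), exists psi : nat -> nat,
    {homo psi : m n / (m < n)%N} /\ exists l, conv (a jt.1 \o jt.2 \o psi) l.
  move=> [j th] /=.
  have [|psi h1 h2] := conv_compact hconv (u := a j \o th); last by exists psi.
  have [M hM] := ha j; exists M => _ _ [n _ <-] [m _ <-]; apply: hM.
    by exists (th n).
  by exists (th m).
pose Theta := fix Theta j : nat -> nat :=
  if j is i.+1 then Theta i \o F (i, Theta i) else id.
have psi_homo j : {homo F (j, Theta j) : m n / (m < n)%N} by have [] := hF (j, Theta j).
have Theta_homo j : {homo Theta j : m n / (m < n)%N}.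
  elim: j => [//|j ih] m n mn /=; apply: ih; exact: psi_homo.
have factor j k : exists2 rho : nat -> nat, (forall n, (n <= rho n)%N) &
    Theta (j + k)%N =1 Theta j \o rho.
  elim: k => [|k [rho h1 h2]]; first by exists id => // n; rewrite addn0.
  exists (rho \o F ((j + k)%N, Theta (j + k)%N)).
    move=> n /=; apply: leq_trans (h1 _); exact: homo_ge (psi_homo _) n.
  by move=> n; rewrite addnS /= h2.
have /choice[r hr] : forall jn : nat * nat, exists m, (jn.1 <= jn.2)%N ->
    (jn.2 <= m)%N /\ Theta jn.2 jn.2 = Theta jn.1 m.
  move=> [j n] /=; have [jn|jn] := leqP j n; last by exists 0%N.
  have [rho h1 h2] := factor j (n - j)%N.
  exists (rho n) => _; split; first exact: h1.
  by rewrite -[X in Theta X _](subnKC jn) h2.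
exists (fun n => Theta n n).
  apply: homo_ltn; first exact: ltn_trans.
  move=> n /=; apply: Theta_homo.
  by apply: leq_trans (homo_ge (psi_homo n) n.+1).
move=> j; have [_ [l hl]] := hF (j, Theta j); exists l.
apply: (conv_sub hconv (rho := fun n => r (j.+1, n)) (N := j.+1) hl) => n jn.
have [h1 h2] := hr (j.+1, n) jn; split => //=.
by rewrite /= h2.
Qed.

(** A sequence converging to x for the distance has a sigma-convergent
subsequence, whose limit is x by lower semicontinuity of the distance; the slope is
thus lower semicontinuous for the distance too, and measurable along continuous
curves. *)
Lemma slope_lsc x c : (c < slope E x)%E ->
  exists2 r : R, 0 < r & forall y, mdist x y < r -> (c < slope E y)%E.
Proof.
move=> cx; apply: contrapT => hN.
have /choice[y hy] : forall n : nat, exists y, mdist x y < n.+1%:R^-1 /\ (slope E y <= c)%E.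
  move=> n; apply: contrapT => hy; apply: hN; exists n.+1%:R^-1; first by rewrite invr_gt0.
  move=> y xy; rewrite ltNge; apply/negP => yc; apply: hy; by exists y.
have [|phi hphi [l hl]] := conv_compact hconv (u := y).
  exists 2 => _ _ [n _ <-] [m _ <-].
  have i1 k : (k.+1%:R^-1 : R) <= 1 by rewrite invf_le1// ler1n.
  have hn k : mdist x (y k) <= 1 by apply: le_trans (ltW (hy k).1) (i1 k).
  have := metric_triangle (y n) x (y m); rewrite (metric_sym (y n) x).
  have := hn n; have := hn m; clear; lra.
have lx : x = l.
  apply: mdist_positivity; apply/eqP; rewrite eq_le mdist_ge0 andbT.
  apply/ler_addgt0Pr => /= e e0; rewrite add0r.
  apply: conv_mdist_le (conv_cst hconv x) hl _ => N.
  have [k _ hk] := near_infty_natSinv_lt (PosNum (e0 : 0 < (e : R))).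
  exists (maxn N k); first exact: leq_maxl.
  have [h _] := hy (phi (maxn N k)); apply: le_trans (ltW h) _; apply/ltW/hk => /=.
  by apply: leq_trans (homo_ge hphi _); exact: leq_maxr.
have := conv_slope hconv hl; rewrite -lx => /(lt_le_trans cx).
rewrite ltNge => /negP; apply; apply: limn_einf_le => N; exists N => //.
exact: (hy (phi N)).2.
Qed.

Lemma slope_ge0 x : (0 <= slope E x)%E.
Proof.
rewrite /slope; case: asboolP => _; last by rewrite leey.
case: asboolP => [//|niso]; apply: limf_esup_ge0.
  move=> h; apply: niso; split; first by rewrite inE.
  exists [set x]; last by rewrite setIT.
  have h' : nbhs x [set z | z != x -> set0 z] by exact: h.
  apply: filterS h' => z /= zx; apply/eqP; apply: contrapT => /negP zx'; exact: zx.
move=> z; apply: mule_ge0; first by rewrite le_max lexx orbT.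
by rewrite lee_fin invr_ge0 mdist_ge0.
Qed.

Lemma measurable_slope gamma : ucont01 gamma ->
  measurable_fun (`[0, 1]%classic : set R) (fun t => slope E (gamma t)).
Proof.
move=> uc.
have lsc : lower_semicontinuous (fun t : R => slope E (gamma (clamp01 t))).
  move=> t a h; have [r r0 hr] := slope_lsc h.
  have r20 : 0 < r / 2 by rewrite divr_gt0.
  have [d d0 hd] := ucont01_clamp uc r20.
  exists (ball t d); first exact: nbhsx_ballx.
  move=> s ts; apply: hr; apply: (@le_lt_trans _ _ (r / 2)); first exact: hd.
  by rewrite ltr_pdivrMr// ltr_pMr// ltr1n.
apply: (@eq_measurable_fun _ _ _ _ _ (fun t => slope E (gamma (clamp01 t)))).
  by move=> t; rewrite inE/= in_itv/= => /andP[t0 t1]; rewrite clamp01_id.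
have := lower_semicontinuous_measurable lsc; exact: measurable_funS.
Qed.

Lemma measurable_slope_sqr gamma : ucont01 gamma ->
  measurable_fun (`[0, 1]%classic : set R) (fun t => slope E (gamma t) ^+ 2)%E.
Proof. by move=> uc; apply: emeasurable_funM; exact: measurable_slope. Qed.

Lemma energy_mod_ucont (gamma : R -> X) V : energy_mod gamma V -> ucont01 gamma.
Proof. by move=> em; exact: energy_controlled_ucont (energy_mod_controlled em). Qed.

End SequentialCompactness.

(** * Closedness of the attainable pairs *)

Lemma ereal_between (R : realType) (a b : \bar R) : (a < b)%E ->
  exists r : R, (a < r%:E)%E /\ (r%:E < b)%E.
Proof.
case: a b => [a| |] [b| |]//=; rewrite ?ltxx ?ltNge ?leey ?leNye//= -?ltNge.
- by rewrite lte_fin => ab; exists ((a + b) / 2); rewrite !lte_fin; split; lra.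
- by move=> _; exists (a + 1); rewrite lte_fin ltry; split => //; lra.
- by move=> _; exists (b - 1); rewrite lte_fin ltNyr; split => //; lra.
- by move=> _; exists 0; rewrite ltry ltNyr.
Qed.

Lemma bounded_liminf (R : realType) (u : nat -> R) (M : R) : (forall n, 0 <= u n <= M) ->
  exists v : R, (forall e, 0 < e -> exists N, forall n, (N <= n)%N -> v - e <= u n) /\
    (forall e N, 0 < e -> exists2 n, (N <= n)%N & u n <= v + e).
Proof.
move=> uM; set L := limn_einf (fun n => (u n)%:E).
have L0 : (0 <= L)%E by apply: (@limn_einf_ge _ _ _ 0%N) => n _; rewrite lee_fin; have /andP[] := uM n.
have LM : (L <= M%:E)%E.
  by apply: limn_einf_le => N; exists N => //; rewrite lee_fin; have /andP[] := uM N.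
have Lfin : L \is a fin_num by rewrite ge0_fin_numE// (le_lt_trans LM)// ltry.
exists (fine L); split => e.
  move=> e0; apply: contrapT => h; have : (L <= (fine L - e)%:E)%E.
    apply: limn_einf_le => N; apply: contrapT => hN; apply: h; exists N => n Nn.
    rewrite leNgt; apply/negP => un; apply: hN; exists n => //; rewrite lee_fin; exact: ltW.
  by rewrite EFinB fineK// leeBrDr// -[leRHS]adde0 leeD2lE// lee_fin leNgt e0.
move=> N e0; have : (L < (fine L + e)%:E)%E.
  by rewrite EFinD fineK// lteDl// lte_fin.
by move=> /limn_einf_lt_often/(_ N)[n Nn]; rewrite lte_fin => /ltW; exists n.
Qed.

Section Attainable.
Context {R : realType} {X : metricType R}.
Local Notation mu := (@lebesgue_measure R).
Variable E : X -> \bar R.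

Definition attainable (x y : X) (a b : R) := exists gamma : R -> X, exists V : R -> R,
  [/\ energy_mod gamma V, gamma 0 = x, gamma 1 = y,
      2^-1 * (V 1 - V 0) <= a & (fisher E gamma <= b%:E)%E].

Variable conv : (nat -> X) -> X -> Prop.
Hypothesis hconv : sigma_conv E conv.

(** Sigma need not be metrizable, so limits are identified along subsequences
only. This form is enough to transfer a bound that holds infinitely often. *)
Definition sub_conv (u : nat -> X) (x : X) := forall rho : nat -> nat,
  (forall n, (n <= rho n)%N) ->
  exists2 psi : nat -> nat, {homo psi : m n / (m < n)%N} & conv (u \o rho \o psi) x.

Lemma sub_conv_mdist u v x y C : sub_conv u x -> sub_conv v y ->
  (forall N, exists2 n, (N <= n)%N & mdist (u n) (v n) <= C) -> mdist x y <= C.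
Proof.
move=> ux vy h.
have /choice[rho hrho] N : exists n, (N <= n)%N /\ mdist (u n) (v n) <= C.
  by have [n] := h N; exists n.
have h1 n := (hrho n).1; have h2 n := (hrho n).2.
have [psi hpsi cu] := ux rho h1.
have h3 n : (n <= rho (psi n))%N by apply: leq_trans (h1 _); exact: homo_ge.
have [psi' hpsi' cv] := vy (rho \o psi) h3.
apply: (conv_mdist_le hconv (conv_sub_homo hconv hpsi' cu) cv) => N.
by exists N => //; exact: h2.
Qed.

Lemma sub_conv_slope u x (c : \bar R) : sub_conv u x ->
  (forall N, exists2 n, (N <= n)%N & (slope E (u n) <= c)%E) -> (slope E x <= c)%E.
Proof.
move=> ux h.
have /choice[rho hrho] N : exists n, (N <= n)%N /\ (slope E (u n) <= c)%E.
  by have [n] := h N; exists n.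
have h1 n := (hrho n).1; have h2 n := (hrho n).2.
have [psi hpsi cu] := ux rho h1.
apply: le_trans (conv_slope hconv cu) _; apply: limn_einf_le => N.
by exists N => //; exact: h2.
Qed.

(** A real number strictly between the two sides would bound the slopes
infinitely often, hence the slope at the limit. *)
Lemma sub_conv_slope_sqr u x : sub_conv u x ->
  (slope E x ^+ 2 <= limn_einf (fun n => slope E (u n) ^+ 2))%E.
Proof.
move=> ux; rewrite leNgt; apply/negP => /ereal_between[r [h1 h2]].
have r0 : 0 <= r.
  rewrite -lee_fin; apply: le_trans (ltW h1); apply: (@limn_einf_ge _ _ _ 0%N) => n _.
  by apply: mule_ge0; exact: (slope_ge0 E).
have s0 : (0 <= (Num.sqrt r)%:E)%E by rewrite lee_fin sqrtr_ge0.
move: h2; rewrite ltNge => /negP; apply.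
rewrite -(sqr_sqrtr r0) EFin_expe lee_sqr ?(slope_ge0 E)//.
apply: (sub_conv_slope ux) => N; have [n Nn hn] := limn_einf_lt_often h1 N.
exists n => //; rewrite -lee_sqr ?(slope_ge0 E)// -EFin_expe sqr_sqrtr//; exact: ltW.
Qed.

(** Extract a subsequence converging at a dense set of times. At any other time,
the equicontinuity given by the energies and the lower semicontinuity of the distance
force all sigma-limits to agree. The limit curve G inherits the energy inequality
with V the pointwise lower limit of the normalized energies, and Fatou's lemma
bounds its Fisher integral. *)
Lemma attainable_closed x y a b :
  (forall e, 0 < e -> attainable x y (a + e) (b + e)) -> attainable x y a b.
Proof.
move=> h.
have /choice[gV hgV] (n : nat) : exists gV : (R -> X) * (R -> R),
    [/\ energy_mod gV.1 gV.2, gV.1 0 = x, gV.1 1 = y,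
      2^-1 * (gV.2 1 - gV.2 0) <= a + n.+1%:R^-1 &
      (fisher E gV.1 <= (b + n.+1%:R^-1)%:E)%E].
  have [|g [V hg]] := h n.+1%:R^-1; first by rewrite invr_gt0.
  by exists (g, V).
pose g n := (gV n).1; pose W n t := (gV n).2 t - (gV n).2 0; pose M := 2 * (a + 1).
have eM n : energy_mod (g n) (gV n).2 by have [] := hgV n.
have WM n (t : R) : 0 <= t -> t <= 1 -> 0 <= W n t <= M.
  move=> t0 t1; rewrite /W subr_ge0 (path_mod_mono (eM n))//=.
  have h1 := path_mod_mono (eM n) t0 t1 (lexx 1).
  have [_ _ _ h2 _] := hgV n.
  have h3 : 2^-1 * ((gV n).2 1 - (gV n).2 0) <= a + 1.
    by apply: le_trans h2 _; rewrite lerD2l invf_le1// ler1n.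
  by rewrite /M; move: h1 h3; clear; lra.
have M0 : 0 <= M by have /andP[] := WM 0%N 0 (lexx 0) ler01; apply: le_trans.
have em n (s t : R) : 0 <= s -> s <= t -> t <= 1 ->
    mdist (g n s) (g n t) ^+ 2 <= (t - s) * (W n t - W n s).
  move=> s0 st t1; rewrite /W opprB addrA subrK; exact: eM.
have hol0 n (s t : R) : 0 <= s -> s <= t -> t <= 1 ->
    mdist (g n s) (g n t) ^+ 2 <= `|s - t| * M.
  move=> s0 st t1; apply: le_trans (em n s t s0 st t1) _.
  rewrite distrC ger0_norm ?subr_ge0// ler_wpM2l ?subr_ge0//.
  have /andP[h1 _] := WM n s s0 (le_trans st t1).
  have /andP[_ h2] := WM n t (le_trans s0 st) t1; lra.
have hol n (s t : R) : 0 <= s <= 1 -> 0 <= t <= 1 ->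
    mdist (g n s) (g n t) ^+ 2 <= `|s - t| * M.
  move=> /andP[s0 s1] /andP[t0 t1]; have [st|/ltW ts] := leP s t; first exact: hol0.
  by rewrite metric_sym distrC; exact: hol0.
have hole n (s t e : R) : 0 <= s <= 1 -> 0 <= t <= 1 -> 0 <= e -> `|s - t| * M <= e ^+ 2 ->
    mdist (g n s) (g n t) <= e.
  move=> s01 t01 e0 he; rewrite -ler_sqr ?nnegrE ?mdist_ge0//.
  exact: le_trans (hol n s t s01 t01) he.
have i00 : 0 <= (0 : R) <= 1 by rewrite lexx ler01.
have i11 : 0 <= (1 : R) <= 1 by rewrite lexx ler01.
have bnd t (psi : nat -> nat) : 0 <= t <= 1 -> metric_bounded (range (fun n => g (psi n) t)).
  move=> t01; have hn n : mdist x (g n t) <= M + 1.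
    have [_ <- _ _ _] := hgV n; apply: hole => //; first by rewrite addr_ge0.
    move: t01 => /andP[t0 t1]; rewrite sub0r normrN ger0_norm//.
    apply: (@le_trans _ _ M); first by rewrite ler_piMl.
    rewrite sqrrD expr1n mulr1 mulr2n; have := sqr_ge0 M; lra.
  exists (M + 1 + (M + 1)) => _ _ [n _ <-] [m _ <-].
  apply: le_trans (metric_triangle _ x _) _; rewrite (metric_sym _ x).
  by rewrite lerD.
have [q [q01 qd]] := @dense_sequence R 0 1 ler01.
have [phi hphi /choice[l hl]] := diagonal_extraction hconv
  (a := fun j n => g n (q j)) (fun j => bnd (q j) id (q01 j)).
(* Any sigma-limit of the curves at time t is close to l j when q j is close to t. *)
have near_l (t : R) (theta : nat -> nat) p j (e : R) : 0 <= t <= 1 -> (forall n, (n <= theta n)%N) ->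
    conv (fun n => g (phi (theta n)) t) p -> 0 <= e -> `|t - q j| * M <= e ^+ 2 ->
    mdist p (l j) <= e.
  move=> t01 hth hp e0 he.
  have hl' : conv (fun n => g (phi (theta n)) (q j)) (l j).
    by apply: (conv_sub hconv (rho := theta) (N := 0%N) (hl j)).
  by apply: (conv_mdist_le hconv hp hl') => N; exists N => //; exact: hole.
have uniq t (theta theta' : nat -> nat) p p' : 0 <= t <= 1 ->
    (forall n, (n <= theta n)%N) -> (forall n, (n <= theta' n)%N) ->
    conv (fun n => g (phi (theta n)) t) p -> conv (fun n => g (phi (theta' n)) t) p' -> p = p'.
  move=> t01 hth hth' hp hp'; apply: mdist_positivity; apply/eqP.
  rewrite eq_le mdist_ge0 andbT; apply/ler_addgt0Pr => /= e e0; rewrite add0r.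
  have M1 : 0 < M + 1 by lra.
  have [j hj] := qd t ((e / 2) ^+ 2 / (M + 1)) t01 ltac:(by rewrite divr_gt0 ?exprn_gt0 ?divr_gt0).
  have he : `|t - q j| * M <= (e / 2) ^+ 2.
    move: hj; rewrite distrC ltr_pdivlMr// mulrDr mulr1 => hj.
    by have := normr_ge0 (t - q j); lra.
  have e20 : 0 <= e / 2 by rewrite divr_ge0// ltW.
  apply: le_trans (metric_triangle _ (l j) _) _; rewrite (metric_sym (l j)).
  rewrite [leRHS](splitr e) lerD//.
    exact: near_l hth hp e20 he.
  exact: near_l hth' hp' e20 he.
have /choice[G hG] (t : R) : exists p, 0 <= t <= 1 -> exists2 psi : nat -> nat,
    (forall n, (n <= psi n)%N) & conv (fun n => g (phi (psi n)) t) p.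
  have [t01|nt] := boolP (0 <= t <= 1); last by exists x.
  have [psi hpsi [p hp]] := conv_compact hconv (bnd t phi t01).
  by exists p => _; exists psi => //; exact: homo_ge.
have sG t : 0 <= t <= 1 -> sub_conv (fun n => g (phi n) t) (G t).
  move=> t01 rho hrho; have [psi' hpsi' hc'] := hG t t01.
  have [psi hpsi [p hp]] := conv_compact hconv (bnd t (phi \o rho) t01).
  exists psi => //; rewrite (_ : G t = p)//.
  apply: (uniq t psi' (rho \o psi)) => // n /=.
  by apply: leq_trans (hrho _); exact: homo_ge.
have scst p : sub_conv (fun=> p) p by move=> rho _; exists id => //; exact: (conv_cst hconv).
have /choice[V hV] (t : R) : exists v : R, 0 <= t <= 1 ->
    (forall e, 0 < e -> exists N, forall n, (N <= n)%N -> v - e <= W (phi n) t) /\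
    (forall e N, 0 < e -> exists2 n, (N <= n)%N & W (phi n) t <= v + e).
  have [/andP[t0 t1]|nt] := boolP (0 <= t <= 1); last by exists 0.
  have [v hv] := bounded_liminf (fun n => WM (phi n) t t0 t1).
  by exists v.
have emG : energy_mod G V.
  move=> s t s0 st t1.
  have s01 : 0 <= s <= 1 by rewrite s0 (le_trans st).
  have t01 : 0 <= t <= 1 by rewrite (le_trans s0).
  set d := mdist (G s) (G t); have d0 : 0 <= d by exact: mdist_ge0.
  apply/ler_addgt0Pr => /= e3 e30; set e := e3 / 3.
  have e0 : 0 < e by rewrite divr_gt0.
  (* Lower semicontinuity of the distance along the extracted sequence. *)
  have [N1 hN1] : exists N, forall n, (N <= n)%N ->
      d ^+ 2 - e <= mdist (g (phi n) s) (g (phi n) t) ^+ 2.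
    apply: contrapT => hN; have hN' N : exists2 n, (N <= n)%N &
        mdist (g (phi n) s) (g (phi n) t) ^+ 2 <= d ^+ 2 - e.
      apply: contrapT => hN'; apply: hN; exists N => n Nn; rewrite leNgt; apply/negP => hn.
      by apply: hN'; exists n => //; exact: ltW.
    have C0 : 0 <= d ^+ 2 - e by have [n _] := hN' 0%N; apply: le_trans; exact: sqr_ge0.
    have : d <= Num.sqrt (d ^+ 2 - e).
      apply: (sub_conv_mdist (sG s s01) (sG t t01)) => N; have [n Nn hn] := hN' N.
      by exists n => //; rewrite -ler_sqr ?nnegrE ?mdist_ge0 ?sqrtr_ge0// sqr_sqrtr.
    by rewrite -ler_sqr ?nnegrE ?sqrtr_ge0// sqr_sqrtr//; move: e0; clear; lra.
  have [N2 hN2] := (hV s s01).1 e e0.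
  have [n nN hn] := (hV t t01).2 e (maxn N1 N2) e0.
  have h1 := hN1 n (leq_trans (leq_maxl _ _) nN).
  have h2 := hN2 n (leq_trans (leq_maxr _ _) nN).
  have h3 := em (phi n) s t s0 st t1.
  have h4 : (t - s) * (W (phi n) t - W (phi n) s) <= (t - s) * (V t - V s + 2 * e).
    by rewrite ler_wpM2l ?subr_ge0//; move: hn h2; clear; lra.
  have h5 : (t - s) * (2 * e) <= 2 * e.
    have ts1 : t - s <= 1 by rewrite lerBlDr (le_trans t1)// lerDl.
    by rewrite ler_piMl// mulr_ge0// ltW.
  have e3E : e3 = 3 * e by rewrite /e mulrC divfK.
  by rewrite e3E; move: h1 h3 h4 h5; rewrite mulrDr; clear; lra.
have inv_small (e : R) : 0 < e -> exists k : nat, forall n, (k <= n)%N -> (phi n).+1%:R^-1 <= e.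
  move=> e0; have [k _ hk] := near_infty_natSinv_lt (PosNum e0).
  exists k => n kn; apply/ltW/hk => /=; apply: leq_trans kn _; exact: homo_ge.
exists G, V; split => //.
- apply: mdist_positivity; apply/eqP; rewrite eq_le mdist_ge0 andbT.
  apply: (sub_conv_mdist (sG 0 i00) (scst x)) => N; exists N => //.
  by rewrite (_ : g _ _ = x) ?mdistxx//; have [] := hgV (phi N).
- apply: mdist_positivity; apply/eqP; rewrite eq_le mdist_ge0 andbT.
  apply: (sub_conv_mdist (sG 1 i11) (scst y)) => N; exists N => //.
  by rewrite (_ : g _ _ = y) ?mdistxx//; have [] := hgV (phi N).
- apply/ler_addgt0Pr => /= e2 e20; set e := e2 / 2.
  have e0 : 0 < e by rewrite divr_gt0.
  have [n0 _] := (hV 0 i00).2 e 0%N e0; rewrite {1}/W subrr => h0.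
  have [N1 hN1] := (hV 1 i11).1 e e0.
  have [k hk] := inv_small e e0.
  have := hN1 (maxn N1 k) (leq_maxl _ _); have := hk (maxn N1 k) (leq_maxr _ _).
  have [_ _ _] := hgV (phi (maxn N1 k)).
  have -> : e2 = 2 * e by rewrite /e mulrC divfK.
  rewrite /W; move: h0; move: ((phi _).+1%:R^-1 : R) (_.2 1) (_.2 0).
  move=> r w1 w0 h0 h1 _; move: h0 h1; clear; lra.
- have mS (f : R -> X) F : energy_mod f F ->
      measurable_fun (`[0, 1]%classic : set R) (fun t => slope E (f t) ^+ 2)%E.
    by move=> /energy_mod_ucont; exact: (measurable_slope_sqr hconv).
  have S0 p : (0 <= slope E p ^+ 2)%E by apply: mule_ge0; exact: (slope_ge0 E).
  rewrite /fisher lee_pdivrMl//.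
  apply: (@le_trans _ _ (\int[mu]_(t in `[0%R, 1%R])
      limn_einf (fun n => slope E (g (phi n) t) ^+ 2))%E).
    apply: ge0_le_integral => //; first exact: mS emG.
      by apply: measurable_fun_limn_einf => n; exact: mS (eM (phi n)).
    by move=> t /=; rewrite in_itv/= => t01; exact: sub_conv_slope_sqr (sG t t01).
  apply: le_trans (fatou mu _ _ _) _ => //.
    by move=> n; exact: mS (eM (phi n)).
  apply/lee_addgt0Pr => e e0; have e20 : 0 < e / 2 by rewrite divr_gt0.
  have [k hk] := inv_small _ e20.
  apply: limn_einf_le => N; exists (maxn N k); first exact: leq_maxl.
  have [_ _ _ _] := hgV (phi (maxn N k)); rewrite /fisher lee_pdivrMl// => /le_trans; apply.
  rewrite -!EFinM -EFinD lee_fin; have := hk (maxn N k) (leq_maxr _ _).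
  by move: ((phi _).+1%:R^-1 : R) => r; clear; lra.
Qed.

End Attainable.

(** * Joining and transforming curves *)

Section Joins.
Context {R : realType} {X : metricType R}.
Implicit Types (V : R -> R) (P Q : X -> Prop).

(** The Cauchy-Schwarz inequality in the plane, for gluing. *)
Lemma sqr_add_le (d1 d2 x1 x2 v1 v2 : R) : 0 <= d1 -> 0 <= d2 -> 0 <= x1 -> 0 <= x2 ->
  0 <= v1 -> 0 <= v2 -> d1 ^+ 2 <= x1 * v1 -> d2 ^+ 2 <= x2 * v2 ->
  (d1 + d2) ^+ 2 <= (x1 + x2) * (v1 + v2).
Proof.
move=> d10 d20 x10 x20 v10 v20 h1 h2.
have h : 2 * (d1 * d2) <= x1 * v2 + x2 * v1.
  rewrite -ler_sqr ?nnegrE ?addr_ge0 ?mulr_ge0//.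
  have h3 : d1 ^+ 2 * d2 ^+ 2 <= (x1 * v1) * (x2 * v2).
    by apply: ler_pM => //; exact: sqr_ge0.
  have h4 := sqr_ge0 (x1 * v2 - x2 * v1).
  rewrite !exprMn; move: h3 h4; clear; nra.
by move: h1 h2 h; clear; nra.
Qed.

Lemma path_mod_cat a c b (gamma1 gamma2 : R -> X) V1 V2 : a <= c -> c <= b ->
  path_mod a c gamma1 V1 -> path_mod c b gamma2 V2 -> gamma1 c = gamma2 c ->
  path_mod a b (fun t => if t <= c then gamma1 t else gamma2 t)
    (fun t => if t <= c then V1 t - V1 c else V2 t - V2 c).
Proof.
move=> ac cb h1 h2 gc s t sa st tb.
have [tc|ct] := leP t c; have [sc|cs] := leP s c.
- by have := h1 s t sa st tc; congr (_ <= _ * _); ring.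
- by have := le_lt_trans (le_trans st tc) cs; rewrite ltxx.
- have g1 := h1 s c sa sc (lexx c); have g2 := h2 c t (lexx c) (ltW ct) tb.
  have m1 := path_mod_mono h1 sa sc (lexx c); have m2 := path_mod_mono h2 (lexx c) (ltW ct) tb.
  rewrite (_ : t - s = (c - s) + (t - c)); last by ring.
  rewrite (_ : _ - (V1 s - _) = (V1 c - V1 s) + (V2 t - V2 c)); last by ring.
  apply: le_trans (_ : (mdist (gamma1 s) (gamma1 c) + mdist (gamma1 c) (gamma2 t)) ^+ 2 <= _).
    by rewrite ler_sqr ?nnegrE ?addr_ge0 ?mdist_ge0// metric_triangle.
  by apply: sqr_add_le => //; rewrite ?mdist_ge0 ?subr_ge0// ?(ltW ct)// gc.
- by have := h2 s t (ltW cs) st tb; congr (_ <= _ * _); ring.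
Qed.

Lemma path_mod_affine a b a' b' (gamma : R -> X) V (k m : R) : 0 <= k ->
  a <= k * a' + m -> k * b' + m <= b -> path_mod a b gamma V ->
  path_mod a' b' (fun t => gamma (k * t + m)) (fun t => k * V (k * t + m)).
Proof.
move=> k0 ha hb h s t sa st tb.
apply: le_trans (h (k * s + m) (k * t + m) _ _ _) _.
- by apply: le_trans ha _; rewrite lerD2r ler_wpM2l.
- by rewrite lerD2r ler_wpM2l.
- by apply: le_trans hb; rewrite lerD2r ler_wpM2l.
- by rewrite le_eqVlt; apply/orP; left; apply/eqP; ring.
Qed.

(** The predicate P carries slope bounds through gluing, time change and Lipschitz
images without any integral. *)
Definition joins P (T : R) (p q : X) (A : R) := exists gamma : R -> X, exists V : R -> R,
  [/\ path_mod 0 T gamma V, gamma 0 = p, gamma T = q, V T - V 0 <= A &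
    forall t, 0 <= t -> t <= T -> P (gamma t)].

Lemma joins_cat P T1 T2 p q r A1 A2 : 0 <= T1 -> 0 <= T2 ->
  joins P T1 p q A1 -> joins P T2 q r A2 -> joins P (T1 + T2) p r (A1 + A2).
Proof.
move=> T10 T20 [g1 [V1 [m1 b1 e1 a1 P1]]] [g2 [V2 [m2 b2 e2 a2 P2]]].
have m2' := @path_mod_affine 0 T2 T1 (T1 + T2) g2 V2 1 (- T1) ler01 ltac:(lra) ltac:(lra) m2.
have gc : g1 T1 = g2 (1 * T1 - T1) by rewrite mul1r subrr e1.
have T12 : T1 <= T1 + T2 by rewrite lerDl.
exists (fun t => if t <= T1 then g1 t else g2 (1 * t - T1)); eexists; split.
- exact: path_mod_cat T10 T12 m1 m2' gc.
- by rewrite T10.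
- rewrite mul1r addrAC subrr add0r; case: ifPn => // h.
  have T20' : T2 = 0 by apply/eqP; rewrite eq_le T20 andbT -(lerD2l T1) addr0.
  by rewrite T20' addr0 e1 -b2 -{1}T20'.
- rewrite /= T10 !mul1r (addrAC T1) subrr add0r; case: ifPn => h; last lra.
  have T20' : T2 = 0 by apply/eqP; rewrite eq_le T20 andbT -(lerD2l T1) addr0.
  move: a2; rewrite T20' addr0 subrr; lra.
- move=> t t0 tT; case: leP => ht; first exact: P1.
  by apply: P2; lra.
Qed.

Lemma joins_rev P T p q A : joins P T p q A -> joins P T q p A.
Proof.
move=> [g [V [m b e a hP]]].
exists (fun t => g (T - t)), (fun t => - V (T - t)); split.
- move=> s t s0 st tT; rewrite metric_sym.
  by apply: le_trans (m (T - t) (T - s) _ _ _) _; try lra; nra.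
- by rewrite subr0.
- by rewrite subrr.
- by rewrite subr0 subrr; lra.
- by move=> t t0 tT; apply: hP; lra.
Qed.

(** Running through a curve T'/T times slower divides its energy by that factor. *)
Lemma joins_rescale P T T' p q A : 0 < T -> 0 < T' -> joins P T p q A ->
  joins P T' p q (T / T' * A).
Proof.
move=> T0 T'0 [g [V [m b e a hP]]].
have k0 : 0 <= T / T' by rewrite divr_ge0// ltW.
have kT : T / T' * T' = T by rewrite divfK// gt_eqF.
exists (fun t => g (T / T' * t + 0)), (fun t => T / T' * V (T / T' * t + 0)); split.
- by apply: path_mod_affine m => //; rewrite ?mulr0 ?kT addr0.
- by rewrite mulr0 addr0.
- by rewrite kT addr0.
- by rewrite !addr0 kT mulr0 -mulrBr ler_wpM2l.
- move=> t t0 tT; apply: hP; rewrite addr0 ?(mulr_ge0 k0)//.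
  by apply: le_trans (_ : T / T' * T' <= T); rewrite ?ler_wpM2l// kT.
Qed.

Lemma joins_image P Q (Phi : X -> X) (c : R) T p q A : 0 <= c ->
  (forall p q, mdist (Phi p) (Phi q) <= c * mdist p q) -> (forall p, P p -> Q (Phi p)) ->
  joins P T p q A -> joins Q T (Phi p) (Phi q) (c ^+ 2 * A).
Proof.
move=> c0 hPhi hPQ [g [V [m b e a hP]]].
exists (Phi \o g), (fun t => c ^+ 2 * V t); split => /=.
- move=> s t s0 st tT; apply: le_trans (_ : (c * mdist (g s) (g t)) ^+ 2 <= _).
    by rewrite ler_sqr ?nnegrE ?mulr_ge0 ?mdist_ge0//=.
  by rewrite exprMn -mulrBr [leRHS]mulrCA ler_wpM2l ?sqr_ge0// m.
- by rewrite b.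
- by rewrite e.
- by rewrite -mulrBr ler_wpM2l ?sqr_ge0.
- by move=> t t0 tT; apply/hPQ/hP.
Qed.

Lemma joins_lipschitz P (g : R -> X) (K T : R) : 0 <= K ->
  (forall s t, 0 <= s -> s <= t -> t <= T -> mdist (g s) (g t) <= K * (t - s)) ->
  (forall t, 0 <= t -> t <= T -> P (g t)) -> joins P T (g 0) (g T) (K ^+ 2 * T).
Proof.
move=> K0 hg hP; exists g, (fun t => K ^+ 2 * t); split => //; last by rewrite mulr0 subr0.
move=> s t s0 st tT; apply: le_trans (_ : (K * (t - s)) ^+ 2 <= _).
  by rewrite ler_sqr ?nnegrE ?mulr_ge0 ?subr_ge0 ?mdist_ge0//; exact: hg.
by rewrite exprMn -mulrBr [leRHS]mulrCA expr2.
Qed.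

Lemma joins_sub P Q T p q A B : (forall z, P z -> Q z) -> A <= B -> joins P T p q A ->
  joins Q T p q B.
Proof.
move=> PQ AB [g [V [m b e a hP]]]; exists g, V; split => //; first exact: le_trans AB.
by move=> t t0 tT; apply/PQ/hP.
Qed.

Lemma path_mod_joins P a b (gamma : R -> X) V : a <= b -> path_mod a b gamma V ->
  (forall t, a <= t -> t <= b -> P (gamma t)) ->
  joins P (b - a) (gamma a) (gamma b) (V b - V a).
Proof.
move=> ab h hP; exists (fun t => gamma (1 * t + a)), (fun t => 1 * V (1 * t + a)); split.
- by apply: path_mod_affine h => //; lra.
- by rewrite mulr0 add0r.
- by rewrite mul1r subrK.
- by rewrite !mul1r subrK add0r.
- by move=> t t0 tb; apply: hP; lra.
Qed.

End Joins.

(** * Curves of finite Fisher integral and nearby action *)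

Lemma recovery_arith (R : realType) (r D delta t1 t2 v0 v1 v2 v3 : R) : 0 < r -> r < 2^-1 ->
  r + (1 + r) / (1 - r) * (D + r) < D + 2 * delta ->
  0 <= t1 -> t1 <= r / 2 -> 1 - t2 <= r / 2 -> t2 <= 1 ->
  v0 <= v1 -> v1 - v0 <= r / 2 -> v2 <= v3 -> v3 - v2 <= r / 2 -> 0 <= D ->
  [/\ 0 < t1 + 1 + (1 - t2), 0 < t2 - t1 &
    (t1 + 1 + (1 - t2)) / (t2 - t1) * (v1 - v0 + D + (v3 - v2)) < D + 2 * delta - r].
Proof.
move=> r0 r12 hr t10 t1r t2r t21 v01 d1 v23 d2 D0.
have T0 : 0 < t1 + 1 + (1 - t2) by lra.
have T'0 : 0 < t2 - t1 by lra.
split => //; rewrite ltrBrDl; apply: le_lt_trans hr; rewrite lerD2l; apply: ler_pM.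
- by rewrite divr_ge0// ltW.
- by rewrite (addr_ge0 (addr_ge0 _ D0))// subr_ge0.
- apply: ler_pM; rewrite ?invr_ge0 ?(ltW T0) ?(ltW T'0)//; first by lra.
  by rewrite lef_pV2 ?posrE//; lra.
- by lra.
Qed.

Lemma recovery_energy_arith (R : realType) (r D delta v0 v1 v2 v3 u0 u1 : R) :
  v1 - v0 <= r / 2 -> v3 - v2 <= r / 2 -> u1 - u0 <= D + 2 * delta - r ->
  2^-1 * (v3 - v2 - (v0 - v1 - (u1 - u0))) <= 2^-1 * D + delta.
Proof. by lra. Qed.

Section Recovery.
Context {R : realType} {X : metricType R}.
Local Notation mu := (@lebesgue_measure R).
Variables (E : X -> \bar R) (lambda : R).
Hypothesis E_proper : forall z, E z != -oo%E.
Hypothesis E_lsc : lower_semicontinuous E.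
Hypothesis E_dom : exists z, (E z < +oo)%E.
Hypothesis E_bounded_below : forall B : set X, metric_bounded B ->
  exists c : R, forall x, B x -> (c%:E <= E x)%E.
Variable S0 : X -> R -> X.
Hypothesis flows : forall p, EVI_flow E lambda p (S0 p).
Let L := `|lambda|.
Local Notation S := (semigroup S0).

(** The constant is the Lipschitz constant of [semigroup_lipschitz] for times up
to 1. *)
Lemma joins_flow p G K s : 0 <= G -> (slope E p < G%:E)%E -> 0 < s -> s <= 1 ->
  expR (L * 2) * (4 * G) <= K ->
  joins (fun z => slope E z <= K%:E)%E s p (S p s) ((expR L * (4 * G)) ^+ 2 * s).
Proof.
move=> G0 pG s0 s1 hK.
have L0 : 0 <= L by exact: normr_ge0.
have G40 : 0 <= 4 * G by rewrite mulr_ge0.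
rewrite -{1}(semigroup0 S0 p); apply: joins_lipschitz.
- by rewrite mulr_ge0// expR_ge0.
- move=> u v u0 uv vs; rewrite metric_sym.
  have vu0 : 0 <= v - u by rewrite subr_ge0.
  have := semigroup_lipschitz E_proper E_lsc E_dom flows G0 pG u0 vu0.
  rewrite (addrC u) subrK => /le_trans; apply.
  rewrite ler_wpM2r// ler_wpM2r// ler_expR.
  by rewrite -[leRHS]mulr1 ler_wpM2l// (le_trans vs).
- move=> t; rewrite le_eqVlt => /predU1P[<-|t0] ts.
    rewrite semigroup0; apply: le_trans (ltW pG) _; rewrite lee_fin; apply: le_trans hK.
    have : 1 <= expR (L * 2) by rewrite -expR0 ler_expR mulr_ge0.
    by move=> /(ler_wpM2r G40); rewrite mul1r; apply: le_trans; rewrite ler_peMl// ler1n.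
  apply: le_trans (semigroup_slope E_proper E_lsc E_dom flows G0 pG t0) _.
  rewrite lee_fin; apply: le_trans hK; rewrite ler_wpM2r// ler_expR ler_wpM2l//.
  by have := le_trans ts s1; lra.
Qed.

(** The flow from p1 for time s, the image under S_s of the given curve,
rescaled to duration T', and the flow from p2 backwards. *)
Lemma joins_regularized p1 p2 G w rho T T' A s : 0 <= G ->
  (slope E p1 < G%:E)%E -> (slope E p2 < G%:E)%E -> 0 < T -> 0 < T' -> 0 < s -> s <= 1 ->
  joins (fun z => mdist z w <= rho) T p1 p2 A ->
  exists2 K, 0 <= K & joins (fun z => slope E z <= K%:E)%E (s + T' + s) p1 p2
    ((expR L * (4 * G)) ^+ 2 * s + T / T' * (expR (L * s) ^+ 2 * A)
     + (expR L * (4 * G)) ^+ 2 * s).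
Proof.
move=> G0 h1 h2 T0 T'0 s0 s1 hj.
have [K1 K10 hK1] := semigroup_slope_bounded E_proper E_lsc E_dom flows E_bounded_below w rho s0.
set K := Num.max K1 (expR (L * 2) * (4 * G)).
have K1K : K1 <= K by rewrite le_max lexx.
have K2K : expR (L * 2) * (4 * G) <= K by rewrite le_max lexx orbT.
exists K; first exact: le_trans K1K.
have hmid : joins (fun z => slope E z <= K%:E)%E T (S p1 s) (S p2 s) (expR (L * s) ^+ 2 * A).
  apply: (joins_image (P := fun z => mdist z w <= rho) (Phi := fun p => S p s)) hj.
  - exact: expR_ge0.
  - by move=> p q; exact: (semigroup_contraction E_proper E_lsc E_dom flows p q (ltW s0)).
  - by move=> p hp; apply: le_trans (hK1 p hp) _; rewrite lee_fin.
apply: joins_cat; [by rewrite addr_ge0// ltW|exact: ltW| |].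
  apply: joins_cat; [exact: ltW|exact: ltW|exact: (joins_flow G0 h1)|exact: joins_rescale hmid].
by apply: joins_rev; exact: joins_flow.
Qed.

(** Let s tend to 0 in [joins_regularized]; the bound K on the slope may blow
up, the energy does not. *)
Lemma joins_slope_bounded p1 p2 G w rho T T' A B : 0 <= G ->
  (slope E p1 < G%:E)%E -> (slope E p2 < G%:E)%E -> 0 < T -> 0 < T' ->
  joins (fun z => mdist z w <= rho) T p1 p2 A -> T / T' * A < B ->
  exists2 K, 0 <= K & joins (fun z => slope E z <= K%:E)%E T' p1 p2 B.
Proof.
move=> G0 h1 h2 T0 T'0 hj AB.
pose C := (expR L * (4 * G)) ^+ 2.
pose f s := C * s + T / (T' - s - s) * (expR (L * s) ^+ 2 * A) + C * s.
have f0 : f 0 = T / T' * A by rewrite /f !mulr0 !subr0 expR0 expr1n mul1r add0r addr0.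
have cf : f s @[s --> 0] --> f 0.
  apply: cvgD; last by apply: cvgM; [exact: cvg_cst|exact: cvg_id].
  apply: cvgD; first by apply: cvgM; [exact: cvg_cst|exact: cvg_id].
  apply: cvgM.
    apply: cvgM; first exact: cvg_cst.
    apply: cvgV; first by rewrite !subr0 gt_eqF.
    by apply: cvgB; [apply: cvgB; [exact: cvg_cst|exact: cvg_id]|exact: cvg_id].
  apply: cvgM; last exact: cvg_cst.
  apply: (@continuous_comp _ _ _ (fun s => expR (L * s)) (fun r => r ^+ 2)); last exact: exprn_continuous.
  by apply: (@continuous_comp _ _ _ (fun s => L * s) expR); [exact: mulrl_continuous|exact: continuous_expR].
have fB : f 0 < B by rewrite f0.
have : \forall s \near 0, f s < B by exact: (cvgr_lt _ cf).
move=> /nbhs_ballP[d /= d0 hd].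
pose s := Num.min (d / 2) (Num.min 1 (T' / 4)).
have s0 : 0 < s by rewrite !lt_min divr_gt0//= ltr01 divr_gt0.
have s1 : s <= 1 by rewrite !ge_min lexx orbT.
have sT : s <= T' / 4 by rewrite !ge_min lexx !orbT.
have sd : s <= d / 2 by rewrite ge_min lexx.
have fs : f s < B.
  by apply: hd; rewrite /ball/= sub0r normrN gtr0_norm//; lra.
have T'' : 0 < T' - s - s by lra.
have [K K0 hK] := joins_regularized G0 h1 h2 T0 T'' s0 s1 hj.
exists K => //; move: hK; rewrite (_ : s + (T' - s - s) + s = T'); last by ring.
by apply: joins_sub => //; exact: ltW.
Qed.

Variable conv : (nat -> X) -> X -> Prop.
Hypothesis hconv : sigma_conv E conv.

Lemma energy_mod_near (gamma : R -> X) V t w : energy_mod gamma V ->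
  0 <= t -> t <= 1 -> w = gamma 0 -> mdist (gamma t) w <= V 1 - V 0 + 1.
Proof.
move=> em t0 t1 ->; rewrite metric_sym.
have h := em 0 t (lexx 0) t0 t1.
have m1 := path_mod_mono em (lexx 0) t0 t1.
have m2 := path_mod_mono em t0 t1 (lexx 1).
have V0 : 0 <= V 1 - V 0 by rewrite subr_ge0 (le_trans m1).
rewrite -ler_sqr ?nnegrE ?mdist_ge0 ?(addr_ge0 V0)//.
apply: le_trans h _; apply: (@le_trans _ _ (V 1 - V 0)).
  rewrite subr0; apply: le_trans (_ : 1 * (V t - V 0) <= _).
    by rewrite ler_wpM2r// subr_ge0.
  by rewrite mul1r lerD2r.
rewrite sqrrD expr1n mulr1 mulr2n; have := sqr_ge0 (V 1 - V 0); lra.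
Qed.

Lemma fisher_lty_integral eta : (fisher E eta < +oo)%E ->
  (\int[mu]_(t in `[0%R, 1%R]) (slope E (eta t) ^+ 2) < +oo)%E.
Proof.
move=> feta; rewrite ltey; apply/eqP => hoo; move: feta.
by rewrite /fisher hoo gt0_muley ?ltxx// lte_fin.
Qed.

Lemma slope_finite_witness eta Veta (a b : R) : energy_mod eta Veta ->
  (fisher E eta < +oo)%E -> 0 <= a -> a < b -> b <= 1 ->
  exists2 t, a < t < b & (slope E (eta t) < +oo)%E.
Proof.
move=> em feta a0 ab b1; have I0 := fisher_lty_integral feta.
have mS : measurable_fun (`[0, 1]%classic : set R) (fun t => slope E (eta t) ^+ 2)%E.
  exact: (measurable_slope_sqr hconv (energy_mod_ucont em)).
have int : mu.-integrable `[0, 1] (fun t => slope E (eta t) ^+ 2)%E.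
  apply/integrableP; split => //.
  apply: le_lt_trans I0; rewrite le_eqVlt; apply/orP; left; apply/eqP.
  by apply: eq_integral => t _; rewrite gee0_abs// mule_ge0// (slope_ge0 E).
have ae := @integrable_ae _ _ _ mu _ (measurable_itv _) _ int.
have [t /andP[at_ tb] ht] := ae_witness ab ae; exists t; first by rewrite at_.
have : `[0, 1]%classic t by rewrite /= in_itv/= (le_trans a0 (ltW at_)) (le_trans (ltW tb) b1).
move=> /ht; rewrite ltey => /=; apply: contraL => /eqP ->.
by rewrite mulyy.
Qed.

(** Bounds the total energy in [recovery], with r measuring the size and energy
of the two pieces of eta. *)
Lemma small_radius (D d : R) : 0 <= D -> 0 < d ->
  exists2 r : R, 0 < r < 2^-1 & r + (1 + r) / (1 - r) * (D + r) < D + d.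
Proof.
move=> D0 d0; pose f (r : R) := r + (1 + r) / (1 - r) * (D + r).
have f0 : f 0 = D by rewrite /f !addr0 subr0 divr1 mul1r add0r.
have cf : f s @[s --> 0] --> f 0.
  apply: cvgD; first exact: cvg_id.
  apply: cvgM; last by apply: cvgD; [exact: cvg_cst|exact: cvg_id].
  apply: cvgM; first by apply: cvgD; [exact: cvg_cst|exact: cvg_id].
  apply: cvgV; first by rewrite subr0 oner_eq0.
  by apply: cvgB; [exact: cvg_cst|exact: cvg_id].
have fB : f 0 < D + d by rewrite f0 ltrDl.
have : \forall s \near 0, f s < D + d by exact: (cvgr_lt _ cf).
move=> /nbhs_ballP[e /= e0 he].
exists (Num.min (e / 2) (1 / 4)).
  rewrite lt_min divr_gt0//= divr_gt0//= gt_min; apply/orP; right; lra.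
apply: he; rewrite /ball/= sub0r normrN gtr0_norm ?lt_min ?divr_gt0//.
by rewrite gt_min; apply/orP; left; lra.
Qed.

(** The integrand is at most slope(eta)^2 + K^2. *)
Lemma fisher_dominated eta zeta K Veta Vzeta : energy_mod eta Veta -> energy_mod zeta Vzeta ->
  (fisher E eta < +oo)%E -> 0 <= K ->
  (forall t, 0 <= t -> t <= 1 -> (slope E (zeta t) <= slope E (eta t))%E \/
    (slope E (zeta t) <= K%:E)%E) -> (fisher E zeta < +oo)%E.
Proof.
move=> em em' feta K0 h.
have S0' p : (0 <= slope E p ^+ 2)%E by apply: mule_ge0; exact: (slope_ge0 E).
have mS (f : R -> X) F : energy_mod f F ->
    measurable_fun (`[0, 1]%classic : set R) (fun t => slope E (f t) ^+ 2)%E.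
  by move=> /energy_mod_ucont; exact: (measurable_slope_sqr hconv).
have mc : measurable_fun (`[0, 1]%classic : set R) (cst ((K ^+ 2)%:E : \bar R)) by [].
have hP t : 0 <= t <= 1 ->
    (slope E (zeta t) ^+ 2 <= slope E (eta t) ^+ 2 + (K ^+ 2)%:E)%E.
  move=> /andP[t0 t1]; have h1 := S0' (eta t).
  have h2 : (0 <= (K ^+ 2)%:E)%E by rewrite lee_fin sqr_ge0.
  have [ht|ht] := h t t0 t1.
    apply: (@le_trans _ _ (slope E (eta t) ^+ 2)%E); last by rewrite leeDl.
    by rewrite lee_sqr ?(slope_ge0 E).
  apply: (@le_trans _ _ (K ^+ 2)%:E); last by rewrite leeDr.
  by rewrite EFin_expe lee_sqr ?(slope_ge0 E) ?lee_fin.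
have hI : (\int[mu]_(t in `[0%R, 1%R]) (slope E (zeta t) ^+ 2) <=
    \int[mu]_(t in `[0%R, 1%R]) (slope E (eta t) ^+ 2 + (K ^+ 2)%:E))%E.
  apply: ge0_le_integral => //; first exact: mS em'.
    by apply: emeasurable_funD => //; exact: mS em.
have hD : (\int[mu]_(t in `[0%R, 1%R]) (slope E (eta t) ^+ 2 + (K ^+ 2)%:E) =
    \int[mu]_(t in `[0%R, 1%R]) (slope E (eta t) ^+ 2) +
    \int[mu]_(t in `[0%R, 1%R]) (cst (K ^+ 2)%:E t))%E.
  apply: (@ge0_integralD _ _ _ mu) => //; first exact: mS em.
  by move=> t _; rewrite lee_fin sqr_ge0.
have hc : (\int[mu]_(t in `[0%R, 1%R]) (cst (K ^+ 2)%:E t) < +oo)%E.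
  rewrite integral_cst//= lebesgue_measure_itv/= lte_fin ltr01 -EFinB -EFinM; exact: ltry.
have I0 := fisher_lty_integral feta.
have I1 : (\int[mu]_(t in `[0%R, 1%R]) (slope E (zeta t) ^+ 2) < +oo)%E.
  by apply: le_lt_trans hI _; rewrite hD lte_add_pinfty.
by rewrite /fisher lte_mul_pinfty.
Qed.

(** The curve is eta on [0, t1] and [t2, 1], close to the end points of [0, 1],
and in between the curve of [joins_slope_bounded] obtained from eta backwards to x,
gamma, and eta backwards from y. *)
Lemma recovery eta Veta gamma V x y delta :
  energy_mod eta Veta -> eta 0 = x -> eta 1 = y ->
  (forall e : R, 0 < e -> exists2 d : R, 0 < d &
    forall s t, 0 <= s -> s <= t -> t <= 1 -> t - s < d -> Veta t - Veta s <= e) ->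
  (fisher E eta < +oo)%E ->
  energy_mod gamma V -> gamma 0 = x -> gamma 1 = y -> 0 < delta ->
  exists b, attainable E x y (2^-1 * (V 1 - V 0) + delta) b.
Proof.
move=> em eta0 eta1 ucV feta emg gamma0 gamma1 delta0.
set D := V 1 - V 0.
have D0 : 0 <= D by rewrite subr_ge0 (path_mod_mono emg).
have d20 : 0 < 2 * delta by rewrite mulr_gt0.
have [r /andP[r0 r12] hr] := small_radius D0 d20.
have r20 : 0 < r / 2 by rewrite divr_gt0.
have [d d0 hd] := ucV _ r20.
(* Within distance m of the ends, eta has energy at most r / 2. *)
pose m := Num.min (d / 2) (r / 2).
have m0 : 0 < m by rewrite lt_min r20 divr_gt0.
have md : m < d by rewrite gt_min; apply/orP; left; lra.
have mr : m <= r / 2 by rewrite ge_min lexx orbT.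
have [t1 /andP[t10 t1m] s1] := slope_finite_witness em feta (lexx 0) m0 ltac:(lra).
have [m10 m11] : 0 <= 1 - m /\ 1 - m < 1 by split; lra.
have [t2 /andP[t2m t21] s2] := slope_finite_witness em feta m10 m11 (lexx 1).
have [t12 t1r t2r] : [/\ t1 < t2, t1 <= r / 2 & 1 - t2 <= r / 2] by split; lra.
have [t1d t2d] : t1 - 0 < d /\ 1 - t2 < d by split; lra.
have [G [G0 G1 G2]] : exists G : R, [/\ 0 <= G, (slope E (eta t1) < G%:E)%E &
    (slope E (eta t2) < G%:E)%E].
  have [g1 [h1 _]] := ereal_between s1; have [g2 [h2 _]] := ereal_between s2.
  have g10 : 0 < g1 by rewrite -lte_fin (le_lt_trans (slope_ge0 E _) h1).
  exists (Num.max g1 g2); split; first by rewrite le_max (ltW g10).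
    by apply: lt_le_trans h1 _; rewrite lee_fin le_max lexx.
  by apply: lt_le_trans h2 _; rewrite lee_fin le_max lexx orbT.
set rho := Num.max (Veta 1 - Veta 0 + 1) (V 1 - V 0 + 1).
pose P z := mdist z x <= rho.
have Peta t : 0 <= t -> t <= 1 -> P (eta t).
  by move=> h0 h1; rewrite /P le_max (energy_mod_near em h0 h1)// eta0.
have Pgam t : 0 <= t -> t <= 1 -> P (gamma t).
  by move=> h0 h1; rewrite /P le_max (energy_mod_near emg h0 h1) ?gamma0 ?orbT.
have t11 : t1 <= 1 by exact: ltW (lt_trans t12 t21).
have t20 : 0 <= t2 by exact: ltW (lt_trans t10 t12).
have em1 : path_mod 0 t1 eta Veta.
  by move=> s t hs st tt; apply: em => //; exact: le_trans tt t11.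
have em2 : path_mod t2 1 eta Veta.
  by move=> s t hs st tt; apply: em => //; exact: le_trans hs.
have j1 : joins P (t1 - 0) (eta t1) x (Veta t1 - Veta 0).
  rewrite -eta0; apply/joins_rev/path_mod_joins => //; first exact: ltW.
  by move=> t h0 h1; apply: Peta => //; exact: le_trans h1 t11.
have j2 : joins P (1 - 0) x y D.
  by rewrite -gamma0 -gamma1; exact: path_mod_joins.
have j3 : joins P (1 - t2) y (eta t2) (Veta 1 - Veta t2).
  rewrite -eta1; apply/joins_rev/path_mod_joins => //; first exact: ltW.
  by move=> t h0 h1; apply: Peta => //; exact: le_trans h0.
rewrite !subr0 in j1 j2.
have D1 : Veta t1 - Veta 0 <= r / 2 by apply: hd => //; exact: ltW.
have D2 : Veta 1 - Veta t2 <= r / 2 by apply: hd => //; exact: ltW.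
have D1' := path_mod_mono em (lexx 0) (ltW t10) t11.
have D2' := path_mod_mono em t20 (ltW t21) (lexx 1).
have j : joins P (t1 + 1 + (1 - t2)) (eta t1) (eta t2)
    (Veta t1 - Veta 0 + D + (Veta 1 - Veta t2)).
  apply: joins_cat j3; [by rewrite addr_ge0// ltW|by rewrite subr_ge0 ltW|].
  by apply: joins_cat j2 => //; exact: ltW.
have [T0 T'0 AB] := recovery_arith r0 r12 hr (ltW t10) t1r t2r (ltW t21) D1' D1 D2' D2 D0.
have [K K0 [g [U [pm g0 g1 hU hg]]]] := joins_slope_bounded G0 G1 G2 T0 T'0 j AB.
have pm' : path_mod t1 t2 (fun t => g (1 * t - t1)) (fun t => 1 * U (1 * t - t1)).
  by apply: path_mod_affine pm => //; rewrite mul1r// subrr.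
have e1 : eta t1 = g (1 * t1 - t1) by rewrite mul1r subrr g0.
have c1 := path_mod_cat (ltW t10) (ltW t12) em1 pm' e1.
set g' := (fun t => if t <= t1 then _ else _) in c1.
set U' := (fun t => if t <= t1 then _ else _) in c1.
have e2 : g' t2 = eta t2 by rewrite /g' leNgt t12/= mul1r g1.
have c2 := path_mod_cat t20 (ltW t21) c1 em2 e2.
set zeta := (fun t => if t <= t2 then _ else _) in c2.
set W := (fun t => if t <= t2 then _ else _) in c2.
have emz : energy_mod zeta W by [].
have fz : (fisher E zeta < +oo)%E.
  apply: (fisher_dominated em emz feta K0) => t h0 h1; rewrite /zeta.
  case: (leP t t2) => ht2; last by left.
  rewrite /g'; case: (leP t t1) => ht1; first by left.
  by right; apply: hg; rewrite mul1r ?subr_ge0 ?lerD2r// ltW.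
have F0 : (0 <= fisher E zeta)%E.
  rewrite /fisher mule_ge0//; apply: integral_ge0 => t _.
  by rewrite mule_ge0// (slope_ge0 E).
exists (fine (fisher E zeta)), zeta, W; split => //.
- by rewrite /zeta t20 /g' (ltW t10).
- by rewrite /zeta leNgt t21.
- rewrite /W (leNgt 1) t21/= t20 /U' (ltW t10) (leNgt t2) t12/= !mul1r subrr.
  exact: recovery_energy_arith D1 D2 hU.
- by rewrite fineK// ge0_fin_numE.
Qed.

End Recovery.

(** * Lower envelopes of affine functions *)

Lemma optimal_limit_arith (R : realType) (a b a' b' t tau e M a1 b1 : R) :
  0 <= b1 -> 0 <= b -> b <= M -> 0 < tau -> a' - e <= a -> b' - e <= b ->
  tau - e <= t -> t <= tau + e -> a + t * b <= a1 + t * b1 + e ->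
  a' + tau * b' <= a1 + tau * b1 + e * (b1 + 2 + M + tau).
Proof.
move=> b10 b0 bM tau0 h1 h2 h3 h4 h5.
have e0 : 0 <= e by lra.
have h6 : tau * (b' - e) <= tau * b by rewrite ler_wpM2l// ltW.
have h7 : (tau - t) * b <= e * M.
  by apply: le_trans (_ : e * b <= _); [rewrite ler_wpM2r//; lra|rewrite ler_wpM2l].
have h8 : (t - tau) * b1 <= e * b1 by rewrite ler_wpM2r//; lra.
move: h6 h7 h8; rewrite !mulrBl !mulrBr !mulrDr; lra.
Qed.

Section Envelope.
Context {R : realType}.
Variable K : R -> R -> Prop.
Hypothesis K_ge0 : forall a b, K a b -> 0 <= a /\ 0 <= b.
Hypothesis K_up : forall a b a' b' : R, K a b -> a <= a' -> b <= b' -> K a' b'.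
Hypothesis K_closed : forall a b : R, (forall e : R, 0 < e -> K (a + e) (b + e)) -> K a b.
Hypothesis K_nonempty : exists a b, K a b.

Definition envelope (tau : R) := inf [set c | exists a b, K a b /\ c = a + tau * b].

Lemma envelope_le (tau a b : R) : 0 <= tau -> K a b -> envelope tau <= a + tau * b.
Proof.
move=> tau0 kab; apply: ge_inf; last by exists a, b.
exists 0 => _ [a' [b' [k ->]]]; have [a0 b0] := K_ge0 k.
by rewrite addr_ge0// mulr_ge0.
Qed.

Lemma envelope_ge (tau m : R) : (forall a b, K a b -> m <= a + tau * b) -> m <= envelope tau.
Proof.
move=> h; have [a [b kab]] := K_nonempty; apply: lb_le_inf.
  by exists (a + tau * b), a, b.
by move=> _ [a' [b' [k ->]]]; exact: h.
Qed.

Lemma envelope_approx (tau e : R) : 0 < e -> exists a b, K a b /\ a + tau * b <= envelope tau + e.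
Proof.
move=> e0; apply: contrapT => h; have : envelope tau + e <= envelope tau.
  apply: envelope_ge => a b k; rewrite leNgt; apply/negP => hk; apply: h.
  by exists a, b; split => //; exact: ltW.
by rewrite gerDl leNgt e0.
Qed.

Definition optimal (tau a b : R) := K a b /\ a + tau * b = envelope tau.

(** Almost optimal pairs at parameters converging to tau are bounded, because
tau > 0 controls b. Extract a cluster point (a', b'); since K is closed upward, K
contains (a' + e, b' + e) for all e > 0, and closedness gives (a', b'). *)
Lemma optimal_limit (tau : R) (t a b : nat -> R) : 0 < tau ->
  (forall n, tau / 2 <= t n) -> (forall n, `|t n - tau| <= n.+1%:R^-1) ->
  (forall n, K (a n) (b n) /\ a n + t n * b n <= envelope (t n) + n.+1%:R^-1) ->
  exists a' b', optimal tau a' b' /\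
    forall (e : R) N, 0 < e -> exists2 n, (N <= n)%N & `|b n - b'| <= e.
Proof.
move=> tau0 th tn kn.
have [a0 [b0 k0]] := K_nonempty; have [a00 b00] := K_ge0 k0.
have i1 n : (n.+1%:R^-1 : R) <= 1 by rewrite invf_le1// ler1n.
pose M := a0 + (tau + 1) * b0 + 1.
have M0 : 0 <= M by rewrite !addr_ge0// mulr_ge0// addr_ge0// ltW.
have t0 n : 0 < t n by apply: lt_le_trans (th n); rewrite divr_gt0.
have tM n : t n <= tau + 1.
  by rewrite -lerBlDl; apply: le_trans (ler_norm _) (le_trans (tn n) (i1 n)).
have sM n : a n + t n * b n <= M.
  apply: le_trans (kn n).2 _; rewrite lerD//.
  by apply: le_trans (envelope_le (ltW (t0 n)) k0) _; rewrite lerD2l ler_wpM2r.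
have aM n : 0 <= a n <= M.
  have [a1 b1] := K_ge0 (kn n).1; rewrite a1; apply: le_trans (sM n).
  by rewrite lerDl mulr_ge0// ltW.
pose M' := M / (tau / 2).
have bM n : 0 <= b n <= M'.
  have [a1 b1] := K_ge0 (kn n).1; rewrite b1 /M' ler_pdivlMr ?divr_gt0// mulrC.
  apply: le_trans (sM n); apply: le_trans (ler_wpM2r b1 (th n)) _.
  by rewrite lerDr.
have [a' [ha1 ha2]] := bounded_liminf aM.
have /choice[f hf] (k : nat) : exists n, (k <= n)%N /\ `|a n - a'| <= k.+1%:R^-1.
  have e0 : 0 < (k.+1%:R^-1 : R) by rewrite invr_gt0.
  have [N hN] := ha1 _ e0; have [n nN hn] := ha2 _ (maxn N k) e0.
  exists n; split; first exact: leq_trans (leq_maxr _ _) nN.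
  rewrite ler_distl hn andbT; apply: hN; exact: leq_trans (leq_maxl _ _) nN.
have [b' [hb1 hb2]] := bounded_liminf (fun k => bM (f k)).
have cl (e : R) N : 0 < e -> exists n, [/\ (N <= n)%N, `|a n - a'| <= e,
    `|b n - b'| <= e & n.+1%:R^-1 <= e].
  move=> e0; have [k0' _ hk] := near_infty_natSinv_lt (PosNum e0).
  have [N1 hN1] := hb1 e e0.
  have [k kN hbk] := hb2 e (maxn N1 (maxn N k0')) e0.
  have kN1 : (N1 <= k)%N by apply: leq_trans kN; exact: leq_maxl.
  have kN2 : (maxn N k0' <= k)%N by apply: leq_trans kN; exact: leq_maxr.
  have kN3 : (N <= k)%N by apply: leq_trans kN2; exact: leq_maxl.
  have kN4 : (k0' <= k)%N by apply: leq_trans kN2; exact: leq_maxr.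
  have [h1 h2] := hf k; exists (f k); split.
  - exact: leq_trans kN3 h1.
  - by apply: le_trans h2 _; exact/ltW/(hk k kN4).
  - by rewrite ler_distl hbk andbT hN1.
  - by apply/ltW/(hk (f k)) => /=; exact: leq_trans kN4 h1.
have kab : K a' b'.
  apply: K_closed => e e0; have [n [_ h1 h2 _]] := cl e 0%N e0.
  move: h1 h2; rewrite !ler_distl => /andP[_ h1] /andP[_ h2].
  exact: K_up (kn n).1 h1 h2.
exists a', b'; split; last by move=> e N e0; have [n []] := cl e N e0; exists n.
split => //; apply/eqP; rewrite eq_le (envelope_le (ltW tau0) kab) andbT.
apply: envelope_ge => a1 b1 k1; have [a10 b10] := K_ge0 k1.
have M'0 : 0 <= M' by have /andP[] := bM 0%N; exact: le_trans.
apply/ler_addgt0Pr => /= d d0; pose C := b1 + 2 + M' + tau.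
have C0 : 0 < C by rewrite /C; lra.
have e0 : 0 < d / C by rewrite divr_gt0.
have eC : d / C * C = d by rewrite divfK// gt_eqF.
move: e0 eC; set e := d / C => e0 eC.
have [n [_ h1 h2 h3]] := cl e 0%N e0.
have h4 := le_trans (tn n) h3.
have h5 := le_trans (kn n).2 (lerD (envelope_le (ltW (t0 n)) k1) h3).
have /andP[bn0 bnM] := bM n.
move: h1 h2 h4; rewrite !ler_distl => /andP[h1 _] /andP[h2 _] /andP[h4 h4'].
by rewrite -eC; exact: optimal_limit_arith b10 bn0 bnM tau0 h1 h2 h4 h4' h5.
Qed.

Lemma optimal_ex tau : 0 < tau -> exists a b, optimal tau a b.
Proof.
move=> tau0; have /choice[ab hab] (n : nat) : exists ab : R * R,
    K ab.1 ab.2 /\ ab.1 + tau * ab.2 <= envelope tau + n.+1%:R^-1.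
  have [|a [b [k h]]] := @envelope_approx tau n.+1%:R^-1; first by rewrite invr_gt0.
  by exists (a, b).
have [n|n|n|a [b [h _]]] :=
  @optimal_limit tau (fun=> tau) (fun n => (ab n).1) (fun n => (ab n).2) tau0.
- by rewrite ler_pdivrMr// ler_peMr ?ler1n// ltW.
- by rewrite subrr normr0 invr_ge0.
- exact: hab.
- by exists a, b.
Qed.

(** Test the pair optimal at one parameter at the other parameter. *)
Lemma optimal_le tau t a b a' b' : 0 <= t -> t <= tau -> optimal t a b -> optimal tau a' b' ->
  (tau - t) * b' <= envelope tau - envelope t <= (tau - t) * b.
Proof.
move=> t0 ttau [k1 e1] [k2 e2].
have := envelope_le t0 k2; have := envelope_le (le_trans t0 ttau) k1.
by rewrite -e1 -e2 !mulrBl => h1 h2; apply/andP; split; lra.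
Qed.

Lemma optimal_antitone tau t a b a' b' : 0 <= t -> t < tau ->
  optimal t a b -> optimal tau a' b' -> b' <= b.
Proof.
move=> t0 ttau h1 h2; have /andP[h3 h4] := optimal_le t0 (ltW ttau) h1 h2.
by have := le_trans h3 h4; rewrite ler_pM2l// subr_gt0.
Qed.

(** The rates at which the optimal affine functions grow. *)
Definition optimal_rates tau := [set b | exists a, optimal tau a b].
Definition min_rate tau := inf (optimal_rates tau).
Definition max_rate tau := sup (optimal_rates tau).

Lemma optimal_rates_nonempty tau : 0 < tau -> optimal_rates tau !=set0.
Proof. by move=> /optimal_ex[a [b h]]; exists b, a. Qed.

Lemma optimal_rates_bound tau b : 0 < tau -> optimal_rates tau b -> 0 <= b <= envelope tau / tau.
Proof.
move=> tau0 [a [k e]]; have [a0 b0] := K_ge0 k.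
by rewrite b0 ler_pdivlMr// -e mulrC lerDr.
Qed.

(** A limit of optimal pairs is optimal, so extremal rates are attained. *)
Lemma optimal_rates_limit tau (c : R) : 0 < tau ->
  (forall e : R, 0 < e -> exists2 b, optimal_rates tau b & `|b - c| <= e) -> optimal_rates tau c.
Proof.
move=> tau0 hc.
have /choice[ab hab] (n : nat) : exists ab : R * R,
    optimal tau ab.1 ab.2 /\ `|ab.2 - c| <= n.+1%:R^-1.
  have [|b [a h] hb] := hc n.+1%:R^-1; first by rewrite invr_gt0.
  by exists (a, b).
have [n|n|n|a [b [h hb]]] :=
  @optimal_limit tau (fun=> tau) (fun n => (ab n).1) (fun n => (ab n).2) tau0.
- by rewrite ler_pdivrMr// ler_peMr ?ler1n// ltW.
- by rewrite subrr normr0 invr_ge0.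
- by have [[k ->] _] := hab n; split => //; rewrite lerDl invr_ge0.
suff -> : c = b by exists a.
apply/eqP; rewrite -subr_eq0 -normr_le0; apply/ler_addgt0Pr => /= e e0; rewrite add0r.
have e20 : 0 < e / 2 by rewrite divr_gt0.
have [k _ hk] := near_infty_natSinv_lt (PosNum e20).
have [n kn bn] := hb (e / 2) k e20.
have h1 := le_trans (hab n).2 (ltW (hk n kn)).
rewrite (_ : c - b = (c - (ab n).2) + ((ab n).2 - b)); last by ring.
rewrite [leRHS](splitr e); apply: le_trans (ler_normD _ _) _.
by rewrite lerD// distrC.
Qed.

Lemma min_rate_optimal tau : 0 < tau -> optimal_rates tau (min_rate tau).
Proof.
move=> tau0; apply: optimal_rates_limit => // e e0.
have hl : has_inf (optimal_rates tau).
  split; first exact: optimal_rates_nonempty.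
  by exists 0 => b /(optimal_rates_bound tau0)/andP[].
have [b hb be] := inf_adherent e0 hl; exists b => //.
have := ge_inf hl.2 hb; rewrite -/(min_rate tau) => mb.
by rewrite ger0_norm ?subr_ge0// lerBlDl ltW.
Qed.

Lemma min_rate_le tau b : 0 < tau -> optimal_rates tau b -> min_rate tau <= b.
Proof.
by move=> tau0; apply: ge_inf; exists 0 => b' /(optimal_rates_bound tau0)/andP[].
Qed.

Lemma max_rate_optimal tau : 0 < tau -> optimal_rates tau (max_rate tau).
Proof.
move=> tau0; apply: optimal_rates_limit => // e e0.
have hl : has_sup (optimal_rates tau).
  split; first exact: optimal_rates_nonempty.
  by exists (envelope tau / tau) => b /(optimal_rates_bound tau0)/andP[].
have [b hb be] := sup_adherent e0 hl; exists b => //.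
have := ub_le_sup hl.2 hb; rewrite -/(max_rate tau) => mb.
by rewrite distrC ger0_norm ?subr_ge0// lerBlDl -lerBlDr ltW.
Qed.

Lemma max_rate_ge tau b : 0 < tau -> optimal_rates tau b -> b <= max_rate tau.
Proof.
by move=> tau0; apply: ub_le_sup; exists (envelope tau / tau) => b' /(optimal_rates_bound tau0)/andP[].
Qed.

(** A cluster point of optimal rates at parameters tending to tau is an optimal
rate at tau. *)
Lemma optimal_rates_near tau e : 0 < tau -> 0 < e -> exists2 d, 0 < d &
  forall t b, `|t - tau| < d -> optimal_rates t b -> min_rate tau - e <= b <= max_rate tau + e.
Proof.
move=> tau0 e0; apply: contrapT => hN.
have /choice[tab htab] (n : nat) : exists tab : R * R * R,
    [/\ `|tab.1.1 - tau| < n.+1%:R^-1, `|tab.1.1 - tau| < tau / 2,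
      optimal tab.1.1 tab.1.2 tab.2 & ~ (min_rate tau - e <= tab.2 <= max_rate tau + e)].
  apply: contrapT => h; apply: hN; exists (Num.min n.+1%:R^-1 (tau / 2)).
    by rewrite lt_min invr_gt0 ltr0n divr_gt0.
  move=> t b; rewrite lt_min => /andP[h1 h2] [a hab]; apply: contrapT => h3.
  by apply: h; exists (t, a, b).
have [n|n|n|a [b [h hb]]] := @optimal_limit tau (fun n => (tab n).1.1)
  (fun n => (tab n).1.2) (fun n => (tab n).2) tau0.
- by have [_ + _ _] := htab n; rewrite ltr_distl => /andP[+ _]; lra.
- by have [h _ _ _] := htab n; exact: ltW.
- by have [_ _ [k ->] _] := htab n; split => //; rewrite lerDl invr_ge0.
have [n _ hn] := hb e 0%N e0; have [_ _ _] := htab n; apply.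
have b1 : min_rate tau <= b by apply: min_rate_le => //; exists a.
have b2 : b <= max_rate tau by apply: max_rate_ge => //; exists a.
by move: hn; rewrite ler_distl => /andP[h1 h2]; apply/andP; split; lra.
Qed.

End Envelope.

(** * One-sided derivatives of the envelope *)

Lemma sqr_near (R : realType) (eps d : R) : 0 < eps -> 0 < d ->
  exists2 r : R, 0 < r /\ r <= eps &
    forall h, `|h| < r -> `|(eps + h) ^+ 2 - eps ^+ 2| < d.
Proof.
move=> e0 d0; exists (Num.min eps (d / (3 * eps))).
  by rewrite lt_min e0 divr_gt0 ?mulr_gt0//= ge_min lexx.
move=> h; rewrite lt_min ltr_pdivlMr ?mulr_gt0// => /andP[h1 h2].
rewrite (_ : _ - _ = h * (2 * eps + h)); last by ring.
rewrite normrM; apply: le_lt_trans h2; rewrite ler_wpM2l//.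
apply: le_trans (ler_normD _ _) _; rewrite ger0_norm; last by rewrite mulr_ge0// ltW.
by move: (ltW h1); lra.
Qed.

(** The increment of the envelope is h w x with h w the increment of eps^2 and x
between two rates; both w - 2 eps and x - m are small. *)
Lemma quot_arith (R : realType) (eps h w m e x D : R) : 0 < eps -> 0 < h -> 0 <= w ->
  w <= 3 * eps -> `|w - 2 * eps| <= h -> 0 <= m -> 0 < e -> h * (m + 1) <= e / 2 ->
  `|x - m| <= e / (6 * eps) -> `|D - h * w * m| <= h * w * `|x - m| ->
  `|D - 2 * eps * m * h| <= e * h.
Proof.
move=> e0 h0 w0 w3 w2 m0 et0 hm hx hD.
have h4 : w * (e / (6 * eps)) <= e / 2.
  rewrite mulrA ler_pdivrMr ?mulr_gt0//.
  have : w * e <= 3 * eps * e by rewrite ler_wpM2r// ltW.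
  lra.
rewrite (_ : _ - _ = (D - h * w * m) + h * (m * (w - 2 * eps))); last by ring.
apply: le_trans (ler_normD _ _) _.
rewrite [leRHS](_ : _ = h * (e / 2) + h * (e / 2)); last by field.
apply: lerD.
  apply: le_trans hD _; rewrite -mulrA ler_wpM2l ?(ltW h0)//.
  by apply: le_trans h4; rewrite ler_wpM2l.
rewrite !normrM (gtr0_norm h0) (ger0_norm m0) ler_wpM2l ?(ltW h0)//.
apply: le_trans hm; apply: le_trans (_ : m * h <= _); first by rewrite ler_wpM2l.
by rewrite mulrC ler_wpM2l ?lerDl// ltW.
Qed.

Lemma dist_between (R : realType) (k D x m : R) : 0 <= k ->
  (k * x <= D <= k * m) || (k * m <= D <= k * x) -> `|D - k * m| <= k * `|x - m|.
Proof.
move=> k0 h; rewrite -(ger0_norm k0) -normrM mulrBr ger0_norm// ler_norml.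
have := ler_norm (k * x - k * m); have := ler_norm (- (k * x - k * m)).
by rewrite normrN; case/orP : h => /andP[h1 h2] n1 n2; apply/andP; split; lra.
Qed.

Lemma is_right_derive_ex (R : realType) (c : R -> R) (eps l : R) :
  (forall e : R, 0 < e -> exists2 d : R, 0 < d & forall h, 0 < h -> h < d ->
    `|c (eps + h) - c eps - l * h| <= e * h) -> is_right_derive c eps l.
Proof.
move=> hc; rewrite /is_right_derive; apply/cvgrPdist_le => e e0.
have [d d0 hd] := hc e e0; near=> h.
have h0 : 0 < h by near: h; exact: nbhs_right_gt.
have hhd : h < d by near: h; exact: nbhs_right_lt.
rewrite /diff_quot distrC (_ : _ - l = h^-1 * (c (eps + h) - c eps - l * h)).
  by rewrite normrM gtr0_norm ?invr_gt0// mulrC ler_pdivrMr// hd.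
by field; rewrite gt_eqF.
Unshelve. all: by end_near. Qed.

Lemma is_left_derive_ex (R : realType) (c : R -> R) (eps l : R) :
  (forall e : R, 0 < e -> exists2 d : R, 0 < d & forall h, 0 < h -> h < d ->
    `|c eps - c (eps - h) - l * h| <= e * h) -> is_left_derive c eps l.
Proof.
move=> hc; rewrite /is_left_derive; apply/cvgrPdist_le => e e0.
have [d d0 hd] := hc e e0; near=> h.
have h0 : h < 0 by near: h; exact: nbhs_left_lt.
have hhd : - d < h by near: h; apply: nbhs_left_gt; rewrite oppr_lt0.
rewrite /diff_quot distrC.
rewrite (_ : _ - l = (- h)^-1 * (c eps - c (eps - (- h)) - l * (- h))); last first.
  by rewrite opprK; field; rewrite lt_eqF.
have nh0 : 0 < - h by rewrite oppr_gt0.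
by rewrite normrM gtr0_norm ?invr_gt0// mulrC ler_pdivrMr// hd// ltrNl.
Unshelve. all: by end_near. Qed.

Section EnvelopeDerivative.
Context {R : realType}.
Variable K : R -> R -> Prop.
Hypothesis K_ge0 : forall a b, K a b -> 0 <= a /\ 0 <= b.
Hypothesis K_up : forall a b a' b' : R, K a b -> a <= a' -> b <= b' -> K a' b'.
Hypothesis K_closed : forall a b : R, (forall e : R, 0 < e -> K (a + e) (b + e)) -> K a b.
Hypothesis K_nonempty : exists a b, K a b.
Let c (eps : R) := envelope K (eps ^+ 2).
Let m (eps : R) := min_rate K (eps ^+ 2).
Let M (eps : R) := max_rate K (eps ^+ 2).

Lemma envelope_sqr_increment s t b b' : 0 <= s -> s < t ->
  optimal_rates K (s ^+ 2) b -> optimal_rates K (t ^+ 2) b' ->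
  b' <= b /\ (t ^+ 2 - s ^+ 2) * b' <= c t - c s <= (t ^+ 2 - s ^+ 2) * b.
Proof.
move=> s0 st [a h] [a' h'].
have st2 : s ^+ 2 < t ^+ 2 by rewrite ltr_sqr ?nnegrE// ltW// (le_lt_trans s0).
split; first exact: (optimal_antitone K_ge0 (sqr_ge0 s) st2 h h').
exact: (optimal_le K_ge0 (sqr_ge0 s) (ltW st2) h h').
Qed.

Lemma sqr_positive (eps : R) : 0 < eps -> 0 < eps ^+ 2. Proof. exact: exprn_gt0. Qed.

Lemma min_rate_sqr eps : 0 < eps -> optimal_rates K (eps ^+ 2) (m eps).
Proof. by move=> /sqr_positive; exact: min_rate_optimal. Qed.

Lemma max_rate_sqr eps : 0 < eps -> optimal_rates K (eps ^+ 2) (M eps).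
Proof. by move=> /sqr_positive; exact: max_rate_optimal. Qed.

Lemma optimal_rates_ge0 eps b : 0 < eps -> optimal_rates K (eps ^+ 2) b -> 0 <= b.
Proof. by move=> /sqr_positive e0 /(optimal_rates_bound K_ge0 e0)/andP[]. Qed.

Lemma optimal_rates_near_sqr eps e : 0 < eps -> 0 < e -> exists2 r : R, 0 < r /\ r <= eps &
  forall h b, `|h| < r -> optimal_rates K ((eps + h) ^+ 2) b -> m eps - e <= b <= M eps + e.
Proof.
move=> eps0 e0.
have [d d0 hd] := optimal_rates_near K_ge0 K_up K_closed K_nonempty (sqr_positive eps0) e0.
have [r r0 hr] := sqr_near eps0 d0.
by exists r => // h b hh hb; apply: (hd _ _ (hr h hh) hb).
Qed.

(** The difference quotient in eps^2 lies between the least rates at eps and at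
eps + h, which are close by [optimal_rates_near_sqr]. *)
Lemma right_expansion eps : 0 < eps -> forall e : R, 0 < e ->
  exists2 d : R, 0 < d & forall h, 0 < h -> h < d ->
    `|c (eps + h) - c eps - 2 * eps * m eps * h| <= e * h.
Proof.
move=> eps0 e e0.
have e60 : 0 < e / (6 * eps) by rewrite divr_gt0// mulr_gt0.
have [r [r0 re] hr] := optimal_rates_near_sqr eps0 e60.
have m0 := optimal_rates_ge0 eps0 (min_rate_sqr eps0).
have m10 : 0 < m eps + 1 by rewrite ltr_wpDl.
exists (Num.min r (e / 2 / (m eps + 1))); first by rewrite lt_min r0 !divr_gt0.
move=> h h0; rewrite lt_min => /andP[hr1 hr2].
have eh0 : 0 < eps + h by rewrite addr_gt0.
have epsh : eps < eps + h by rewrite ltrDl.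
have [mm h1] := envelope_sqr_increment (ltW eps0) epsh (min_rate_sqr eps0) (min_rate_sqr eh0).
have h2 : h * (m eps + 1) <= e / 2 by rewrite -ler_pdivlMr// ltW.
have /andP[h3 _] : m eps - e / (6 * eps) <= m (eps + h) <= M eps + e / (6 * eps).
  by apply: hr (min_rate_sqr eh0); rewrite gtr0_norm.
have he := le_trans (ltW hr1) re.
apply: (quot_arith (w := 2 * eps + h) (x := m (eps + h)) eps0 h0 _ _ _ m0 e0 h2).
- by rewrite addr_ge0 ?mulr_ge0// ltW.
- by lra.
- by rewrite addrAC subrr add0r gtr0_norm.
- by rewrite distrC ger0_norm ?subr_ge0// lerBlDl -lerBlDr.
apply: dist_between; first by rewrite mulr_ge0 ?addr_ge0 ?mulr_ge0// ltW.
by apply/orP; left; rewrite (_ : h * _ = (eps + h) ^+ 2 - eps ^+ 2)//; ring.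
Qed.

Lemma left_expansion eps : 0 < eps -> forall e : R, 0 < e ->
  exists2 d : R, 0 < d & forall h, 0 < h -> h < d ->
    `|c eps - c (eps - h) - 2 * eps * M eps * h| <= e * h.
Proof.
move=> eps0 e e0.
have e60 : 0 < e / (6 * eps) by rewrite divr_gt0// mulr_gt0.
have [r [r0 re] hr] := optimal_rates_near_sqr eps0 e60.
have m0 := optimal_rates_ge0 eps0 (max_rate_sqr eps0).
have m10 : 0 < M eps + 1 by rewrite ltr_wpDl.
exists (Num.min r (e / 2 / (M eps + 1))); first by rewrite lt_min r0 !divr_gt0.
move=> h h0; rewrite lt_min => /andP[hr1 hr2].
have eh0 : 0 < eps - h by rewrite subr_gt0 (lt_le_trans hr1).
have epsh : eps - h < eps by rewrite ltrBlDr ltrDl.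
have [mm h1] := envelope_sqr_increment (ltW eh0) epsh (max_rate_sqr eh0) (max_rate_sqr eps0).
have h2 : h * (M eps + 1) <= e / 2 by rewrite -ler_pdivlMr// ltW.
have /andP[_ h3] : m eps - e / (6 * eps) <= M (eps - h) <= M eps + e / (6 * eps).
  by apply: hr (max_rate_sqr eh0); rewrite normrN gtr0_norm.
have he := le_trans (ltW hr1) re.
apply: (quot_arith (w := 2 * eps - h) (x := M (eps - h)) eps0 h0 _ _ _ m0 e0 h2).
- by lra.
- by lra.
- by rewrite addrAC subrr add0r normrN gtr0_norm.
- by rewrite ger0_norm ?subr_ge0// lerBlDl.
apply: dist_between; first by rewrite mulr_ge0 ?(ltW h0)//; lra.
by apply/orP; right; rewrite (_ : h * _ = eps ^+ 2 - (eps - h) ^+ 2)//; ring.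
Qed.

Lemma envelope_right_derive eps : 0 < eps -> is_right_derive c eps (2 * eps * m eps).
Proof. by move=> eps0; apply: is_right_derive_ex; exact: right_expansion. Qed.

Lemma envelope_left_derive eps : 0 < eps -> is_left_derive c eps (2 * eps * M eps).
Proof. by move=> eps0; apply: is_left_derive_ex; exact: left_expansion. Qed.

Lemma right_deriveE eps : 0 < eps -> right_derive c eps = 2 * eps * m eps.
Proof. by move=> eps0; apply/cvg_lim => //; exact: envelope_right_derive. Qed.

Lemma left_deriveE eps : 0 < eps -> left_derive c eps = 2 * eps * M eps.
Proof. by move=> eps0; apply/cvg_lim => //; exact: envelope_left_derive. Qed.

Lemma right_derive_right_continuous eps : 0 < eps ->
  right_derive c e @[e --> eps^'+] --> right_derive c eps.
Proof.
move=> eps0; rewrite right_deriveE//.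
suff hm : m e @[e --> eps^'+] --> m eps.
  have : 2 * e * m e @[e --> eps^'+] --> 2 * eps * m eps.
    apply: cvgM => //; apply: cvgM; first exact: cvg_cst.
    by apply: cvg_at_right_filter; exact: cvg_id.
  apply: cvg_trans; apply: near_eq_cvg; near=> e; rewrite right_deriveE//.
  by apply: lt_trans eps0 _; near: e; exact: nbhs_right_gt.
apply/cvgrPdist_le => e e0; have [r [r0 re] hr] := optimal_rates_near_sqr eps0 e0.
near=> s.
have s0 : eps < s by near: s; exact: nbhs_right_gt.
have sr : s < eps + r by near: s; apply: nbhs_right_lt; rewrite ltrDl.
have s00 := lt_trans eps0 s0.
have [h1 _] := envelope_sqr_increment (ltW eps0) s0 (min_rate_sqr eps0) (min_rate_sqr s00).
rewrite ger0_norm ?subr_ge0// lerBlDl -lerBlDr.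
have /andP[//] : m eps - e <= m s <= M eps + e.
apply: (hr (s - eps)); first by rewrite gtr0_norm ?subr_gt0// ltrBlDl.
by rewrite addrC subrK; exact: min_rate_sqr.
Unshelve. all: by end_near. Qed.

Lemma left_derive_left_continuous eps : 0 < eps ->
  left_derive c e @[e --> eps^'-] --> left_derive c eps.
Proof.
move=> eps0; rewrite left_deriveE//.
suff hm : M e @[e --> eps^'-] --> M eps.
  have : 2 * e * M e @[e --> eps^'-] --> 2 * eps * M eps.
    apply: cvgM => //; apply: cvgM; first exact: cvg_cst.
    by apply: cvg_at_left_filter; exact: cvg_id.
  by apply: cvg_trans; apply: near_eq_cvg; near=> e; rewrite left_deriveE.
apply/cvgrPdist_le => e e0; have [r [r0 re] hr] := optimal_rates_near_sqr eps0 e0.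
near=> s.
have s0 : s < eps by near: s; exact: nbhs_left_lt.
have sr : eps - r < s by near: s; apply: nbhs_left_gt; rewrite ltrBlDr ltrDl.
have s00 : 0 < s by apply: le_lt_trans sr; rewrite subr_ge0.
have [h1 _] := envelope_sqr_increment (ltW s00) s0 (max_rate_sqr s00) (max_rate_sqr eps0).
rewrite distrC ger0_norm ?subr_ge0// lerBlDl.
have /andP[//] : m eps - e <= M s <= M eps + e.
apply: (hr (s - eps)); last by rewrite addrC subrK; exact: max_rate_sqr.
by rewrite distrC gtr0_norm ?subr_gt0// ltrBlDl -ltrBlDr.
Unshelve. all: by end_near. Qed.

End EnvelopeDerivative.

(** * Absolute continuity of the envelope *)

Section EnvelopeAbsCont.
Context {R : realType}.
Local Notation mu := (@lebesgue_measure R).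
Variable K : R -> R -> Prop.
Hypothesis K_ge0 : forall a b, K a b -> 0 <= a /\ 0 <= b.
Hypothesis K_up : forall a b a' b' : R, K a b -> a <= a' -> b <= b' -> K a' b'.
Hypothesis K_closed : forall a b : R, (forall e : R, 0 < e -> K (a + e) (b + e)) -> K a b.
Hypothesis K_nonempty : exists a b, K a b.
Let c (eps : R) := envelope K (eps ^+ 2).
Let m (eps : R) := min_rate K (eps ^+ 2).
Let f (eps : R) := 2 * eps * m eps.

Lemma envelope_nondecreasing s t : 0 <= s -> s <= t -> c s <= c t.
Proof.
move=> s0 st; apply: (envelope_ge K_nonempty) => a b k; have [_ b0] := K_ge0 k.
apply: le_trans (envelope_le K_ge0 (sqr_ge0 s) k) _; rewrite lerD2l ler_wpM2r//.
by rewrite ler_sqr ?nnegrE// (le_trans s0).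
Qed.

(** The infimum at 0 is approached by a single affine function, continuous at 0. *)
Lemma envelope_continuous0 e : 0 < e ->
  exists2 d : R, 0 < d & forall s, 0 <= s -> s < d -> c s <= c 0 + e.
Proof.
move=> e0; have e20 : 0 < e / 2 by rewrite divr_gt0.
have [a [b [k]]] := envelope_approx K_nonempty (0 ^+ 2) e20; have [_ b0] := K_ge0 k.
rewrite {1}expr2 !mul0r addr0 => ha.
have b10 : 0 < b + 1 by rewrite ltr_wpDl.
exists (Num.min 1 (e / 2 / (b + 1))); first by rewrite lt_min ltr01 !divr_gt0.
move=> s s0; rewrite lt_min ltr_pdivlMr// => /andP[s1 s2].
apply: le_trans (envelope_le K_ge0 (sqr_ge0 s) k) _.
have h : s ^+ 2 * b <= s * b by rewrite ler_wpM2r// expr2 ler_piMl// ltW.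
by move: ha; rewrite -/(c 0); lra.
Qed.

Lemma min_rate_antitone s t : 0 < s -> s <= t -> m t <= m s.
Proof.
move=> s0; rewrite le_eqVlt => /predU1P[->//|st].
have t0 := lt_trans s0 st.
by have [] := envelope_sqr_increment K_ge0 (ltW s0) st
  (min_rate_sqr K_ge0 K_up K_closed K_nonempty s0)
  (min_rate_sqr K_ge0 K_up K_closed K_nonempty t0).
Qed.

Lemma min_rate_ge0 s : 0 < s -> 0 <= m s.
Proof. by move=> s0; apply: (optimal_rates_ge0 K_ge0 s0); exact: min_rate_sqr. Qed.

Lemma right_slope_ge0 s : 0 < s -> 0 <= f s.
Proof. by move=> s0; rewrite /f mulr_ge0 ?min_rate_ge0// mulr_ge0// ltW. Qed.

Lemma measurable_right_slope s t : 0 < s -> measurable_fun (`[s, t]%classic : set R) f.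
Proof.
move=> s0.
apply: (eq_measurable_fun (fun r : R => (2 * r) * - (- m (Num.max s r)) : R)).
  by move=> r; rewrite inE/= in_itv/= => /andP[sr _]; rewrite /f opprK max_r.
apply: measurable_funM; first exact: measurable_funM.
apply: measurableT_comp => //; apply: nondecreasing_measurable => //.
move=> r r' rr'; rewrite lerN2; apply: min_rate_antitone; first by rewrite lt_max s0.
by rewrite ge_max le_max lexx/= le_max rr' orbT.
Qed.

Lemma envelope_lipschitz s t : 0 < s -> s <= t -> forall x y, s <= x -> x <= y -> y <= t ->
  0 <= c y - c x <= 2 * t * m s * (y - x).
Proof.
move=> s0 st x y sx xy yt; have x0 := lt_le_trans s0 sx.
rewrite subr_ge0 envelope_nondecreasing ?(ltW x0)//=.
move: xy; rewrite le_eqVlt => /predU1P[<-|xy]; first by rewrite !subrr mulr0.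
have y0 := lt_trans x0 xy.
have [_ /andP[_ h]] := envelope_sqr_increment K_ge0 (ltW x0) xy
  (min_rate_sqr K_ge0 K_up K_closed K_nonempty x0)
  (min_rate_sqr K_ge0 K_up K_closed K_nonempty y0).
apply: le_trans h _; rewrite -/(m x) mulrAC.
apply: ler_pM; rewrite ?min_rate_ge0 ?min_rate_antitone//.
  by rewrite subr_ge0 ler_sqr ?nnegrE ltW.
rewrite subr_sqr mulrC ler_wpM2r ?subr_ge0 ?(ltW xy)//; move: (ltW xy); lra.
Qed.

(** Away from 0 the envelope is Lipschitz, hence the integral of its derivative,
which exists almost everywhere and must then be the right derivative. *)
Lemma envelope_integral_gt0 s t : 0 < s -> s < t ->
  (\int[mu]_(r in `[s, t]) (f r)%:E = (c t - c s)%:E)%E.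
Proof.
move=> s0 st; pose k := 2 * t * m s.
have ec : energy_controlled s t (\1_(`[s, t[%classic : set R)) (fun x => k ^+ 2 * x)
    (fun x y => c y - c x).
  split; first exact: integrable_indic_itv.
    by move=> r sr rt; rewrite indicE mem_set//= in_itv/= sr.
  move=> x y sx xy yt; rewrite Rintegral_indic_itvco// -mulrBr.
  have /andP[h1 h2] := envelope_lipschitz s0 (ltW st) sx xy yt.
  rewrite mulrCA -expr2 -exprMn ler_sqr ?nnegrE//; exact: le_trans h2.
have [h hi hc] := energy_controlled_ac st ec.
have aeh := ae_is_deriv hi hc.
have /measurable_EFinP mh := measurable_int mu hi.
have mf : measurable_fun (`[s, t[%classic : set R) f.
  have := @measurable_right_slope s t s0; apply: measurable_funS => //.
  by apply: subset_itvl; rewrite bnd_simp.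
rewrite -integral_itv_bndo_bndc; last exact/measurable_EFinP.
rewrite (hc s t)//; last exact: ltW.
rewrite /Rintegral fineK; last first.
  apply: integrable_fin_num => //; exact: integrableS hi.
apply: ae_eq_integral => //; [exact/measurable_EFinP|apply/measurable_EFinP; exact: measurable_funS mh|].
apply: (ae_sub (ae_and aeh (ae_ne s))) => r [hr rs] /=; rewrite in_itv/= => /andP[sr rt].
have sr' : s < r by rewrite lt_neqAle sr andbT eq_sym; exact/eqP.
have r0 := lt_trans s0 sr'.
congr (_%:E); apply/eqP; rewrite -subr_eq0 -normr_le0; apply/ler_addgt0Pr => /= e e0.
rewrite add0r; have e20 : 0 < e / 2 by rewrite divr_gt0.
have [d1 d10 h1] := right_expansion K_ge0 K_up K_closed K_nonempty r0 e20.
have [d2 d20 h2] := hr sr' rt _ e20.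
pose x := Num.min (d1 / 2) (d2 / 2).
have x0 : 0 < x by rewrite lt_min !divr_gt0.
have xd1 : x < d1 by rewrite gt_min; apply/orP; left; lra.
have xd2 : x < d2 by rewrite gt_min; apply/orP; right; lra.
have := h1 x x0 xd1; have := h2 (r + x).
rewrite (_ : r + x - r = x); last by ring.
rewrite gtr0_norm// => /(_ xd2); rewrite -/(c _) -/(c _) -/(m _) -/(f _) => g2 g1.
rewrite -(ler_pM2r x0) -{1}(gtr0_norm x0) -normrM.
rewrite (_ : (f r - h r) * x = (c (r + x) - c r - h r * x) - (c (r + x) - c r - f r * x)); last by ring.
apply: le_trans (ler_normB _ _) _; rewrite [in leRHS](splitr e) mulrDl.
by rewrite lerD.
Qed.

Lemma bigcup_itv_right (t : R) : 0 < t ->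
  \bigcup_n `[t / n.+2%:R, t]%classic = (`]0, t]%classic : set R).
Proof.
move=> t0; apply/seteqP; split => r /=.
  move=> [n _] /=; rewrite !in_itv/= => /andP[h ->]; rewrite andbT.
  by apply: lt_le_trans h; rewrite divr_gt0.
rewrite in_itv/= => /andP[r0 rt]; have [N [N0 hN]] := ex_div_lt (ltW t0) r0.
exists N => //=; rewrite in_itv/= rt andbT; apply: le_trans (ltW hN).
by rewrite ler_wpM2l ?(ltW t0)// lef_pV2 ?posrE ?ltr0n// ler_nat ltnW.
Qed.

Lemma measurable_right_slope0 t : 0 < t -> measurable_fun (`]0, t]%classic : set R) f.
Proof.
move=> t0; rewrite -bigcup_itv_right//; apply/measurable_fun_bigcup => // n.
by apply: measurable_right_slope; rewrite divr_gt0.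
Qed.

(** Monotone convergence on the left, continuity at 0 on the right. *)
Lemma envelope_integral0 t : 0 < t ->
  (\int[mu]_(r in `[0%R, t]) (f r)%:E = (c t - c 0)%:E)%E.
Proof.
move=> t0; rewrite -integral_itv_obnd_cbnd; last by apply/measurable_EFinP; exact: measurable_right_slope0.
rewrite -bigcup_itv_right//.
have s0 n : 0 < t / n.+2%:R by rewrite divr_gt0.
have st n : t / n.+2%:R < t by rewrite ltr_pdivrMr// ltr_pMr// ltr1n.
have H : (\int[mu]_(x in `[(t / n.+2%:R)%R, t]) (f x)%:E @[n --> \oo] -->
    \int[mu]_(x in \bigcup_n `[(t / n.+2%:R)%R, t]%classic) (f x)%:E)%E.
  apply: ge0_nondecreasing_set_cvg_integral.
  - move=> i j ij; apply/subsetPset/subset_itv; rewrite bnd_simp//.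
    by rewrite ler_wpM2l ?(ltW t0)// lef_pV2 ?posrE// ler_nat.
  - by move=> i; exact: measurable_itv.
  - by move=> i; apply/measurable_EFinP; exact: measurable_right_slope.
  - move=> i x /=; rewrite in_itv/= => /andP[h _]; rewrite lee_fin right_slope_ge0//.
    exact: lt_le_trans h.
have L : ((c t - c (t / n.+2%:R))%:E @[n --> \oo] --> (c t - c 0)%:E)%E.
  apply: cvg_EFin; first exact: nearW.
  apply/cvgrPdist_le => e e0 /=; have [d d0 hd] := envelope_continuous0 e0.
  have [N [N0 hN]] := ex_div_lt (ltW t0) d0.
  exists N => // n /= Nn; have h : t / n.+2%:R < d.
    apply: le_lt_trans hN; rewrite ler_wpM2l ?(ltW t0)// lef_pV2 ?posrE ?ltr0n//.
    by rewrite ler_nat (leq_trans Nn)// -addn2 leq_addr.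
  have h1 := hd _ (ltW (s0 n)) h; have h2 := envelope_nondecreasing (lexx 0) (ltW (s0 n)).
  by rewrite ler_norml; apply/andP; split; lra.
apply: cvg_unique H _ => //=; apply: cvg_trans L; apply: near_eq_cvg; apply: nearW => n.
by rewrite envelope_integral_gt0.
Qed.

Lemma envelope_integral s t : 0 <= s -> s < t ->
  (\int[mu]_(r in `[s, t]) (f r)%:E = (c t - c s)%:E)%E.
Proof.
rewrite le_eqVlt => /predU1P[<-|]; first exact: envelope_integral0.
exact: envelope_integral_gt0.
Qed.

Lemma envelope_abs_cont : abs_cont_loc `[0, +oo[ (c : R -> R^o).
Proof.
move=> a b ab sub.
have a0 : 0 <= a by have /sub : `[a, b]%classic a; rewrite /= !in_itv/= ?lexx// andbT.
(* b + 1 rather than b keeps the interval nondegenerate when b = 0. *)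
have b10 : 0 < b + 1 by rewrite ltr_wpDl// (le_trans a0).
have fi : mu.-integrable `[0, b + 1] (EFin \o f).
  have mf : measurable_fun (`[0, b + 1]%classic : set R) f.
    by apply/measurable_fun_itv_obnd_cbndP; exact: measurable_right_slope0.
  apply/integrableP; split; first exact/measurable_EFinP.
  apply: (@le_lt_trans _ _ (c (b + 1) - c 0)%:E); last exact: ltry.
  rewrite -envelope_integral0// le_eqVlt; apply/orP; left; apply/eqP.
  apply: eq_integral => r; rewrite inE/= in_itv/= => /andP[r0 _].
  rewrite ger0_norm//; move: r0; rewrite le_eqVlt => /predU1P[<-|/right_slope_ge0//].
  by rewrite /f mulr0 mul0r.
exists f.
  apply: integrableS fi => //; apply: subset_itv; rewrite bnd_simp//.
  by rewrite lerDl.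
move=> s t as_ st tb; have s0 := le_trans a0 as_.
rewrite (_ : mdist _ _ = c t - c s); last first.
  by change (`|c t - c s| = c t - c s); rewrite ger0_norm ?subr_ge0 ?envelope_nondecreasing.
move: st; rewrite le_eqVlt => /predU1P[<-|st].
  by rewrite subrr set_itv1 Rintegral_set1.
by rewrite /Rintegral envelope_integral.
Qed.

End EnvelopeAbsCont.

(** * The cost as an envelope *)

Section CostEnvelope.
Context {R : realType} {X : metricType R}.
Local Notation mu := (@lebesgue_measure R).
Variable E : X -> \bar R.

Lemma ucont01_continuous (gamma : R -> X) : ucont01 gamma -> {within `[0, 1], continuous gamma}.
Proof.
move=> uc; apply/subspace_continuousP => t /=; rewrite in_itv/= => /andP[t0 t1].
apply/metricType_numDomainType.cvgrPdist_le => e e0; have [d d0 hd] := uc e e0.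
rewrite near_withinE; have := nbhsx_ballx t d d0; apply: filterS.
move=> s /= ts; rewrite in_itv/= => /andP[s0 s1].
have : `|t - s| < d by exact: ts.
have [st|/ltW st] := leP s t.
  by rewrite ger0_norm ?subr_ge0// => h; rewrite metric_sym; exact: hd.
by rewrite distrC ger0_norm ?subr_ge0// => h; exact: hd.
Qed.

Lemma fisher_ge0 gamma : (0 <= fisher E gamma)%E.
Proof.
rewrite /fisher mule_ge0//; apply: integral_ge0 => t _.
by rewrite mule_ge0// (slope_ge0 E).
Qed.

Lemma action_ge0 (gamma : R -> X) : (0 <= action gamma)%E.
Proof.
rewrite /action; case: asboolP => // _; rewrite mule_ge0//; apply: integral_ge0 => t _.
by rewrite lee_fin sqr_ge0.
Qed.

Lemma attainable_curve x y a b : attainable E x y a b -> exists gamma : R -> X,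
  [/\ AC2 gamma, curves_between x y gamma, (action gamma <= a%:E)%E & (fisher E gamma <= b%:E)%E].
Proof.
move=> [g [V [em g0 g1 ha hb]]]; have [ac h] := energy_mod_action em.
exists g; split => //; last by apply: le_trans h _; rewrite lee_fin.
by split => //; apply: ucont01_continuous; exact: energy_mod_ucont em.
Qed.

Lemma curve_attainable x y (gamma : R -> X) : gamma 0 = x -> gamma 1 = y ->
  (action gamma < +oo)%E -> (fisher E gamma < +oo)%E ->
  attainable E x y (fine (action gamma)) (fine (fisher E gamma)).
Proof.
move=> g0 g1 ha hb; have [V [em aE _]] := action_energy_mod ha.
exists gamma, V; split => //; first by rewrite aE.
by rewrite fineK// ge0_fin_numE// fisher_ge0.
Qed.

Lemma attainable_ge0 x y a b : attainable E x y a b -> 0 <= a /\ 0 <= b.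
Proof.
move=> [g [V [em g0 g1 ha hb]]]; split.
  apply: le_trans ha; rewrite mulr_ge0// subr_ge0.
  exact: path_mod_mono em (lexx 0) ler01 (lexx 1).
by rewrite -lee_fin (le_trans (fisher_ge0 g)).
Qed.

Lemma attainable_up x y (a b a' b' : R) : attainable E x y a b -> a <= a' -> b <= b' ->
  attainable E x y a' b'.
Proof.
move=> [g [V [em g0 g1 ha hb]]] aa bb; exists g, V; split => //.
  exact: le_trans aa.
by apply: le_trans hb _; rewrite lee_fin.
Qed.

Lemma action_eps_finite eps gamma : (action_eps E eps gamma < +oo)%E ->
  (action gamma < +oo)%E /\ (eps != 0 -> (fisher E gamma < +oo)%E).
Proof.
have e2 : (0 <= (eps ^+ 2)%:E)%E by rewrite lee_fin sqr_ge0.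
have f0 := fisher_ge0 gamma; have a0 := action_ge0 gamma.
move=> h; split.
  by apply: le_lt_trans h; rewrite /action_eps leeDl// mule_ge0.
move=> eps0; rewrite ltey; apply/eqP => foo; move: h; rewrite /action_eps foo gt0_muley.
  by rewrite addey// -ltNye (lt_le_trans _ a0).
by rewrite lte_fin exprn_even_gt0.
Qed.

Variables (x y : X).
Hypothesis recover : forall gamma : R -> X, gamma 0 = x -> gamma 1 = y ->
  (action gamma < +oo)%E -> forall delta : R, 0 < delta ->
  exists b, attainable E x y (fine (action gamma) + delta) b.
Hypothesis nonempty : exists a b, attainable E x y a b.
Let K := attainable E x y.

(** For eps = 0 a curve of infinite Fisher integral still competes in the cost,
since 0 * +oo = 0; the hypothesis [recover] shows that it gains nothing. *)
Lemma cost_envelope eps : cost E eps x y = (envelope K (eps ^+ 2))%:E.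
Proof.
apply/eqP; rewrite eq_le; apply/andP; split.
  apply/lee_addgt0Pr => e e0; have [a [b [k h]]] := envelope_approx nonempty (eps ^+ 2) e0.
  have [g [_ gb ha hb]] := attainable_curve k.
  apply: (@le_trans _ _ (action_eps E eps g)); first by apply: ereal_inf_lbound; exists g.
  apply: (@le_trans _ _ (a%:E + (eps ^+ 2)%:E * b%:E)%E).
    by rewrite leeD// lee_wpmul2l// lee_fin sqr_ge0.
  by rewrite -EFinM -!EFinD lee_fin.
apply: le_ereal_inf_tmp => _ [g [_ g0 g1] <-].
have [->|/eqP] := eqVneq (action_eps E eps g) +oo%E; first by rewrite leey.
move=> /eqP; rewrite -ltey => /action_eps_finite[ha hf].
have afin : action g \is a fin_num by rewrite ge0_fin_numE// action_ge0.
have [e0|e0] := eqVneq eps 0.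
  rewrite /action_eps e0 expr0n/= mul0e adde0 -(fineK afin) lee_fin.
  apply/ler_addgt0Pr => /= d d0; have [b k] := recover g0 g1 ha d0.
  have := envelope_le (@attainable_ge0 x y) (lexx 0) k; rewrite mul0r addr0; exact.
have {}hf := hf e0; have ffin : fisher E g \is a fin_num by rewrite ge0_fin_numE// fisher_ge0.
rewrite /action_eps -(fineK afin) -(fineK ffin) -EFinM -EFinD lee_fin.
apply: (envelope_le (@attainable_ge0 x y)); first exact: sqr_ge0.
exact: curve_attainable.
Qed.

Lemma minimizer_optimal eps omega : 0 < eps -> minimizers E eps x y omega ->
  exists2 b, fisher E omega = b%:E & optimal_rates K (eps ^+ 2) b.
Proof.
move=> eps0 [_ o0 o1 oE].
have [ha hf] : (action omega < +oo)%E /\ (eps != 0 -> (fisher E omega < +oo)%E).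
  by apply: action_eps_finite; rewrite oE cost_envelope ltry.
have {}hf := hf (lt0r_neq0 eps0).
have afin : action omega \is a fin_num by rewrite ge0_fin_numE// action_ge0.
have ffin : fisher E omega \is a fin_num by rewrite ge0_fin_numE// fisher_ge0.
exists (fine (fisher E omega)); first by rewrite fineK.
exists (fine (action omega)); split; first exact: curve_attainable.
by apply: EFin_inj; rewrite EFinD EFinM !fineK// -cost_envelope.
Qed.

(** Both the action and the Fisher integral of an attaining curve must be equal
to their bounds, since eps^2 > 0. *)
Lemma optimal_minimizer eps b : 0 < eps -> optimal_rates K (eps ^+ 2) b ->
  exists2 omega, minimizers E eps x y omega & fisher E omega = b%:E.
Proof.
move=> eps0 [a [k h]]; have [g [ac gb ha hb]] := attainable_curve k.
have [gc g0 g1] := gb.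
have afin : action g \is a fin_num by rewrite ge0_fin_numE ?action_ge0// (le_lt_trans ha)// ltry.
have ffin : fisher E g \is a fin_num by rewrite ge0_fin_numE ?fisher_ge0// (le_lt_trans hb)// ltry.
have e20 : 0 < eps ^+ 2 by rewrite exprn_gt0.
have hval : ((envelope K (eps ^+ 2))%:E <= action_eps E eps g)%E.
  by rewrite -cost_envelope; apply: ereal_inf_lbound; exists g.
move: ha hb hval; rewrite /action_eps -(fineK afin) -(fineK ffin) -EFinM -EFinD !lee_fin -h.
set A := fine (action g); set I := fine (fisher E g) => ha hb hval.
have hI : eps ^+ 2 * I <= eps ^+ 2 * b by rewrite ler_wpM2l// ltW.
have eI : I = b.
  by apply/eqP; rewrite eq_le hb/= -(ler_pM2l e20); lra.
exists g; last by rewrite -eI fineK.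
split => //; rewrite cost_envelope /action_eps -(fineK afin) -(fineK ffin) -EFinM -EFinD.
congr (_%:E); rewrite -h -/A -/I; move: hval; rewrite eI lerD2r => hval.
by congr (_ + _); apply/eqP; rewrite eq_le ha.
Qed.

Hypothesis K_closed : forall a b : R, (forall e : R, 0 < e -> K (a + e) (b + e)) -> K a b.

Lemma fisher_max eps : 0 < eps ->
  is_max_over (fisher E) (minimizers E eps x y) (max_rate K (eps ^+ 2)).
Proof.
move=> eps0; split.
  have [|g gm gE] := @optimal_minimizer eps (max_rate K (eps ^+ 2)) eps0.
    exact: (max_rate_sqr (@attainable_ge0 x y) (@attainable_up x y) K_closed nonempty eps0).
  by exists g.
move=> _ [g /(minimizer_optimal eps0)[b -> hb] <-]; rewrite lee_fin.
by apply: (max_rate_ge (@attainable_ge0 x y)) => //; exact: exprn_gt0.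
Qed.

Lemma fisher_min eps : 0 < eps ->
  is_min_over (fisher E) (minimizers E eps x y) (min_rate K (eps ^+ 2)).
Proof.
move=> eps0; split.
  have [|g gm gE] := @optimal_minimizer eps (min_rate K (eps ^+ 2)) eps0.
    exact: (min_rate_sqr (@attainable_ge0 x y) (@attainable_up x y) K_closed nonempty eps0).
  by exists g.
move=> _ [g /(minimizer_optimal eps0)[b -> hb] <-]; rewrite lee_fin.
by apply: (min_rate_le (@attainable_ge0 x y)) => //; exact: exprn_gt0.
Qed.

End CostEnvelope.

Theorem proposition5p5 (R : realType) (X : metricType R) (E : X -> \bar R)
    (E_proper : forall z, E z != -oo%E)
    (X_complete : metric_complete X) (X_separable : metric_separable X)
    (hA2 : assumption_A2 E) (hA3 : assumption_A3 E) (hS : assumption_S E)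
    (x y : X)
    (hsolv : exists2 eps : R, 0 < eps & schrodinger_solvable E eps x y) :
  let c : R -> R := fun eps => fine (cost E eps x y) in
  [/\ (forall eps : R, 0 <= eps -> cost E eps x y \is a fin_num),
      abs_cont_loc `[0, +oo[ (c : R -> R^o),
      (forall eps : R, 0 < eps ->
        (exists2 M : R, is_max_over (fisher E) (minimizers E eps x y) M &
           is_left_derive c eps (2 * eps * M)) /\
        (exists2 m : R, is_min_over (fisher E) (minimizers E eps x y) m &
           is_right_derive c eps (2 * eps * m))),
      (forall eps : R, 0 < eps ->
        left_derive c e @[e --> eps^'-] --> left_derive c eps) &
      (forall eps : R, 0 < eps ->
        right_derive c e @[e --> eps^'+] --> right_derive c eps)].
Proof.
have [conv hconv] := assumption_S_conv hS.
have [lambda hflows] := hA3; have [S0 flows] := choice hflows.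
have [E_lsc E_dense E_bounded_below] := hA2.
have E_dom : exists z, (E z < +oo)%E.
  have : closure (energy_dom E) x by rewrite E_dense.
  by move=> /(_ setT filterT)[z [hz _]]; exists z.
have [eta [Veta [em [eta0 eta1 aE]]] [ucV feta]] : exists eta, exists2 Veta,
    energy_mod eta Veta /\ [/\ eta 0 = x, eta 1 = y & (action eta < +oo)%E] &
    (forall e : R, 0 < e -> exists2 d : R, 0 < d &
      forall s t, 0 <= s -> s <= t -> t <= 1 -> t - s < d -> Veta t - Veta s <= e) /\
    (fisher E eta < +oo)%E.
  have [eps0 e0 [cfin [eta [_ eta0 eta1] etaE]]] := hsolv.
  have [ha hf] : (action eta < +oo)%E /\ (eps0 != 0 -> (fisher E eta < +oo)%E).
    by apply: action_eps_finite; rewrite etaE ltey_eq cfin.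
  have [V [em aE uc]] := action_energy_mod ha.
  exists eta, V; split => //; exact: hf (lt0r_neq0 e0).
have nonempty : exists a b, attainable E x y a b.
  by exists (fine (action eta)), (fine (fisher E eta)); exact: curve_attainable.
have recover (gamma : R -> X) : gamma 0 = x -> gamma 1 = y ->
    (action gamma < +oo)%E -> forall delta : R, 0 < delta ->
    exists b, attainable E x y (fine (action gamma) + delta) b.
  move=> g0 g1 ha delta d0; have [V [emg gE _]] := action_energy_mod ha.
  rewrite gE/=.
  exact: (recovery E_proper E_lsc E_dom E_bounded_below flows hconv em eta0 eta1 ucV feta
    emg g0 g1 d0).
have K_closed := @attainable_closed _ _ _ _ hconv x y.
pose K_ge0 := @attainable_ge0 _ _ E x y; pose K_up := @attainable_up _ _ E x y.
move=> c; have cE : c = (fun eps => envelope (attainable E x y) (eps ^+ 2)).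
  by apply/funext => eps; rewrite /c (cost_envelope recover nonempty).
split.
- by move=> eps _; rewrite (cost_envelope recover nonempty).
- by rewrite cE; exact: (envelope_abs_cont K_ge0 K_up K_closed nonempty).
- move=> eps eps0; split.
    exists (max_rate (attainable E x y) (eps ^+ 2)); first exact: fisher_max.
    by rewrite cE; exact: (envelope_left_derive K_ge0 K_up K_closed nonempty eps0).
  exists (min_rate (attainable E x y) (eps ^+ 2)); first exact: fisher_min.
  by rewrite cE; exact: (envelope_right_derive K_ge0 K_up K_closed nonempty eps0).
- by rewrite cE; exact: (left_derive_left_continuous K_ge0 K_up K_closed nonempty).
- by rewrite cE; exact: (right_derive_right_continuous K_ge0 K_up K_closed nonempty).
Qed.
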